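(* Let $K\subseteq\mathbb{B}_m$ be a Lebesgue-measurable set with $0<\Lambda(K)<+\infty$. If $c=c(K)$ is the holomorphic barycenter of $K$, then $p(c)$ is the holomorphic barycenter of $p(K)$ for any holomorphic automorphism $p$ of the unit ball $\mathbb{B}_m$.
   Context: On $\mathbb{C}^m$, $\langle z,w\rangle=\sum_{k=1}^m z_k\overline{w_k}$ and $|z|=\sqrt{\langle z,z\rangle}$; $\mathbb{B}_m=\{z\in\mathbb{C}^m:|z|<1\}$. The hyperbolic measure on $\mathbb{B}_m$ is $d\Lambda(z)=\frac{d\lambda(z)}{(1-|z|^2)^{m+1}}$, where $\lambda$ is Lebesgue measure on $\mathbb{C}^m$. For $a\in\mathbb{B}_m$, $$p_a(z)=\frac{a-P_az-s_aQ_az}{1-\langle z,a\rangle},$$ where $P_0=0$ and $P_az=\frac{\langle z,a\rangle}{\langle a,a\rangle}a$ for $a\neq0$, $Q_a=I-P_a$, $s_a=(1-|a|^2)^{1/2}$. Every holomorphic automorphism of $\mathbb{B}_m$ has the form $U\circ p_a$ with $U$ unitary and $a\in\mathbb{B}_m$. For a Lebesgue-measurable set $K\subseteq\mathbb{B}_m$ with $0<\Lambda(K)<+\infty$, the holomorphic barycenter of $K$ is the unique point $c\in\mathbb{B}_m$ such that $\int_K p_c(z)\,d\Lambda(z)=0$. *)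

(* Defs.v *)
From HB Require Import structures.
From mathcomp Require Import all_boot all_order all_algebra.
From mathcomp Require Import all_classical all_reals all_analysis.
From mathcomp Require Import complex.

Set Implicit Arguments.
Unset Strict Implicit.
Unset Printing Implicit Defensive.

Import Order.TTheory GRing.Theory Num.Theory.
Import numFieldNormedType.Exports.

Local Open Scope classical_set_scope.
Local Open Scope ring_scope.
Local Open Scope complex_scope.

(* C^m is represented by row vectors 'rV[R[i]]_m. *)

(* The topology of R[i] is the one given by its modulus. *)
HB.instance Definition _ (R : realType) := NormedModule.copy R[i] R[i]^o.

Section lebesgue_Cm.
Variables (R : realType) (m : nat).
Local Notation V := 'rV[R[i]]_m.

(* Half-open boxes of C^m = R^(2m). The empty box None is redundant unless
   m = 0, where every other box is the whole one-point space. *)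
Definition box (ab : option (V * V)) : set V :=
  if ab is Some (a, b) then
    [set z : V | forall k,
      (complex.Re (a 0 k) < complex.Re (z 0 k) <= complex.Re (b 0 k)) &&
      (complex.Im (a 0 k) < complex.Im (z 0 k) <= complex.Im (b 0 k))]
  else set0.

Definition box_volume (ab : option (V * V)) : R :=
  if ab is Some (a, b) then
    \prod_(k < m)
      (Num.max 0 (complex.Re (b 0 k) - complex.Re (a 0 k)) *
       Num.max 0 (complex.Im (b 0 k) - complex.Im (a 0 k)))
  else 0.

Definition lebesgue_outer (X : set V) : \bar R :=
  ereal_inf [set (\sum_(k <oo) (box_volume (B k))%:E)%E |
    B in [set B : nat -> option (V * V) | X `<=` \bigcup_k box (B k)]].

Lemma box_volume_ge0 ab : 0 <= box_volume ab.
Proof.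
case: ab => [[a b]|] //=; apply: prodr_ge0 => k _.
by apply: mulr_ge0; rewrite le_max lexx.
Qed.

Local Open Scope ereal_scope.

Lemma le_lebesgue_outer :
  {homo lebesgue_outer : A B / A `<=` B >-> A <= B}.
Proof.
move=> A B AB; apply/ereal_inf_le_tmp => x [B' BB' <-].
by exists B' => //; exact: subset_trans AB BB'.
Qed.

Lemma lebesgue_outer_ge0 A : 0 <= lebesgue_outer A.
Proof.
apply: le_ereal_inf_tmp => x [B _ <-]; apply: nneseries_ge0 => n _ _.
by rewrite lee_fin box_volume_ge0.
Qed.

Lemma lebesgue_outer0 : lebesgue_outer set0 = 0.
Proof.
apply/eqP; rewrite eq_le lebesgue_outer_ge0 andbT.
apply: ereal_inf_lbound; exists (fun=> None) => //.
by rewrite eseries0.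
Qed.

Lemma lebesgue_outer_sigma_subadditive : sigma_subadditive lebesgue_outer.
Proof.
pose vol ab : \bar R := (box_volume ab)%:E.
have vol_ge0 ab : 0 <= vol ab by rewrite lee_fin box_volume_ge0.
move=> A; have [[i ioo]|] := pselect (exists i, lebesgue_outer (A i) = +oo).
  rewrite (eseries_pinfty _ _ ioo) ?leey// => n _.
  by rewrite -ltNye (lt_le_trans _ (lebesgue_outer_ge0 _)).
rewrite -forallNE => Aoo.
suff add2e (e : {posnum R}) : lebesgue_outer (\bigcup_n A n) <=
    \sum_(i <oo) lebesgue_outer (A i) + e%:num%:E.
  by apply/lee_addgt0Pr => _/posnumP[].
rewrite (le_trans _ (epsilon_trick _ _ _))//; last first.
  by move=> n; exact: lebesgue_outer_ge0.
pose P n (B : nat -> option (V * V)) := (A n `<=` \bigcup_k box (B k)) /\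
  \sum_(k <oo) vol (B k) <= lebesgue_outer (A n) + (e%:num / (2 ^ n.+1)%:R)%:E.
have [G PG] : {G : nat -> nat -> option (V * V) & forall n, P n (G n)}.
  apply: (@choice _ _ P) => n; rewrite /P /lebesgue_outer.
  set S := (X in ereal_inf X); move infS : (ereal_inf S) => iS.
  case: iS infS => [r Sr|Soo|Soo].
  - have en1 : (0 < e%:num / (2 ^ n.+1)%:R)%R by [].
    have /(lb_ereal_inf_adherent en1) : ereal_inf S \is a fin_num by rewrite Sr.
    move=> [x [B AnB muBx] xS].
    by exists B; split => //; rewrite /vol muBx -Sr; exact/ltW.
  - by have := Aoo n; rewrite /lebesgue_outer Soo.
  - suff : lbound S 0 by move/le_ereal_inf_tmp; rewrite Soo.
    by move=> /= _ [B AnB <-]; apply: nneseries_ge0 => k _ _; exact: vol_ge0.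
have muG_ge0 x : 0 <= (vol \o uncurry G) x by exact: vol_ge0.
apply: (@le_trans _ _ (\esum_(i in setT) (vol \o uncurry G) i)).
  rewrite /lebesgue_outer; apply: ereal_inf_lbound => /=.
  have /card_esym/ppcard_eqP[f] := card_nat2.
  exists (uncurry G \o f).
    apply: (@subset_trans _ (\bigcup_n \bigcup_k box (G n k))) => [t [i _]|].
      by move=> /(PG i).1 -[j _ ?]; exists i => //; exists j.
    move=> t [i _ [j _ Bijt]]; exists (f^-1%FUN (i, j)) => //=.
    by rewrite invK ?inE.
  rewrite -(esum_pred_image (vol \o uncurry G) _ xpredT) ?[fun=> _]set_true//.
  by rewrite image_eq.
rewrite (_ : esum _ _ = \sum_(i <oo) \sum_(j <oo ) vol (G i j)); last first.
  pose J : nat -> set (nat * nat) := fun i => [set (i, j) | j in setT].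
  rewrite (_ : setT = \bigcup_k J k); last first.
    by rewrite predeqE => -[a b]; split => // _; exists a => //; exists b.
  rewrite esum_bigcupT /=; last 2 first.
    - apply/trivIsetP => i j _ _ ij.
      rewrite predeqE => -[n k] /=; split => //= -[] [_] _ [<-{n} _].
      by move=> [m' _] [] /esym/eqP; rewrite (negbTE ij).
    - by move=> /= [n k]; exact: vol_ge0.
  rewrite -(image_id [set: nat]) -fun_true esum_pred_image//; last first.
    by move=> n _; exact: esum_ge0.
  apply: eq_eseriesr => /= j _.
  rewrite -(esum_pred_image (vol \o uncurry G) (pair j) predT)//=; last first.
    by move=> ? ? _ _; exact: (@can_inj _ _ _ snd).
  by congr esum; rewrite predeqE => -[a b]; split; move=> [i _ <-]; exists i.
apply: lee_lim.
- apply: is_cvg_nneseries => n *.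
  by apply: nneseries_ge0 => k *; exact: (muG_ge0 (n, k)).
- apply: is_cvg_nneseries => n *.
  by apply: adde_ge0 => //; exact: lebesgue_outer_ge0.
- by near=> n; apply: lee_sum => i _; exact: (PG i).2.
Unshelve. all: by end_near. Qed.

HB.instance Definition _ := isOuterMeasure.Build R V lebesgue_outer
  lebesgue_outer0 lebesgue_outer_ge0 le_lebesgue_outer
  lebesgue_outer_sigma_subadditive.

End lebesgue_Cm.

Definition lebesgue_outer_measure (R : realType) (m : nat) :
  {outer_measure set 'rV[R[i]]_m -> \bar R} := @lebesgue_outer R m.

(* C^m with its Lebesgue sigma-algebra: the Caratheodory-measurable sets of
   the Lebesgue outer measure, hence a complete sigma-algebra. *)
Definition lebesgue_type (R : realType) (m : nat) :=
  caratheodory_type (lebesgue_outer_measure R m).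

Definition lebesgue_Cm (R : realType) (m : nat) :
  {measure set (lebesgue_type R m) -> \bar R} := lebesgue_outer_measure R m.

Section ball.
Variables (R : realType) (m : nat).
Local Notation V := 'rV[R[i]]_m.
Implicit Types (z w a c : V) (K : set V).

Definition hdot z w : R[i] := \sum_(k < m) z 0 k * (w 0 k)^*.

Definition hnorm z : R := Num.sqrt (complex.Re (hdot z z)).

Definition unit_ball : set V := [set z | hnorm z < 1].

Definition line_proj a z : V := if a == 0 then 0 else (hdot z a / hdot a a) *: a.

Definition ball_involution a z : V :=
  (1 - hdot z a)^-1 *:
    (a - line_proj a z - (Num.sqrt (1 - hnorm a ^+ 2))%:C *: (z - line_proj a z)).

(* The density of the hyperbolic measure, extended by 0 outside the ball. *)
Definition hyperbolic_density : V -> R :=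
  (fun z => (1 - hnorm z ^+ 2) ^- m.+1) \_ unit_ball.

Definition lebesgue_measurable K : Prop :=
  measurable (K : set (lebesgue_type R m)).

Definition hyperbolic_measure K : \bar R :=
  (\int[lebesgue_Cm R m]_(z in K) (hyperbolic_density z)%:E)%E.

(* Integral over K, against the hyperbolic measure, of a C^m-valued function,
   taken on real and imaginary parts of the coordinates. *)
Definition hyperbolic_integral K (f : V -> V) : V :=
  \row_(k < m)
    (Rintegral (lebesgue_Cm R m) K
       (fun z => complex.Re (f z 0 k) * hyperbolic_density z) +i*
     Rintegral (lebesgue_Cm R m) K
       (fun z => complex.Im (f z 0 k) * hyperbolic_density z)).

Definition has_hyperbolic_mass K : Prop :=
  [/\ lebesgue_measurable K, K `<=` unit_ball,
      (0 < hyperbolic_measure K)%E & (hyperbolic_measure K < +oo)%E].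

Definition is_holomorphic_barycenter K c : Prop :=
  has_hyperbolic_mass K /\
  unique (fun a => unit_ball a /\
                   hyperbolic_integral K (ball_involution a) = 0) c.

(* [differentiable] is over the field R[i], i.e. the differential is
   C-linear. *)
Definition holomorphic_on (D : set V) (f : V -> V) : Prop :=
  forall z, D z -> differentiable f z.

(* Only the restriction of p to the ball matters. *)
Definition ball_automorphism (p : V -> V) : Prop :=
  holomorphic_on unit_ball p /\
  exists q : V -> V,
    [/\ holomorphic_on unit_ball q,
        forall z, unit_ball z -> unit_ball (p z),
        forall z, unit_ball z -> unit_ball (q z),
        forall z, unit_ball z -> q (p z) = z &
        forall z, unit_ball z -> p (q z) = z].

End ball.

(* Main.v *)
(* For c in the ball, [p_{p c} \o p \o p_c] is an automorphism of the ball
   fixing the origin, hence unitary, so that [p_{p c} (p z) = p_c z *m U].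
   Since Lambda is invariant under p, the integral of [p_{p c}] over [p @` K]
   is that of [p_c] over K multiplied by the invertible matrix U, and one
   vanishes if and only if the other does; as p permutes the points of the
   ball, existence and uniqueness of the barycenter are transported from K to
   [p @` K].

   That an automorphism fixing the origin is unitary follows from the Schwarz
   lemma: it preserves the norm, and applying this to [p_{F a} \o F \o p_a]
   one finds that it preserves the Hermitian product.

   For the invariance of Lambda, the same factorization
   [p = p_{p x} \o U \o p_x] near x gives the factor by which the derivative
   of p at x scales volumes. This yields a local estimate on small dyadic
   cubes around each point; an open set is partitioned into such cubes, and
   regularity passes from open sets to measurable sets. Applied to p and to
   its inverse, the resulting inequality is an equality. *)

Require Import Defs.
From HB Require Import structures.
From mathcomp Require Import all_boot all_order all_algebra.
From mathcomp Require Import all_classical all_reals all_analysis.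
From mathcomp Require Import complex measurable_realfun ring lra.
Set Implicit Arguments.
Unset Strict Implicit.
Unset Printing Implicit Defensive.
Import Order.TTheory GRing.Theory Num.Theory.
Import numFieldNormedType.Exports.
Local Open Scope classical_set_scope.
Local Open Scope ring_scope.
Local Open Scope complex_scope.

(** * The Hermitian product and the ball involutions *)

Section Hermitian.
Variables (R : realType) (m : nat).
Local Notation "x ^*" := (Num.conj x) : complex_scope.
Local Notation C := R[i].
Local Notation V := 'rV[C]_m.
Implicit Types (z w a : V) (k : C).

(** The usual road to the Schwarz lemma, dividing by z and applying the maximum principle, is
    reversed. The substitution z = exp w turns the circles around 0 into vertical segments, so
    Goursat's theorem on rectangles already gives |f'(0)| <= 1 for self-maps of the disc fixing 0.
    Composing with disc involutions extends this bound to a differential inequality at every point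
    (Schwarz-Pick), and integrating it along a radius gives the Schwarz lemma.

    On the measure side no determinant appears. A linear map is controlled by a constant bounding
    the volume growth of arbitrary sets. Such constants multiply under composition, and the
    derivative of an automorphism is a product of three matrices: a unitary one, for which the
    constant is 1, and two derivatives of involutions taken at special points, where they are scalar
    plus rank one and become diagonal in a unitary basis. The exponent m + 1 of the density comes
    out of their eigenvalues. *)

Definition cabs k : R := Num.sqrt (complex.Re k ^+ 2 + complex.Im k ^+ 2).

Lemma cabsE k : `|k| = (cabs k)%:C.
Proof. by rewrite normc_def. Qed.

Lemma cabs_ge0 k : 0 <= cabs k.
Proof. exact: sqrtr_ge0. Qed.

Lemma cabsM k l : cabs (k * l) = cabs k * cabs l.
Proof. by apply: (@complexI R); rewrite -cabsE normrM !cabsE rmorphM. Qed.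

Lemma cabsV k : cabs k^-1 = (cabs k)^-1.
Proof. by apply: (@complexI R); rewrite -cabsE normfV !cabsE fmorphV. Qed.

Lemma cabsD k l : cabs (k + l) <= cabs k + cabs l.
Proof. by rewrite -lecR rmorphD /= -!cabsE ler_normD. Qed.

Lemma cabsN k : cabs (- k) = cabs k.
Proof. by apply: (@complexI R); rewrite -!cabsE normrN. Qed.

Lemma cabs_sub_le k l : cabs k - cabs l <= cabs (k - l).
Proof. by have := cabsD (k - l) l; rewrite subrK lerBlDr. Qed.

Lemma cabs0 : cabs 0 = 0.
Proof. by apply: (@complexI R); rewrite -cabsE normr0. Qed.

Lemma cabs1 : cabs 1 = 1.
Proof. by apply: (@complexI R); rewrite -cabsE normr1. Qed.

Lemma cabs_real (x : R) : cabs x%:C = `|x|.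
Proof. by rewrite /cabs /= expr0n addr0 sqrtr_sqr. Qed.

Lemma cabs_eq0 k : (cabs k == 0) = (k == 0).
Proof. by rewrite -(inj_eq (@complexI R)) -cabsE normr_eq0. Qed.

Lemma cabs_gt0 k : (0 < cabs k) = (k != 0).
Proof. by rewrite lt_neqAle cabs_ge0 andbT eq_sym cabs_eq0. Qed.

Lemma cabsJ k : cabs (k^*) = cabs k.
Proof. by case: k => x y; rewrite /cabs /= sqrrN. Qed.

Lemma cabs_sqr k : cabs k ^+ 2 = complex.Re k ^+ 2 + complex.Im k ^+ 2.
Proof. by rewrite sqr_sqrtr ?addr_ge0 ?sqr_ge0. Qed.

Lemma mulJ k : k * k^* = (cabs k ^+ 2)%:C.
Proof. by rewrite -normCK cabsE rmorphXn. Qed.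

Lemma conj_realC (x : R) : (x%:C)^* = x%:C.
Proof. exact: conjc_real. Qed.

Lemma addJ k : k + k^* = 2 * (complex.Re k)%:C.
Proof. exact: addcJ. Qed.

Lemma Re_le_cabs k : complex.Re k <= cabs k.
Proof.
rewrite (le_trans (ler_norm _))// -(@ler_pXn2r _ 2)// ?nnegrE ?cabs_ge0//.
by rewrite cabs_sqr real_normK ?num_real// lerDl sqr_ge0.
Qed.

Lemma normRe_le_cabs k : `|complex.Re k| <= cabs k.
Proof.
rewrite -(@ler_pXn2r _ 2)// ?nnegrE ?cabs_ge0//.
by rewrite cabs_sqr real_normK ?num_real// lerDl sqr_ge0.
Qed.

Lemma normIm_le_cabs k : `|complex.Im k| <= cabs k.
Proof.
rewrite -(@ler_pXn2r _ 2)// ?nnegrE ?cabs_ge0//.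
by rewrite cabs_sqr real_normK ?num_real// lerDr sqr_ge0.
Qed.

Lemma cabs_le_ReIm k : cabs k <= `|complex.Re k| + `|complex.Im k|.
Proof.
rewrite -(@ler_pXn2r _ 2)// ?nnegrE ?cabs_ge0 ?addr_ge0//.
rewrite cabs_sqr sqrrD !real_normK ?num_real//.
have := mulr_ge0 (normr_ge0 (complex.Re k)) (normr_ge0 (complex.Im k)).
by move: (_ * _) => u; lra.
Qed.

Lemma hdotDl z1 z2 w : hdot (z1 + z2) w = hdot z1 w + hdot z2 w.
Proof. by rewrite /hdot -big_split; apply: eq_bigr => i _; rewrite mxE mulrDl. Qed.

Lemma hdotZl k z w : hdot (k *: z) w = k * hdot z w.
Proof. by rewrite /hdot mulr_sumr; apply: eq_bigr => i _; rewrite mxE mulrA. Qed.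

Lemma hdotC z w : hdot w z = (hdot z w)^*.
Proof.
rewrite /hdot rmorph_sum; apply: eq_bigr => i _.
by rewrite rmorphM /= conjCK mulrC.
Qed.

Lemma hdotDr z w1 w2 : hdot z (w1 + w2) = hdot z w1 + hdot z w2.
Proof. by rewrite hdotC hdotDl rmorphD /= -!hdotC. Qed.

Lemma hdotZr k z w : hdot z (k *: w) = k^* * hdot z w.
Proof. by rewrite hdotC hdotZl rmorphM /= -!hdotC. Qed.

Lemma hdotNl z w : hdot (- z) w = - hdot z w.
Proof. by rewrite -scaleN1r hdotZl mulN1r. Qed.

Lemma hdotNr z w : hdot z (- w) = - hdot z w.
Proof. by rewrite -scaleN1r hdotZr rmorphN1 mulN1r. Qed.

Lemma hdot0l w : hdot 0 w = 0.
Proof. by rewrite -(scale0r 0) hdotZl mul0r. Qed.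

Lemma hdot0r z : hdot z 0 = 0.
Proof. by rewrite hdotC hdot0l rmorph0. Qed.

Lemma hdotBl z1 z2 w : hdot (z1 - z2) w = hdot z1 w - hdot z2 w.
Proof. by rewrite hdotDl hdotNl. Qed.

Lemma hdotBr z w1 w2 : hdot z (w1 - w2) = hdot z w1 - hdot z w2.
Proof. by rewrite hdotDr hdotNr. Qed.

Lemma hdotzzE z : hdot z z = (\sum_(k < m) cabs (z 0 k) ^+ 2)%:C.
Proof. by rewrite /hdot rmorph_sum; apply: eq_bigr => i _; rewrite mulJ. Qed.

Lemma hnorm_sqrE z : hnorm z ^+ 2 = \sum_(k < m) cabs (z 0 k) ^+ 2.
Proof.
rewrite /hnorm hdotzzE /= sqr_sqrtr//.
by apply: sumr_ge0 => i _; rewrite sqr_ge0.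
Qed.

Lemma hdotzz z : hdot z z = (hnorm z ^+ 2)%:C.
Proof. by rewrite hdotzzE hnorm_sqrE. Qed.

Lemma hnorm_ge0 z : 0 <= hnorm z.
Proof. exact: sqrtr_ge0. Qed.

Lemma hnormZ k z : hnorm (k *: z) = cabs k * hnorm z.
Proof.
apply/eqP; rewrite -(@eqrXn2 _ 2)// ?hnorm_ge0 ?mulr_ge0 ?hnorm_ge0 ?cabs_ge0//.
rewrite exprMn !hnorm_sqrE mulr_sumr; apply/eqP/eq_bigr => i _.
by rewrite mxE cabsM exprMn.
Qed.

Lemma cabs_le_hnorm z i : cabs (z 0 i) <= hnorm z.
Proof.
rewrite -(@ler_pXn2r _ 2)// ?nnegrE ?cabs_ge0 ?hnorm_ge0//.
rewrite hnorm_sqrE (bigD1 i)//= lerDl.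
by apply: sumr_ge0 => j _; rewrite sqr_ge0.
Qed.

Lemma hnorm0 : hnorm (0 : V) = 0.
Proof. by rewrite -(scale0r 0) hnormZ cabs0 mul0r. Qed.

Lemma hnorm_eq0 z : (hnorm z == 0) = (z == 0).
Proof.
apply/eqP/eqP => [z0|->]; last exact: hnorm0.
apply/rowP => i; rewrite mxE; apply/eqP; rewrite -cabs_eq0.
by rewrite eq_le cabs_ge0 andbT -z0 cabs_le_hnorm.
Qed.

Lemma hnorm_gt0 z : (0 < hnorm z) = (z != 0).
Proof. by rewrite lt_neqAle hnorm_ge0 andbT eq_sym hnorm_eq0. Qed.

Lemma hnormN z : hnorm (- z) = hnorm z.
Proof. by rewrite -scaleN1r hnormZ cabsN cabs1 mul1r. Qed.

Lemma hnorm_sqrD z w :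
  hnorm (z + w) ^+ 2 = hnorm z ^+ 2 + 2 * complex.Re (hdot z w) + hnorm w ^+ 2.
Proof.
apply: (@complexI R); rewrite -hdotzz !rmorphD (rmorphM _ 2) (rmorph_nat _ 2) /= -!hdotzz.
have := addJ (hdot z w); rewrite -hdotC => <-.
by rewrite hdotDl !hdotDr; ring.
Qed.

(* Expanding [hnorm (|w|^2 z - <z,w> w) ^ 2 >= 0]. *)
Lemma hdot_CauchySchwarz z w : cabs (hdot z w) <= hnorm z * hnorm w.
Proof.
have [->|w0] := eqVneq w 0; first by rewrite hdot0r cabs0 mulr_ge0// hnorm_ge0.
rewrite -(@ler_pXn2r _ 2)// ?nnegrE ?mulr_ge0 ?hnorm_ge0 ?cabs_ge0//.
rewrite -(ler_pM2l (_ : 0 < hnorm w ^+ 2)); last by rewrite exprn_gt0 ?hnorm_gt0.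
pose v := hdot w w *: z - hdot z w *: w.
suff: hnorm v ^+ 2 = hnorm w ^+ 2 *
    ((hnorm z * hnorm w) ^+ 2 - cabs (hdot z w) ^+ 2).
  by have := sqr_ge0 (hnorm v); rewrite -subr_ge0 -mulrBr => + <-.
apply: (@complexI R).
rewrite -hdotzz exprMn (rmorphM _ (hnorm w ^+ 2)) rmorphB /=.
rewrite (rmorphM _ (hnorm z ^+ 2)) /= -(mulJ (hdot z w)) -!hdotzz /v -hdotC.
rewrite hdotBl !hdotBr !hdotZl !hdotZr -!hdotC.
ring.
Qed.

Lemma hnormD z w : hnorm (z + w) <= hnorm z + hnorm w.
Proof.
rewrite -(@ler_pXn2r _ 2)// ?nnegrE ?addr_ge0 ?hnorm_ge0//.
rewrite hnorm_sqrD sqrrD.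
have := le_trans (Re_le_cabs _) (hdot_CauchySchwarz z w).
by lra.
Qed.

Lemma hnormB z w : hnorm (z - w) <= hnorm z + hnorm w.
Proof. by rewrite -(hnormN w) hnormD. Qed.

Lemma hnorm_sub_le z w : hnorm z - hnorm w <= hnorm (z - w).
Proof. by have := hnormD (z - w) w; rewrite subrK lerBlDr. Qed.

Lemma hnorm_le_sum z : hnorm z <= \sum_(k < m) cabs (z 0 k).
Proof.
have -> : z = \sum_(k < m) (z 0 k) *: delta_mx 0 k.
  by rewrite {1}(row_sum_delta z).
apply: (@le_trans _ _ (\sum_(k < m) hnorm (z 0 k *: delta_mx 0 k : V))).
  elim/big_ind2 : _ => [|x1 y1 x2 y2 h1 h2|i _]; rewrite ?hnorm0//.
  exact: le_trans (hnormD _ _) (lerD h1 h2).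
apply: ler_sum => k _; rewrite -row_sum_delta hnormZ ler_piMr ?cabs_ge0//.
rewrite -(@ler_pXn2r _ 2)// ?nnegrE ?hnorm_ge0// hnorm_sqrE.
rewrite (bigD1 k)//= big1 => [|i ik]; rewrite !mxE ?eqxx/= ?(negbTE ik) ?cabs0 ?expr0n//.
by rewrite cabs1 expr1n addr0.
Qed.

End Hermitian.

Section BallInvolution.
Variables (R : realType) (m : nat).
Local Notation "x ^*" := (Num.conj x) : complex_scope.
Local Notation C := R[i].
Local Notation V := 'rV[C]_m.
Implicit Types (z w a : V).

(** The scalar s_a in the formula of p_a. *)
Definition ball_shrink a : R := Num.sqrt (1 - hnorm a ^+ 2).

Lemma unit_ball_sqr z : unit_ball z -> 0 < 1 - hnorm z ^+ 2.
Proof. by rewrite /unit_ball/= => z1; rewrite subr_gt0 expr_lt1// hnorm_ge0. Qed.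

Lemma unit_ballP z : 0 < 1 - hnorm z ^+ 2 -> unit_ball z.
Proof. by rewrite /unit_ball/= subr_gt0 expr_lt1// hnorm_ge0. Qed.

Lemma unit_ball0 : unit_ball (0 : V).
Proof. by rewrite /unit_ball /= hnorm0. Qed.

Lemma ball_shrink_gt0 a : unit_ball a -> 0 < ball_shrink a.
Proof. by move=> /unit_ball_sqr; rewrite sqrtr_gt0. Qed.

Lemma ball_shrink_sqr a : unit_ball a -> ball_shrink a ^+ 2 = 1 - hnorm a ^+ 2.
Proof. by move=> /unit_ball_sqr/ltW; exact: sqr_sqrtr. Qed.

(** Together with [ball_involutionE], this turns the identities on p_a into rational identities in
    s_a and Hermitian products, within reach of [field]. *)
Lemma hdot_shrink a : unit_ball a -> hdot a a = 1 - (ball_shrink a)%:C ^+ 2.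
Proof.
by move=> /ball_shrink_sqr e; rewrite hdotzz -rmorphXn /= e rmorphB rmorph1 /=; ring.
Qed.

Lemma shrink_neq0 a : unit_ball a -> (ball_shrink a)%:C != 0.
Proof. by move=> /ball_shrink_gt0 s0; rewrite gt_eqF// ltcR. Qed.

Lemma shrink1_neq0 a : 1 + (ball_shrink a)%:C != 0.
Proof. by rewrite gt_eqF// ltr_pwDl// lecR sqrtr_ge0. Qed.

Lemma cabs_hdot_lt1 z a : unit_ball z -> unit_ball a -> cabs (hdot z a) < 1.
Proof.
move=> z1 a1; apply: le_lt_trans (hdot_CauchySchwarz _ _) _.
by rewrite mulr_ilt1// hnorm_ge0.
Qed.

Lemma one_sub_neq0 (k : C) : cabs k < 1 -> 1 - k != 0.
Proof.
move=> k1; rewrite subr_eq0; apply: contraTneq k1 => <-.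
by rewrite cabs1 ltxx.
Qed.

Lemma ball_denom_neq0 z a : unit_ball z -> unit_ball a -> 1 - hdot z a != 0.
Proof. by move=> z1 a1; apply/one_sub_neq0/cabs_hdot_lt1. Qed.

(* The division by [<a,a>] is cleared using [<a,a> = (1 - s) (1 + s)], so that
   the formula is uniform in [a]. *)
Lemma ball_involutionE a z : unit_ball a ->
  ball_involution a z = (1 - hdot z a)^-1 *:
    ((1 - hdot z a / (1 + (ball_shrink a)%:C)) *: a - (ball_shrink a)%:C *: z).
Proof.
move=> a1; rewrite /ball_involution -/(ball_shrink a); congr (_ *: _).
have := hdot_shrink a1; have := shrink1_neq0 a; set s := (ball_shrink a)%:C.
rewrite /line_proj => s0 e; have [a0|a0] := eqVneq a 0.
  by rewrite a0 !subr0 scaler0.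
have : hdot a a != 0 by rewrite hdotzz gt_eqF// ltcR exprn_gt0 ?hnorm_gt0.
rewrite e => e0; apply/rowP => i; rewrite !mxE; field.
by rewrite s0 e0.
Qed.

(** The fundamental identity of the ball involutions; the conjugate factor is 1 - <a,w>. Its
    diagonal case gives the invariance of the ball and, later, the rigidity of automorphisms fixing
    the origin. *)
Lemma ball_involution_dotE a z w : unit_ball a -> unit_ball z -> unit_ball w ->
  1 - hdot (ball_involution a z) (ball_involution a w) =
  ((ball_shrink a)%:C ^+ 2) * (1 - hdot z w) / ((1 - hdot z a) * (1 - hdot w a)^*).
Proof.
move=> a1 z1 w1; rewrite !ball_involutionE//.
have := ball_denom_neq0 z1 a1; have := ball_denom_neq0 w1 a1.
rewrite -conjC_eq0 => wa za.
have s0 := shrink1_neq0 a; have e := hdot_shrink a1.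
have sJ : ((ball_shrink a)%:C)^* = (ball_shrink a)%:C by exact: conjc_real.
rewrite hdotZl hdotZr !hdotBl !hdotBr !hdotZl !hdotZr e.
rewrite (hdotC w a) fmorphV rmorphB rmorphB rmorph1 rmorphM fmorphV rmorphD rmorph1 /= sJ.
move: za wa s0; rewrite rmorphB rmorph1 /= -?(hdotC w a); set s := (ball_shrink a)%:C => *.
by field; apply/and3P.
Qed.

Lemma hnorm_ball_involution a z : unit_ball a -> unit_ball z ->
  1 - hnorm (ball_involution a z) ^+ 2 =
  (1 - hnorm a ^+ 2) * (1 - hnorm z ^+ 2) / cabs (1 - hdot z a) ^+ 2.
Proof.
move=> a1 z1; apply: (@complexI R); have := ball_involution_dotE a1 z1 z1.
rewrite mulJ !hdotzz -rmorphXn ball_shrink_sqr//=.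
by rewrite !(rmorphM, rmorphB, fmorphV, rmorph1).
Qed.

Lemma ball_involution_ball a z : unit_ball a -> unit_ball z ->
  unit_ball (ball_involution a z).
Proof.
move=> a1 z1; apply: unit_ballP; rewrite hnorm_ball_involution//.
have d0 : 0 < cabs (1 - hdot z a) ^+ 2.
  by rewrite exprn_gt0// cabs_gt0 ball_denom_neq0.
by rewrite divr_gt0// mulr_gt0// unit_ball_sqr.
Qed.

Lemma ball_involutionK a z : unit_ball a -> unit_ball z ->
  ball_involution a (ball_involution a z) = z.
Proof.
move=> a1 z1; have s0 := shrink1_neq0 a; have e := hdot_shrink a1.
have za := ball_denom_neq0 z1 a1; have s1 := shrink_neq0 a1.
(* Hence 1 - <p_a z, a> = s^2 / (1 - <z,a>), so the second denominator does not vanish. *)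
have E : hdot (ball_involution a z) a =
    (1 - (ball_shrink a)%:C ^+ 2 - hdot z a) / (1 - hdot z a).
  rewrite ball_involutionE// hdotZl hdotBl !hdotZl e.
  by field; rewrite za s0.
rewrite ball_involutionE// E ball_involutionE//; apply/rowP => i; rewrite !mxE.
field; rewrite za s0 /=.
have -> : 1 - hdot z a - (1 - (ball_shrink a)%:C ^+ 2 - hdot z a) =
  (ball_shrink a)%:C ^+ 2 by ring.
exact: expf_neq0.
Qed.

Lemma ball_involution0 a : unit_ball a -> ball_involution a 0 = a.
Proof.
by move=> a1; rewrite ball_involutionE// hdot0l mul0r subr0 invr1 !scale1r scaler0 subr0.
Qed.

Lemma ball_involution_self a : unit_ball a -> ball_involution a a = 0.
Proof.
by move=> a1; rewrite -{2}(ball_involution0 a1) ball_involutionK//; exact: unit_ball0.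
Qed.

End BallInvolution.

(** * Complex derivatives in several variables *)

Section Derivative.
Variable R : realType.
Local Notation "x ^*" := (Num.conj x) : complex_scope.
Local Notation C := R[i].
Local Notation "''V_' m" := ('rV[C]_m) (at level 8, m at level 2, format "''V_' m").

Lemma hnorm_mulmx_bound m n (M : 'M[C]_(m, n)) :
  exists2 B : R, 0 < B & forall h : 'V_m, hnorm (h *m M) <= B * hnorm h.
Proof.
exists (1 + \sum_i hnorm (row i M)) => [|h].
  by rewrite ltr_pwDl// sumr_ge0// => i _; exact: hnorm_ge0.
rewrite mulmx_sum_row mulrDl mul1r ler_wpDl ?hnorm_ge0// mulr_suml.
apply: (@le_trans _ _ (\sum_i hnorm (h 0 i *: row i M))).
  elim/big_ind2 : _ => [|x1 y1 x2 y2 h1 h2|i _]; rewrite ?hnorm0//.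
  exact: le_trans (hnormD _ _) (lerD h1 h2).
apply: ler_sum => i _; rewrite hnormZ mulrC.
by apply: ler_wpM2l; rewrite ?hnorm_ge0 ?cabs_le_hnorm.
Qed.

Lemma mx_norm_le_hnorm m (z : 'V_m) : `|z| <= (hnorm z)%:C.
Proof.
have [->|z0] := eqVneq z 0; first by rewrite normr0 lecR hnorm_ge0.
have : mx_norm z != 0 by apply: contra_neq z0 => /mx_norm_eq0.
move=> /mx_norm_neq0[[i j]] /=; rewrite (ord1 i) /Num.norm/= => ->.
have : `|z 0 j| <= (hnorm z)%:C by rewrite cabsE lecR cabs_le_hnorm.
exact.
Qed.

Lemma hnorm_le_mx_norm m (z : 'V_m) : (hnorm z)%:C <= m%:R * `|z|.
Proof.
have : (hnorm z)%:C <= \sum_(k < m) (cabs (z 0 k))%:C.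
  by rewrite -rmorph_sum lecR hnorm_le_sum.
move=> /le_trans; apply.
have -> : m%:R * `|z| = \sum_(k < m) `|z| by rewrite sumr_const card_ord mulr_natl.
apply: ler_sum => k _; rewrite -cabsE [leRHS]mx_normE.
by rewrite -[leLHS]nngE num_le; exact: (le_bigmax _ _ (0, k)).
Qed.

(** Complex differentiability with derivative L acting on the right of row vectors. The explicit
    form in the real-valued Hermitian norm keeps all estimates in R. *)
Definition hdiff m n (f : 'V_m -> 'V_n) (x : 'V_m) (L : 'M[C]_(m, n)) :=
  forall e : R, 0 < e -> exists2 d : R, 0 < d & forall h, hnorm h < d ->
    hnorm (f (x + h) - f x - h *m L) <= e * hnorm h.

Lemma differentiable_hdiff m n (f : 'V_m -> 'V_n) x : differentiable f x -> exists L, hdiff f x L.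
Proof.
move=> /diff_locallyP[_ /eqaddoP fx]; exists (lin1_mx ('d f x)) => e e0.
(* The Hermitian norm is at most n times the sup norm; dividing by n + 1 absorbs this factor and
   remains possible when n = 0. *)
have e1 : 0 < (e / n.+1%:R)%:C by rewrite ltcR divr_gt0.
have /nbhs_ballP[d /= d0 H] := fx _ e1.
(* A positive element of R[i] is real, so its real part is a valid radius. *)
exists (complex.Re d); first by rewrite ltcE in d0; case/andP: d0.
move=> h hd; have /H : ball (0 : 'V_m) d h.
  rewrite -ball_normE /ball_/= sub0r normrN.
  apply: le_lt_trans (mx_norm_le_hnorm h) _.
  by move: d0; rewrite !ltcE /= => /andP[/eqP -> _]; rewrite eqxx.
rewrite /= !fctE /= mul_rV_lin1 opprD addrA (addrC h) => fh.
rewrite -lecR; apply: le_trans (hnorm_le_mx_norm _) _.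
apply: (@le_trans _ _ (n.+1%:R * ((e / n.+1%:R)%:C * `|h|))).
  apply: ler_pM => //; first by rewrite ler_nat.
have E : n.+1%:R * (e / n.+1%:R)%:C = e%:C.
  have <- : (n.+1%:R : R)%:C = n.+1%:R by rewrite rmorph_nat.
  by rewrite -rmorphM /= mulrC divfK ?pnatr_eq0.
rewrite mulrA E (rmorphM _ e) /=.
apply: ler_wpM2l; first by rewrite lecR ltW.
exact: mx_norm_le_hnorm.
Qed.

Lemma hdiff_ext m n (f g : 'V_m -> 'V_n) x L (r : R) : 0 < r ->
  (forall h, hnorm h < r -> f (x + h) = g (x + h)) -> hdiff f x L -> hdiff g x L.
Proof.
move=> r0 fg fx e /fx[d d0 H]; exists (Num.min r d) => [|h].
  by rewrite lt_min r0.
rewrite lt_min => /andP[hr /H]; rewrite fg//.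
by have := fg 0; rewrite addr0 hnorm0 => ->.
Qed.

Lemma hdiff_lipschitz m n (f : 'V_m -> 'V_n) x L : hdiff f x L -> exists2 B : R, 0 < B &
  exists2 d : R, 0 < d &
  forall h, hnorm h < d -> hnorm (f (x + h) - f x) <= B * hnorm h.
Proof.
move=> fx; have [B B0 LB] := hnorm_mulmx_bound L; have [d d0 H] := fx _ ltr01.
exists (1 + B); first by rewrite addr_gt0.
exists d => // h /H; rewrite mul1r mulrDl mul1r => fh.
rewrite -[f (x + h) - f x](subrK (h *m L)).
exact: le_trans (hnormD _ _) (lerD fh (LB h)).
Qed.

Lemma hdiff_continuous m n (f : 'V_m -> 'V_n) x L : hdiff f x L -> forall e : R, 0 < e ->
  exists2 d : R, 0 < d & forall h, hnorm h < d -> hnorm (f (x + h) - f x) < e.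
Proof.
move=> /hdiff_lipschitz[B B0 [d d0 H]] e e0.
exists (Num.min d (e / B)) => [|h]; first by rewrite lt_min d0 divr_gt0.
rewrite lt_min ltr_pdivlMr// mulrC => /andP[/H hd]; exact: le_lt_trans.
Qed.

Lemma hdiff_comp m n p (f : 'V_m -> 'V_n) (g : 'V_n -> 'V_p) x L M : hdiff f x L -> hdiff g (f x) M ->
  hdiff (g \o f) x (L *m M).
Proof.
move=> fx gx e e0.
have [B B0 [d1 d10 H1]] := hdiff_lipschitz fx.
have [A A0 MA] := hnorm_mulmx_bound M.
have [d2 d20 H2] := gx (e / 2 / B) (divr_gt0 (divr_gt0 e0 (ltr0Sn _ 1)) B0).
have [d3 d30 H3] := fx (e / 2 / A) (divr_gt0 (divr_gt0 e0 (ltr0Sn _ 1)) A0).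
exists (Num.min (Num.min d1 d3) (d2 / B)) => [|h].
  by rewrite !lt_min d10 d30 divr_gt0.
rewrite !lt_min ltr_pdivlMr// => /andP[/andP[/H1 h1 /H3 h3] h2] /=.
set k := f (x + h) - f x in h1 h3 *.
have /H2 : hnorm k < d2 by apply: le_lt_trans h1 _; rewrite mulrC.
rewrite {1}/k [f x + _]addrC subrK => h4.
rewrite -(subrK (k *m M) (g (f (x + h)) - _)) -addrA.
apply: le_trans (hnormD _ _) _; rewrite mulmxA -mulmxBl.
apply: (@le_trans _ _ (e / 2 * hnorm h + e / 2 * hnorm h)); last first.
  by rewrite -mulrDl -splitr.
apply: lerD.
  apply: le_trans h4 _.
  have -> : e / 2 / B * hnorm k = e / 2 * (hnorm k / B) by ring.
  by rewrite ler_pM2l ?divr_gt0// ler_pdivrMr// mulrC.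
apply: le_trans (MA _) _; rewrite mulrC -ler_pdivlMr//.
by apply: le_trans h3 _; rewrite mulrAC.
Qed.

(** Identifies the derivative of q o p with the identity, from which the derivative of an
    automorphism is invertible. The two expansions are compared on small multiples of basis
    vectors. *)
Lemma hdiff_unique m n (f : 'V_m -> 'V_n) x L M : hdiff f x L -> hdiff f x M -> L = M.
Proof.
move=> fL fM; apply/eqP; rewrite -subr_eq0; apply/eqP/row_matrixP => i.
rewrite row0 rowE; set u := delta_mx 0 i; apply/eqP; rewrite -hnorm_eq0.
rewrite eq_le hnorm_ge0 andbT leNgt; apply/negP => n0.
have u0 : 0 < hnorm u.
  by rewrite hnorm_gt0; apply: contraTneq n0 => ->; rewrite mul0mx hnorm0 ltxx.
(* With this e the two errors add up to half of the norm that they have to dominate. *)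
pose e := hnorm (u *m (L - M)) / (4 * hnorm u).
have e0 : 0 < e by rewrite divr_gt0// mulr_gt0.
have [d1 d10 H1] := fL _ e0; have [d2 d20 H2] := fM _ e0.
pose t := Num.min d1 d2 / (2 * hnorm u).
have t0 : 0 < t by rewrite divr_gt0// ?mulr_gt0// lt_min d10.
have hu : hnorm (t%:C *: u) = Num.min d1 d2 / 2.
  rewrite hnormZ cabs_real gtr0_norm// /t.
  by field; rewrite gt_eqF.
have hd : hnorm (t%:C *: u) < Num.min d1 d2.
  by rewrite hu ltr_pdivrMr// ltr_pMr ?ltr1n// lt_min d10.
have /H1 K1 : hnorm (t%:C *: u) < d1 by apply: lt_le_trans hd _; rewrite ge_min lexx.
have /H2 K2 : hnorm (t%:C *: u) < d2 by apply: lt_le_trans hd _; rewrite ge_min lexx orbT.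
have : hnorm ((t%:C *: u) *m (L - M)) <= 2 * e * hnorm (t%:C *: u).
  rewrite -mulrA mulr_natl mulr2n; apply: le_trans (lerD K2 K1).
  apply: le_trans (hnormB _ _); rewrite mulmxBr le_eqVlt; apply/orP; left.
  by apply/eqP; congr hnorm; rewrite opprB [RHS]addrC addrA subrK.
rewrite -scalemxAl !hnormZ !cabs_real gtr0_norm// mulrCA ler_pM2l// /e.
have -> : 2 * (hnorm (u *m (L - M)) / (4 * hnorm u)) * hnorm u =
    hnorm (u *m (L - M)) / 2 by field; rewrite gt_eqF.
by move: n0; lra.
Qed.

Lemma hdiff_linear m n (M : 'M[C]_(m, n)) x : hdiff (fun z => z *m M) x M.
Proof.
move=> e e0; exists 1 => // h _; rewrite mulmxDl addrAC addrK subrr hnorm0.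
by rewrite mulr_ge0 ?hnorm_ge0// ltW.
Qed.

Lemma unit_ball_open m (x : 'V_m) : unit_ball x -> exists2 d : R, 0 < d &
  forall h, hnorm h < d -> unit_ball (x + h).
Proof.
rewrite /unit_ball/= => x1; exists (1 - hnorm x); first by rewrite subr_gt0.
by move=> h; rewrite ltrBrDl => /(le_lt_trans (hnormD _ _)).
Qed.

(** The derivative of p_a at x, by the quotient rule applied to the form of p_a in
    [ball_involutionE]: a rank-one matrix plus a scalar one. *)
Definition ball_jac m (a x : 'V_m) : 'M[C]_m := (1 - hdot x a)^-1 *:
  (\col_k ((a 0 k)^*) *m (ball_involution a x - (1 + (ball_shrink a)%:C)^-1 *: a)
   - (ball_shrink a)%:C%:M).

Lemma mul_col_conj m (h a : 'V_m) : h *m (\col_k (a 0 k)^*) = (hdot h a)%:M.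
Proof.
apply/matrixP => i j; rewrite !mxE (ord1 i) (ord1 j) eqxx mulr1n.
by apply: eq_bigr => k _; rewrite mxE.
Qed.

Lemma mul_ball_jac m (a x h : 'V_m) : h *m ball_jac a x = (1 - hdot x a)^-1 *:
  (hdot h a *: (ball_involution a x - (1 + (ball_shrink a)%:C)^-1 *: a)
   - (ball_shrink a)%:C *: h).
Proof.
rewrite -scalemxAr mulmxBr mulmxA mul_col_conj mul_scalar_mx.
by rewrite mul_mx_scalar.
Qed.

Lemma hdiff_ball_involution m (a x : 'V_m) : unit_ball a -> unit_ball x ->
  hdiff (ball_involution a) x (ball_jac a x).
Proof.
move=> a1 x1 e e0; have [B B0 LB] := hnorm_mulmx_bound (ball_jac a x).
have [r r0 Hr] := unit_ball_open x1.
have dx := ball_denom_neq0 x1 a1.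
have d0 : 0 < cabs (1 - hdot x a) by rewrite cabs_gt0.
(* The three bounds keep x + h in the ball, the denominator above half of its modulus at x, and the
   quadratic remainder below e |h|. *)
exists (Num.min r (Num.min (cabs (1 - hdot x a) / 2)
   (e * cabs (1 - hdot x a) / (2 * B)))) => [|h].
  by rewrite !lt_min r0 !divr_gt0 ?mulr_gt0.
rewrite !lt_min => /and3P[/Hr xh1 hd he].
have dxh := ball_denom_neq0 xh1 a1.
(* Since p_a is linear fractional, its remainder is exactly a scalar multiple of its derivative. *)
have -> : ball_involution a (x + h) - ball_involution a x - h *m ball_jac a x =
    (hdot h a / (1 - hdot (x + h) a)) *: (h *m ball_jac a x).
  rewrite mul_ball_jac !ball_involutionE//; have s0 := shrink1_neq0 a.
  apply/rowP => i; rewrite !mxE; move: dxh; rewrite hdotDl => dxh.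
  by field; apply/and3P.
have ha : cabs (hdot h a) <= hnorm h.
  apply: le_trans (hdot_CauchySchwarz _ _) _.
  by rewrite ler_piMr ?hnorm_ge0// ltW.
have dd : cabs (1 - hdot x a) / 2 <= cabs (1 - hdot (x + h) a).
  have := cabs_sub_le (1 - hdot x a) (hdot h a).
  by rewrite hdotDl opprD addrA; move: ha hd; lra.
rewrite hnormZ cabsM cabsV; apply: (@le_trans _ _
    (hnorm h / (cabs (1 - hdot x a) / 2) * (B * hnorm h))).
  apply: ler_pM; rewrite ?hnorm_ge0// ?divr_ge0 ?cabs_ge0//.
  apply: ler_pM; rewrite ?hnorm_ge0// ?cabs_ge0 ?invr_ge0 ?cabs_ge0//.
  by rewrite lef_pV2// posrE ?cabs_gt0// divr_gt0.
rewrite mulrA; apply: ler_wpM2r; first exact: hnorm_ge0.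
move: he; rewrite ltr_pdivlMr ?mulr_gt0// => /ltW.
move=> he; have -> : hnorm h / (cabs (1 - hdot x a) / 2) * B =
    hnorm h * (2 * B) / cabs (1 - hdot x a) by field; rewrite gt_eqF.
by rewrite ler_pdivrMr.
Qed.

End Derivative.

(** * Cauchy's estimate in one variable, by Goursat's argument on rectangles *)

Section Goursat.
Variable R : realType.
Local Notation mu := (@lebesgue_measure R).
Implicit Types (f : R -> R) (u v : R -> R -> R).

Definition rint f (a b : R) : R := (\int[mu]_(x in `[a, b]) f x)%R.

Definition cont_on f (a b : R) := forall x, a <= x <= b -> {for x, continuous f}.

Lemma cont_on_within f a b : cont_on f a b -> {within `[a, b], continuous f}.
Proof.
move=> fab; apply: continuous_in_subspaceT => x.
by rewrite inE/= in_itv/=; exact: fab.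
Qed.

Lemma cont_on_integrable f a b : cont_on f a b ->
  mu.-integrable `[a, b] (EFin \o f).
Proof.
by move=> /cont_on_within; apply: continuous_compact_integrable; exact: segment_compact.
Qed.

Lemma rint_split f a c b : a <= c -> c <= b -> cont_on f a b ->
  rint f a b = rint f a c + rint f c b.
Proof.
move=> ac cb fab; have := Rintegral_itvB (a := BLeft a) (b := BRight b) (x := c)
  (cont_on_integrable fab).
rewrite !bnd_simp => /(_ ac cb) /eqP; rewrite subr_eq addrC /rint => /eqP {1}->.
congr (_ + _); rewrite Rintegral_itv_obnd_cbnd//.
apply: integrableS (cont_on_integrable fab) => //.
by apply: subset_itvr; rewrite bnd_simp.
Qed.

Lemma rint_affine (al be x0 a b : R) : a <= b ->
  rint (fun x => al + be * (x - x0)) a b =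
  al * (b - a) + be * ((b - x0) ^+ 2 - (a - x0) ^+ 2) / 2.
Proof.
rewrite le_eqVlt => /predU1P[->|ab].
  rewrite /rint set_itv1 Rintegral_set1; ring.
pose F x := al * x + be * (x - x0) ^+ 2 / 2.
have dF (x : R) : is_derive x 1 F (al + be * (x - x0)).
  rewrite /F; apply: is_derive_eq; rewrite /GRing.scale/=.
  by field.
have cF : continuous F.
  move=> x; apply/differentiable_continuous/derivable1_diffP.
  by have [] := dF x.
rewrite /rint /Rintegral (@continuous_FTC2 _ _ F)//=.
- by rewrite /F; field.
- apply: continuous_subspaceT => x.
  apply: cvgD; first exact: cvg_cst.
  by apply: cvgMl_tmp; apply: cvgB; [exact: cvg_id|exact: cvg_cst].
- split; last 2 first.
  + by apply: cvg_at_right_filter; exact: cF.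
  + by apply: cvg_at_left_filter; exact: cF.
  by move=> x _; have [] := dF x.
- by move=> x _; rewrite derive1E; have [_] := dF x.
Qed.

(** Serves on the sides of a small rectangle, where u and v are close to affine functions, and with
    zero slope to estimate a mean. *)
Lemma rint_affine_bound f (al be x0 M a b : R) : a <= b -> cont_on f a b ->
  (forall x, a <= x <= b -> `|f x - (al + be * (x - x0))| <= M) ->
  `|rint f a b - (al * (b - a) + be * ((b - x0) ^+ 2 - (a - x0) ^+ 2) / 2)|
  <= M * (b - a).
Proof.
move=> ab fab fM; have aff c : cont_on (fun x => c + be * (x - x0)) a b.
  move=> x _; apply: cvgD; first exact: cvg_cst.
  by apply: cvgMl_tmp; apply: cvgB; [exact: cvg_id|exact: cvg_cst].
have H1 : rint f a b <= rint (fun x => (al + M) + be * (x - x0)) a b.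
  apply: le_Rintegral => //; try exact: cont_on_integrable.
  move=> x /=; rewrite in_itv/= => /fM; rewrite ler_norml => /andP[_].
  by lra.
have H2 : rint (fun x => (al - M) + be * (x - x0)) a b <= rint f a b.
  apply: le_Rintegral => //; try exact: cont_on_integrable.
  move=> x /=; rewrite in_itv/= => /fM; rewrite ler_norml => /andP[+ _].
  by lra.
rewrite !rint_affine// in H1 H2; rewrite ler_norml; apply/andP; split.
  by move: H2; lra.
by move: H1; lra.
Qed.

(* [u + i v] has a complex derivative at [x + i y], namely [al + i be]. *)
Definition CR_at (u v : R -> R -> R) (x y : R) := exists al be : R,
  forall e, 0 < e -> exists2 d : R, 0 < d & forall s t, `|s| < d -> `|t| < d ->
  `|u (x + s) (y + t) - u x y - (al * s - be * t)| <= e * (`|s| + `|t|) /\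
  `|v (x + s) (y + t) - v x y - (be * s + al * t)| <= e * (`|s| + `|t|).

Lemma small_incr_continuous f (x al : R) :
  (forall e, 0 < e -> exists2 d : R, 0 < d & forall s, `|s| < d ->
    `|f (x + s) - f x - al * s| <= e * `|s|) -> {for x, continuous f}.
Proof.
move=> H; apply/cvgrPdist_lt => e e0; have [d d0 Hd] := H _ ltr01.
have a0 : 0 < 1 + `|al| by rewrite ltr_pwDl.
have de : 0 < Num.min d (e / (1 + `|al|)) by rewrite lt_min d0 divr_gt0.
near=> y; have : `|y - x| < Num.min d (e / (1 + `|al|)).
  rewrite distrC; near: y; apply: (@cvgr_dist_lt _ _ _ (nbhs x)) => //.
rewrite lt_min => /andP[/Hd]; rewrite subrKC mul1r ltr_pdivlMr// => h1 h2.
rewrite distrC; have := ler_normD (f y - f x - al * (y - x)) (al * (y - x)).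
rewrite subrK normrM => /le_lt_trans; apply.
apply: le_lt_trans h2; rewrite [leRHS]mulrDr mulr1 lerD// mulrC.
Unshelve. all: by end_near. Qed.

Lemma CR_continuous u v x y : CR_at u v x y ->
  [/\ {for x, continuous (u^~ y)}, {for y, continuous (u x)},
      {for x, continuous (v^~ y)} & {for y, continuous (v x)}].
Proof.
move=> [al [be H]]; split.
- apply: (@small_incr_continuous _ _ al) => e /H[d d0 Hd]; exists d => // s sd.
  by have := (Hd s 0 sd _).1; rewrite normr0 mulr0 subr0 !addr0; apply.
- apply: (@small_incr_continuous _ _ (- be)) => e /H[d d0 Hd]; exists d => // s sd.
  by have := (Hd 0 s _ sd).1; rewrite normr0 mulr0 sub0r !addr0 add0r mulNr; apply.
- apply: (@small_incr_continuous _ _ be) => e /H[d d0 Hd]; exists d => // s sd.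
  by have := (Hd s 0 sd _).2; rewrite normr0 mulr0 !addr0; apply.
- apply: (@small_incr_continuous _ _ al) => e /H[d d0 Hd]; exists d => // s sd.
  by have := (Hd 0 s _ sd).2; rewrite normr0 mulr0 !addr0 !add0r; apply.
Qed.

End Goursat.

(** * Goursat's theorem on rectangles *)

Section GoursatRectangle.
Variable R : realType.
Variables (u v : R -> R -> R).

(* The imaginary part of the integral of [u + i v] over the boundary of a
   rectangle with lower left corner [x + i y]. *)
Definition circulation (x y w h : R) : R :=
  rint (v^~ y) x (x + w) + rint (u (x + w)) y (y + h)
  - rint (v^~ (y + h)) x (x + w) - rint (u x) y (y + h).

Definition CR_on (x y w h : R) :=
  forall a b, x <= a <= x + w -> y <= b <= y + h -> CR_at u v a b.

(** The contributions of the inner edges cancel; differentiability supplies the continuity needed to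
    split each side. *)
Lemma circulation_split x y w h : 0 <= w -> 0 <= h -> CR_on x y (w + w) (h + h) ->
  circulation x y (w + w) (h + h) =
  circulation x y w h + circulation (x + w) y w h +
  circulation x (y + h) w h + circulation (x + w) (y + h) w h.
Proof.
move=> w0 h0 uv; rewrite /circulation !addrA.
have cu a : x <= a <= x + (w + w) -> cont_on (u a) y (y + h + h).
  by rewrite -addrA => xa b yb; have [] := CR_continuous (uv a b xa yb).
have cv b : y <= b <= y + (h + h) -> cont_on (v^~ b) x (x + w + w).
  by rewrite -addrA => yb a xa; have [] := CR_continuous (uv a b xa yb).
have hx : x <= x + w by lra.
have hy : y <= y + h by lra.
have hx2 : x + w <= x + w + w by lra.
have hy2 : y + h <= y + h + h by lra.
rewrite (rint_split hx hx2 (cv y _)); last by lra.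
rewrite (rint_split hx hx2 (cv (y + h + h) _)); last by lra.
rewrite (rint_split hy hy2 (cu x _)); last by lra.
rewrite (rint_split hy hy2 (cu (x + w + w) _)); last by lra.
by ring.
Qed.

(** The circulation of the affine part is zero, which the final [lra] sees on the explicit
    integrals. The remainder is at most e/2 (w + h) on a contour of length 2 (w + h). *)
Lemma circulation_local a b e : 0 < e -> CR_at u v a b ->
  exists2 d : R, 0 < d & forall x y w h,
    x <= a <= x + w -> y <= b <= y + h -> w < d -> h < d -> CR_on x y w h ->
    `|circulation x y w h| <= e * (w + h) ^+ 2.
Proof.
move=> e0 [al [be H]]; have e20 : 0 < e / 2 by rewrite divr_gt0.
have [d d0 Hd] := H _ e20; exists d => // x y w h xa yb wd hd uv.
have cu c : x <= c <= x + w -> cont_on (u c) y (y + h).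
  by move=> xc t yt; have [] := CR_continuous (uv c t xc yt).
have cv c : y <= c <= y + h -> cont_on (v^~ c) x (x + w).
  by move=> yc t xt; have [] := CR_continuous (uv t c xt yc).
have [w0 h0] : 0 <= w /\ 0 <= h by split; lra.
have near c t : x <= c <= x + w -> y <= t <= y + h ->
    `|u c t - (u a b + al * (c - a) + - be * (t - b))| <= e / 2 * (w + h) /\
    `|v c t - (v a b + al * (t - b) + be * (c - a))| <= e / 2 * (w + h).
  move=> xc yt; have c1 : `|c - a| <= w by rewrite ler_norml; lra.
  have t1 : `|t - b| <= h by rewrite ler_norml; lra.
  have [] := Hd (c - a) (t - b) (le_lt_trans c1 wd) (le_lt_trans t1 hd).
  rewrite !subrKC => h1 h2; have k : e / 2 * (`|c - a| + `|t - b|) <= e / 2 * (w + h).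
    by rewrite ler_pM2l// lerD.
  split; apply: le_trans k; [apply: le_trans h1|apply: le_trans h2];
    by rewrite le_eqVlt; apply/orP; left; apply/eqP; congr `|_|; ring.
have xx : x <= x <= x + w by lra.
have xw : x <= x + w <= x + w by lra.
have yy : y <= y <= y + h by lra.
have yh : y <= y + h <= y + h by lra.
have hxw : x <= x + w by lra.
have hyh : y <= y + h by lra.
have K1 := rint_affine_bound hxw (cv y yy) (fun c xc => (near c y xc yy).2).
have K2 := rint_affine_bound hxw (cv _ yh) (fun c xc => (near c _ xc yh).2).
have K3 := rint_affine_bound hyh (cu x xx) (fun c yc => (near x c xx yc).1).
have K4 := rint_affine_bound hyh (cu _ xw) (fun c yc => (near _ c xw yc).1).
move: K1 K2 K3 K4; rewrite /circulation !ler_norml.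
move: (rint _ _ _) (rint _ _ _) (rint _ _ _) (rint _ _ _) => i1 i2 i3 i4.
by move=> *; apply/andP; split; lra.
Qed.

Lemma CR_onS x y w h x' y' w' h' : x <= x' -> x' + w' <= x + w ->
  y <= y' -> y' + h' <= y + h -> CR_on x y w h -> CR_on x' y' w' h'.
Proof. by move=> h1 h2 h3 h4 H a b xa yb; apply: H => //; lra. Qed.

Lemma circulation_bisect x y w h : 0 <= w -> 0 <= h ->
  CR_on x y (w + w) (h + h) -> exists p : R * R,
  [/\ x <= p.1, p.1 + w <= x + (w + w), y <= p.2, p.2 + h <= y + (h + h) &
      `|circulation x y (w + w) (h + h)| <= 4 * `|circulation p.1 p.2 w h|].
Proof.
move=> w0 h0 uv; rewrite circulation_split//.
set c1 := circulation x y w h; set c2 := circulation (x + w) y w h.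
set c3 := circulation x (y + h) w h; set c4 := circulation (x + w) (y + h) w h.
have T : `|c1 + c2 + c3 + c4| <= `|c1| + `|c2| + `|c3| + `|c4|.
  by do 3! (apply: le_trans (ler_normD _ _) _; rewrite lerD2r).
apply: contrapT => N.
have N1 : 4 * `|c1| < `|c1 + c2 + c3 + c4|.
  by rewrite ltNge; apply/negP => ?; apply: N; exists (x, y); split => //=; lra.
have N2 : 4 * `|c2| < `|c1 + c2 + c3 + c4|.
  by rewrite ltNge; apply/negP => ?; apply: N; exists (x + w, y); split => //=; lra.
have N3 : 4 * `|c3| < `|c1 + c2 + c3 + c4|.
  by rewrite ltNge; apply/negP => ?; apply: N; exists (x, y + h); split => //=; lra.
have N4 : 4 * `|c4| < `|c1 + c2 + c3 + c4|.
  by rewrite ltNge; apply/negP => ?; apply: N; exists (x + w, y + h); split => //=; lra.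
by lra.
Qed.

Lemma nested_intervals (x l : nat -> R) :
  (forall n, x n <= x n.+1) -> (forall n, x n.+1 + l n.+1 <= x n + l n) ->
  (forall n, 0 <= l n) -> exists a, forall n, x n <= a <= x n + l n.
Proof.
move=> x1 xl l0; have xle n k : (n <= k)%N -> x n <= x k.
  by move=> nk; apply: (@homo_leq _ x (fun a b => a <= b)) nk => //; exact: le_trans.
have xlle n k : (n <= k)%N -> x k + l k <= x n + l n.
  move=> nk; apply: (@homo_leq _ (fun n => x n + l n) (fun a b => b <= a)) nk => //.
  by move=> a b c ab bc; exact: le_trans ab.
have ub n : ubound (range x) (x n + l n).
  move=> _ [k _ <-]; have [nk|/ltnW kn] := leqP n k.
    by apply: le_trans (xlle _ _ nk); rewrite lerDl.
  by apply: le_trans (xle _ _ kn) _; rewrite lerDl.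
exists (sup (range x)) => n; apply/andP; split.
  by apply: ub_le_sup; [exists (x 0 + l 0); exact: ub|exists n].
by apply: ge_sup => //; exists (x 0), 0.
Qed.

(** Bisection retains at least a quarter of the circulation at each step, hence a multiple of 4^-n,
    whereas the local bound at the common point of the nested rectangles makes it o(4^-n). *)
Lemma goursat x y w h : 0 < w -> 0 < h -> CR_on x y w h ->
  circulation x y w h = 0.
Proof.
move=> w0 h0 uv; apply: contrapT => /eqP; rewrite -normr_gt0 => K0.
pose W n : R := w / 2 ^+ n; pose H n : R := h / 2 ^+ n.
have half (r : R) n : r / 2 ^+ n = r / 2 ^+ n.+1 + r / 2 ^+ n.+1.
  by rewrite exprS; field; rewrite expf_neq0.
have W0 n : 0 < W n by rewrite divr_gt0// exprn_gt0.
have H0 n : 0 < H n by rewrite divr_gt0// exprn_gt0.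
(* Guarding the conclusion by [CR_on] makes the choice function total; outside that case its value
   is arbitrary. *)
have step (np : nat * (R * R)) : exists q : R * R,
    CR_on np.2.1 np.2.2 (W np.1) (H np.1) ->
    [/\ np.2.1 <= q.1, q.1 + W np.1.+1 <= np.2.1 + W np.1,
      np.2.2 <= q.2, q.2 + H np.1.+1 <= np.2.2 + H np.1 &
      `|circulation np.2.1 np.2.2 (W np.1) (H np.1)| <=
        4 * `|circulation q.1 q.2 (W np.1.+1) (H np.1.+1)|].
  case: np => n [a b] /=; have [ab|ab] := pselect (CR_on a b (W n) (H n)); last first.
    by exists (a, b).
  move: ab; rewrite /W /H !(half _ n) => ab.
  have [q Hq] := circulation_bisect (ltW (W0 n.+1)) (ltW (H0 n.+1)) ab.
  by exists q.
have [F HF] := choice step.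
pose s := fix s n := if n is k.+1 then F (k, s k) else (x, y).
have inv n : CR_on (s n).1 (s n).2 (W n) (H n) /\
    `|circulation x y w h| <= 4 ^+ n * `|circulation (s n).1 (s n).2 (W n) (H n)|.
  elim: n => [|n [ab cn]] /=.
    by rewrite /W /H expr0 !divr1 mul1r.
  have [h1 h2 h3 h4 h5] := HF (n, s n) ab.
  split; first exact: CR_onS ab.
  by apply: le_trans cn _; rewrite exprSr -mulrA ler_pM2l// exprn_gt0.
have stepP n := HF (n, s n) (inv n).1.
have [a Ha] : exists a, forall n, (s n).1 <= a <= (s n).1 + W n.
  by apply: nested_intervals => n; last exact: ltW; have [] := stepP n.
have [b Hb] : exists b, forall n, (s n).2 <= b <= (s n).2 + H n.
  by apply: nested_intervals => n; last exact: ltW; have [] := stepP n.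
have ab : CR_at u v a b.
  by apply: (inv 0).1; [exact: Ha 0|exact: Hb 0].
(* Chosen so that the local bound is half of what bisection guarantees. *)
pose e := `|circulation x y w h| / (2 * (w + h) ^+ 2).
have e0 : 0 < e by rewrite divr_gt0// mulr_gt0// exprn_gt0// addr_gt0.
have [d d0 Hd] := circulation_local e0 ab.
have [n Hn] : exists n, W n < d /\ H n < d.
  pose n := Num.bound ((w + h) / d); exists n.
  have : (w + h) / d < 2 ^+ n.
    apply: lt_trans (archi_boundP _) _; first by rewrite divr_ge0// ltW// addr_gt0.
    by rewrite -natrX ltr_nat ltn_expl.
  rewrite ltr_pdivrMr// => k.
  by split; rewrite ltr_pdivrMr ?exprn_gt0// mulrC; lra.
have [abn cn] := inv n.
have := Hd _ _ _ _ (Ha n) (Hb n) Hn.1 Hn.2 abn.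
rewrite leNgt => /negP; apply; rewrite /W /H -mulrDl exprMn exprVn -exprM mulrA.
have -> : e * (w + h) ^+ 2 = `|circulation x y w h| / 2.
  by rewrite /e; field; rewrite gt_eqF// addr_gt0.
rewrite ltr_pdivrMr ?exprn_gt0// mulnC exprM (_ : 2 ^+ 2 = 4); last by ring.
rewrite [ltRHS]mulrC; apply: lt_le_trans cn.
by rewrite ltr_pdivrMr// ltr_pMr// ltr1n.
Qed.

End GoursatRectangle.

(** * One-variable derivatives and the complex exponential *)

Section RealDerivative.
Variable R : realType.
Implicit Types (f : R -> R) (x d : R).

Lemma is_deriveP f x d : is_derive x 1 f d <->
  (forall e, 0 < e -> exists2 r : R, 0 < r & forall h, `|h| < r ->
    `|f (x + h) - f x - h * d| <= e * `|h|).
Proof.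
split=> [[fx fd] e e0|H].
  have : h^-1 *: ((f \o shift x) (h *: 1) - f x) @[h --> 0^'] --> d.
    by rewrite -fd; exact: fx.
  move=> /cvgrPdist_lt /(_ _ e0); rewrite near_withinE => /nbhs_ballP[r /= r0 Hr].
  exists r => // h hr; have [->|h0] := eqVneq h 0.
    by rewrite addr0 subrr sub0r mul0r oppr0 normr0 mulr0.
  have /Hr /(_ h0) : ball (0 : R) r h by rewrite -ball_normE /= sub0r normrN.
  rewrite /GRing.scale /= mulr1 => /ltW H.
  have -> : f (x + h) - f x - h * d = - (h * (d - h^-1 * (f (h + x) - f x))).
    by rewrite (addrC h); field.
  by rewrite normrN normrM mulrC ler_pM2r ?normr_gt0.
have C : h^-1 *: ((f \o shift x) (h *: 1) - f x) @[h --> 0^'] --> d.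
  apply/cvgrPdist_le => e /H[r r0 Hr]; rewrite near_withinE.
  apply/nbhs_ballP; exists r => //= h; rewrite -ball_normE /= sub0r normrN => /Hr k h0.
  rewrite -(ler_pM2r (_ : 0 < `|h|)) ?normr_gt0// -normrM -normrN.
  apply: le_trans k; rewrite le_eqVlt; apply/orP; left; apply/eqP; congr `|_|.
  by rewrite /GRing.scale /= mulr1 (addrC h); field.
by apply: DeriveDef; [apply/cvg_ex; exists d|exact: cvg_lim C].
Qed.

End RealDerivative.

Section ComplexDerivative.
Variable R : realType.
Local Notation C := R[i].
Implicit Types (f g : C -> C) (x k : C).

Definition cdiff f x (l : C) := forall e : R, 0 < e -> exists2 d : R, 0 < d &
  forall k, cabs k < d -> cabs (f (x + k) - f x - k * l) <= e * cabs k.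

Lemma cdiff_lipschitz f x l : cdiff f x l -> exists2 B : R, 0 < B &
  exists2 d : R, 0 < d &
  forall k, cabs k < d -> cabs (f (x + k) - f x) <= B * cabs k.
Proof.
move=> fx; have [d d0 H] := fx _ ltr01.
exists (1 + cabs l); first by rewrite ltr_pwDl// cabs_ge0.
exists d => // k /H; rewrite mul1r mulrDl mul1r => fk.
rewrite -[f (x + k) - f x](subrK (k * l)).
by apply: le_trans (cabsD _ _) _; rewrite lerD// cabsM mulrC.
Qed.

Lemma cdiff_mul f g x l n : cdiff f x l -> cdiff g x n ->
  cdiff (fun z => f z * g z) x (f x * n + g x * l).
Proof.
move=> fx gx e e0.
have [B B0 [d1 d10 H1]] := cdiff_lipschitz fx.
have [A A0 [d2 d20 H2]] := cdiff_lipschitz gx.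
have f0 : 0 < cabs (f x) + 1 by rewrite ltr_wpDl// cabs_ge0.
have g0 : 0 < cabs (g x) + 1 by rewrite ltr_wpDl// cabs_ge0.
have [d3 d30 H3] := fx (e / 3 / (cabs (g x) + 1)) (divr_gt0 (divr_gt0 e0 (ltr0Sn _ 2)) g0).
have [d4 d40 H4] := gx (e / 3 / (cabs (f x) + 1)) (divr_gt0 (divr_gt0 e0 (ltr0Sn _ 2)) f0).
exists (Num.min (Num.min d1 d2) (Num.min (Num.min d3 d4) (e / 3 / (A * B)))) => [|k].
  by rewrite !lt_min d10 d20 d30 d40 !divr_gt0// mulr_gt0.
rewrite !lt_min => /andP[/andP[/H1 k1 /H2 k2] /andP[/andP[/H3 k3 /H4 k4] k5]].
have -> : f (x + k) * g (x + k) - f x * g x - k * (f x * n + g x * l) =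
    (f (x + k) - f x) * (g (x + k) - g x) +
    (f x * (g (x + k) - g x - k * n) + g x * (f (x + k) - f x - k * l)) by ring.
have E : e * cabs k = e / 3 * cabs k + (e / 3 * cabs k + e / 3 * cabs k) by field.
rewrite E; apply: le_trans (cabsD _ _) _; apply: lerD.
  rewrite cabsM; apply: (@le_trans _ _ ((B * cabs k) * (A * cabs k))).
    by apply: ler_pM => //; exact: cabs_ge0.
  rewrite mulrA; apply: ler_wpM2r; first exact: cabs_ge0.
  by move: k5; rewrite ltr_pdivlMr ?mulr_gt0// => /ltW; lra.
apply: le_trans (cabsD _ _) _; apply: lerD; rewrite cabsM.
  apply: (@le_trans _ _ ((cabs (f x) + 1) * (e / 3 / (cabs (f x) + 1) * cabs k))).
    by apply: ler_pM => //; rewrite ?cabs_ge0// lerDl.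
  by rewrite le_eqVlt; apply/orP; left; apply/eqP; field; rewrite gt_eqF.
apply: (@le_trans _ _ ((cabs (g x) + 1) * (e / 3 / (cabs (g x) + 1) * cabs k))).
  by apply: ler_pM => //; rewrite ?cabs_ge0// lerDl.
by rewrite le_eqVlt; apply/orP; left; apply/eqP; field; rewrite gt_eqF.
Qed.

Lemma cdiff_comp f g x l n : cdiff f x l -> cdiff g (f x) n ->
  cdiff (g \o f) x (l * n).
Proof.
move=> fx gx e e0.
have [B B0 [d1 d10 H1]] := cdiff_lipschitz fx.
have n0 : 0 < cabs n + 1 by rewrite ltr_wpDl// cabs_ge0.
have [d2 d20 H2] := gx (e / 2 / B) (divr_gt0 (divr_gt0 e0 (ltr0Sn _ 1)) B0).
have [d3 d30 H3] := fx (e / 2 / (cabs n + 1)) (divr_gt0 (divr_gt0 e0 (ltr0Sn _ 1)) n0).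
exists (Num.min (Num.min d1 d3) (d2 / B)) => [|k].
  by rewrite !lt_min d10 d30 divr_gt0.
rewrite !lt_min ltr_pdivlMr// => /andP[/andP[/H1 h1 /H3 h3] h2] /=.
set q := f (x + k) - f x in h1 h3 *.
have /H2 : cabs q < d2 by apply: le_lt_trans h1 _; rewrite mulrC.
rewrite {1}/q subrKC => h4.
rewrite -(subrK (q * n) (g (f (x + k)) - _)) -addrA mulrA -mulrBl.
apply: le_trans (cabsD _ _) _.
have -> : e * cabs k = e / 2 * cabs k + e / 2 * cabs k by field.
apply: lerD.
  apply: le_trans h4 _.
  have -> : e / 2 / B * cabs q = e / 2 * (cabs q / B) by ring.
  by rewrite ler_pM2l ?divr_gt0// ler_pdivrMr// mulrC.
rewrite cabsM; apply: (@le_trans _ _ (e / 2 / (cabs n + 1) * cabs k * (cabs n + 1))).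
  by apply: ler_pM => //; rewrite ?cabs_ge0// lerDl.
by rewrite le_eqVlt; apply/orP; left; apply/eqP; field; rewrite gt_eqF.
Qed.

Lemma cdiff_scale x (l : C) : cdiff (fun z => z * l) x l.
Proof.
move=> e e0; exists 1 => // k _.
have -> : (x + k) * l - x * l - k * l = 0 by ring.
by rewrite cabs0 mulr_ge0// ?cabs_ge0// ltW.
Qed.

Definition cexp (z : C) : C :=
  (expR (complex.Re z))%:C * (cos (complex.Im z) +i* sin (complex.Im z)).

Lemma cexpD z w : cexp (z + w) = cexp z * cexp w.
Proof.
case: z w => [a b] [c d]; rewrite /cexp /= expRD cosD sinD; simpc.
by apply/eqP; rewrite eq_complex /=; apply/andP; split; apply/eqP; ring.
Qed.

Lemma cexp_periodic z : cexp (z + (0 +i* (pi *+ 2))) = cexp z.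
Proof. by rewrite cexpD {2}/cexp /= expR0 cos2pi sin2pi [X in _ * X]mul1r mulr1. Qed.

Lemma cabs_cexp z : cabs (cexp z) = expR (complex.Re z).
Proof.
rewrite /cexp cabsM cabs_real ger0_norm ?expR_ge0// /cabs /=.
by rewrite cos2Dsin2 sqrtr1 mulr1.
Qed.

Lemma cexp_neq0 z : cexp z != 0.
Proof. by rewrite -cabs_gt0 cabs_cexp expR_gt0. Qed.

Lemma cdiff_cexp z : cdiff cexp z (cexp z).
Proof.
(* The derivative at the origin; the functional equation [cexpD] carries it to z. *)
have H0 : cdiff cexp 0 1.
  (* The error is at most 9 q |k|: 4 q |k| from the real part and 5 q |k| from the imaginary
     part. *)
  move=> e e0; have [q [q0 q1 qe]] : exists q : R, [/\ 0 < q, q <= 1 & 9 * q <= e].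
    exists (Num.min 1 (e / 9)); split; first by rewrite lt_min ltr01 divr_gt0.
      by rewrite ge_min lexx.
    by rewrite mulrC -ler_pdivlMr// ge_min lexx orbT.
  have [r1 r10 H1] := (is_deriveP expR 0 (expR 0)).1 (is_derive_expR 0) _ q0.
  have [r2 r20 H2] := (is_deriveP cos 0 (- sin 0)).1 (is_derive_cos 0) _ q0.
  have [r3 r30 H3] := (is_deriveP sin 0 (cos 0)).1 (is_derive_sin 0) _ q0.
  exists (Num.min (Num.min r1 (Num.min r2 r3)) q) => [|[a b]].
    by rewrite !lt_min r10 r20 r30.
  rewrite !lt_min => /andP[/and3P[k1 k2 k3] k4].
  have := normRe_le_cabs (a +i* b); have := normIm_le_cabs (a +i* b).
  have t0 := cabs_ge0 (a +i* b).
  set t := cabs (a +i* b) in t0 k1 k2 k3 k4 *.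
  move=> hb ha; rewrite /= in hb ha.
  have := H1 a (le_lt_trans ha k1); rewrite !add0r expR0 mulr1 => A.
  have := H2 b (le_lt_trans hb k2); rewrite !add0r sin0 cos0 oppr0 mulr0 subr0 => B.
  have := H3 b (le_lt_trans hb k3); rewrite !add0r sin0 cos0 subr0 mulr1 => D.
  have qle (y : R) : `|y| <= t -> q * `|y| <= q * t by rewrite ler_pM2l.
  have {}A := le_trans A (qle _ ha); have {}B := le_trans B (qle _ hb).
  have {}D := le_trans D (qle _ hb).
  rewrite mulr1 /cexp /= expR0 cos0 sin0 mul1r.
  set p := expR a - 1 - a in A; set c := cos b - 1 in B; set s := sin b - b in D.
  have -> : expR a = 1 + a + p by rewrite /p; ring.
  have -> : cos b = 1 + c by rewrite /c; ring.
  have -> : sin b = b + s by rewrite /s; ring.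
  have ap : `|a + p| <= 2 * t.
    apply: le_trans (ler_normD _ _) _; have : q * t <= 1 * t by rewrite ler_wpM2r.
    by lra.
  have bs : `|b + s| <= 2 * t.
    apply: le_trans (ler_normD _ _) _; have : q * t <= 1 * t by rewrite ler_wpM2r.
    by lra.
  apply: le_trans (cabs_le_ReIm _) _; simpc => /=.
  have -> : (1 + a + p) * (1 + c) - 1 - a = p + c + (a + p) * c by ring.
  have -> : (1 + a + p) * (b + s) - b = s + (a + p) * (b + s) by ring.
  have tq : t * t <= q * t by apply: ler_wpM2r => //; exact: ltW.
  have X1 : `|(a + p) * c| <= 2 * (q * t).
    rewrite normrM; apply: (@le_trans _ _ (2 * t * (q * t))).
      by apply: ler_pM.
    rewrite -mulrA ler_pM2l// -[leRHS]mul1r; apply: ler_wpM2r.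
      by rewrite mulr_ge0// ltW.
    exact: le_trans (ltW k4) q1.
  have X2 : `|(a + p) * (b + s)| <= 4 * (q * t).
    rewrite normrM; apply: (@le_trans _ _ (2 * t * (2 * t))); first exact: ler_pM.
    by move: tq; lra.
  have Y1 := ler_normD (p + c) ((a + p) * c).
  have Y2 := ler_normD p c.
  have Y3 := ler_normD s ((a + p) * (b + s)).
  have Y4 : 9 * q * t <= e * t by apply: ler_wpM2r.
  by lra.
move=> e e0; have z0 : 0 < cabs (cexp z) by rewrite cabs_gt0 cexp_neq0.
have [d d0 Hd] := H0 _ (divr_gt0 e0 z0); exists d => // k /Hd.
rewrite add0r mulr1 => K; rewrite cexpD.
have c0 : cexp 0 = 1 by rewrite /cexp /= expR0 cos0 sin0 mul1r.
have -> : cexp z * cexp k - cexp z - k * cexp z = cexp z * (cexp k - cexp 0 - k).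
  by rewrite c0; ring.
rewrite cabsM mulrC -ler_pdivlMr//; apply: le_trans K _.
by rewrite mulrAC.
Qed.

End ComplexDerivative.

(** * The derivative at 0 of a self-map of the disc *)

Section DerivativeBound.
Variable R : realType.
Local Notation C := R[i].
Implicit Types (f : C -> C) (l : C).

Lemma cdiff_CR (f : C -> C) (s t : R) l : cdiff f (s +i* t) l ->
  CR_at (fun a b => complex.Re (f (a +i* b))) (fun a b => complex.Im (f (a +i* b))) s t.
Proof.
move=> H; exists (complex.Re l), (complex.Im l) => e e0; have [d d0 Hd] := H e e0.
exists (d / 2) => [|a b ad bd]; first by rewrite divr_gt0.
have ab := cabs_le_ReIm (a +i* b); rewrite /= in ab.
have /Hd : cabs (a +i* b) < d by lra.
have -> : s +i* t + (a +i* b) = (s + a) +i* (t + b) by [].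
case: (f (_ +i* (t + b))) => x y; case: (f _) => x' y'; case: l {H Hd} => p q.
move=> K; have {}K := le_trans K (ler_wpM2l (ltW e0) ab).
split.
  apply: le_trans (le_trans (normRe_le_cabs _) K).
  by rewrite /= (mulrC p) (mulrC q).
apply: le_trans (le_trans (normIm_le_cabs _) K).
by rewrite /= (mulrC q) (mulrC p) addrC.
Qed.

(* The function [f (exp w) / exp w] is holomorphic on [Re w < 0] and
   2 pi i-periodic, so its mean over a period at [Re w = s] does not depend on
   s. It tends to [l] as s goes to -oo, and is bounded by [expR (- s)]. *)
Lemma Re_derivative_le1 f l :
  (forall z, cabs z < 1 -> exists n, cdiff f z n) ->
  (forall z, cabs z < 1 -> cabs (f z) <= 1) ->
  f 0 = 0 -> cdiff f 0 l -> complex.Re l <= 1.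
Proof.
move=> df f1 f0 fl; rewrite leNgt; apply/negP => l1.
(* The factor exp(-w) is written with [w * -1] so that [cdiff_scale] and the chain rule
   differentiate it. *)
pose H w := f (cexp w) * cexp (w * -1).
pose u a b := complex.Re (H (a +i* b)); pose v a b := complex.Im (H (a +i* b)).
have cexpN w : cexp (w * -1) = (cexp w)^-1.
  apply: (mulfI (cexp_neq0 w)); rewrite divff ?cexp_neq0// -cexpD mulrN1 subrr.
  by rewrite /cexp /= expR0 cos0 sin0 mulr1.
have CRuv a b : a < 0 -> CR_at u v a b.
  move=> a0; have z1 : cabs (cexp (a +i* b)) < 1 by rewrite cabs_cexp expR_lt1.
  have [n fn] := df _ z1; apply: cdiff_CR; apply: cdiff_mul.
    exact: cdiff_comp (@cdiff_cexp R _) fn.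
  exact: cdiff_comp (@cdiff_scale R _ (-1)) (@cdiff_cexp R _).
have CRc a : a < 0 -> cont_on (u a) 0 (0 + pi *+ 2).
  by move=> a0 x _; have [] := CR_continuous (CRuv a x a0).
have p0 : 0 < pi *+ 2 :> R by rewrite pmulrn_lgt0 ?pi_gt0.
(* On a rectangle of height 2 pi the horizontal sides cancel by periodicity, so the two vertical
   integrals agree. *)
have mean s0 s1 : s0 < s1 -> s1 < 0 ->
    rint (u s1) 0 (0 + pi *+ 2) = rint (u s0) 0 (0 + pi *+ 2).
  move=> s01 s10; have d0 : 0 < s1 - s0 by rewrite subr_gt0.
  have /(goursat d0 p0) : CR_on u v s0 0 (s1 - s0) (pi *+ 2).
    move=> a b /andP[_]; rewrite subrKC => a1 _; apply: CRuv.
    exact: le_lt_trans s10.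
  rewrite /circulation subrKC add0r.
  have -> : v^~ (pi *+ 2) = v^~ 0.
    apply/funext => x; have E : x +i* (pi *+ 2) = x +i* 0 + (0 +i* (pi *+ 2)).
      by apply/eqP; rewrite eq_complex /= addr0 add0r !eqxx.
    by rewrite /v /H !cexpN E cexp_periodic.
  by lra.
have hp : 0 <= 0 + pi *+ 2 :> R by rewrite add0r ltW.
(* Now Re l = 1 + 3e. The mean is at most exp y = 1 + e on Re w = -y, and at least Re l - e = 1 + 2e
   on Re w = s, far enough to the left. *)
pose e := (complex.Re l - 1) / 3; have e0 : 0 < e by rewrite divr_gt0// subr_gt0.
have [y ey] : exists y, expR y = 1 + e by apply: expR_total; rewrite addr_gt0.
have y0 : 0 < y by rewrite -expR_gt1 ey ltrDl.
have [d d0 Hd] := fl _ e0.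
have [s es] : exists s, expR s = Num.min (d / 2) (expR (- y) / 2).
  by apply: expR_total; rewrite lt_min !divr_gt0// expR_gt0.
have sy : s < - y.
  rewrite -ltr_expR es gt_min; apply/orP; right.
  by rewrite ltr_pdivrMr// ltr_pMr ?expR_gt0// ltr1n.
have sd : expR s < d.
  rewrite es gt_min; apply/orP; left.
  by rewrite ltr_pdivrMr// ltr_pMr// ltr1n.
have ny0 : - y < 0 by rewrite oppr_lt0.
have U1 : forall x, 0 <= x <= 0 + pi *+ 2 -> `|u (- y) x - (0 + 0 * (x - 0))| <= 1 + e.
  move=> x _; rewrite mul0r addr0 subr0; apply: le_trans (normRe_le_cabs _) _.
  rewrite /H cexpN cabsM cabsV cabs_cexp /= expRN invrK ey.
  rewrite -[leRHS]mul1r; apply: ler_wpM2r; first by rewrite addr_ge0// ltW.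
  by apply: f1; rewrite cabs_cexp expR_lt1.
have s0 : s < 0 by apply: lt_trans ny0.
have U2 : forall x, 0 <= x <= 0 + pi *+ 2 ->
    `|u s x - (complex.Re l + 0 * (x - 0))| <= e.
  move=> x _; rewrite mul0r addr0 /u /H cexpN.
  set z := cexp _; have zs : cabs z = expR s by rewrite cabs_cexp.
  have := Hd z; rewrite zs => /(_ sd); rewrite f0 add0r subr0 => K.
  have z0 : 0 < cabs z by rewrite cabs_gt0 cexp_neq0.
  rewrite -(raddfB (@complex.Re R : Rcomplex R -> R)).
  apply: le_trans (normRe_le_cabs _) _.
  have -> : f z * z^-1 - l = (f z - z * l) / z by field; exact: cexp_neq0.
  by rewrite cabsM cabsV ler_pdivrMr// zs.
have {U1} := rint_affine_bound hp (CRc _ ny0) U1.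
have {U2} := rint_affine_bound hp (CRc _ s0) U2.
rewrite (mean _ _ sy ny0) !mul0r !addr0 !add0r !subr0 !ler_norml.
move=> /andP[B _] /andP[_ A].
have : complex.Re l * pi *+ 2 - e * pi *+ 2 <= (1 + e) * pi *+ 2.
  by rewrite -!mulrnAr; lra.
rewrite -!mulrnAr -mulrBl ler_pM2r//.
by rewrite /e; lra.
Qed.

Lemma derivative_le1 f l :
  (forall z, cabs z < 1 -> exists n, cdiff f z n) ->
  (forall z, cabs z < 1 -> cabs (f z) <= 1) ->
  f 0 = 0 -> cdiff f 0 l -> cabs l <= 1.
Proof.
move=> df f1 f0 fl; have [->|l0] := eqVneq l 0; first by rewrite cabs0.
have al : 0 < cabs l by rewrite cabs_gt0.
(* Multiplying f by this unimodular factor makes its derivative at 0 equal to |l|. *)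
pose k := Num.conj l / (cabs l)%:C.
have k1 : cabs k = 1.
  by rewrite cabsM cabsV cabsJ cabs_real ger0_norm ?cabs_ge0// divff// gt_eqF.
have -> : cabs l = complex.Re (l * k).
  rewrite /k mulrA mulJ -fmorphV -rmorphM /= expr2 mulfK// gt_eqF//.
apply: (@Re_derivative_le1 (fun z => f z * k)).
- move=> z /df[n fn]; exists (n * k).
  exact: cdiff_comp fn (@cdiff_scale R _ k).
- by move=> z /f1; rewrite cabsM k1 mulr1.
- by rewrite f0 mul0r.
- exact: cdiff_comp fl (@cdiff_scale R _ k).
Qed.

End DerivativeBound.

(** * The Schwarz lemma and automorphisms fixing the origin *)

Section Schwarz.
Variable R : realType.
Local Notation C := R[i].

Definition hholo m n (f : 'rV[C]_m -> 'rV[C]_n) :=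
  forall z, unit_ball z -> exists L, hdiff f z L.

Lemma hnorm_rV1 (z : 'rV[C]_1) : hnorm z = cabs (z 0 0).
Proof.
apply/eqP; rewrite -(@eqrXn2 _ 2)// ?hnorm_ge0 ?cabs_ge0//.
by rewrite hnorm_sqrE big_ord1.
Qed.

Lemma rV1E (z : 'rV[C]_1) : z = (z 0 0)%:M.
Proof. by apply/rowP => i; rewrite mxE (ord1 i) eqxx mulr1n. Qed.

Lemma scalar_mx00 (x : C) : (x%:M : 'rV[C]_1) 0 0 = x.
Proof. by rewrite mxE eqxx mulr1n. Qed.

Lemma hdiff_cdiff (f : 'rV[C]_1 -> 'rV[C]_1) x L : hdiff f x L ->
  cdiff (fun z => f z%:M 0 0) (x 0 0) (L 0 0).
Proof.
move=> H e /H[d d0 Hd]; exists d => // k kd.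
have := Hd k%:M; rewrite !hnorm_rV1 scalar_mx00 => /(_ kd).
rewrite raddfD /= -rV1E !mxE.
by rewrite big_ord1 mxE eqxx mulr1n.
Qed.

Lemma ball_rV1 (z : C) : unit_ball (z%:M : 'rV[C]_1) <-> cabs z < 1.
Proof. by rewrite /unit_ball /= hnorm_rV1 scalar_mx00. Qed.

Lemma hholo_comp m n p (f : 'rV[C]_m -> 'rV[C]_n) (g : 'rV[C]_n -> 'rV[C]_p) :
  hholo f -> (forall z, unit_ball z -> unit_ball (f z)) -> hholo g -> hholo (g \o f).
Proof.
move=> hf fB hg z z1; have [L fL] := hf z z1; have [M gM] := hg _ (fB z z1).
by exists (L *m M); exact: hdiff_comp.
Qed.

Lemma hholo_ball_involution m (a : 'rV[C]_m) : unit_ball a ->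
  hholo (ball_involution a).
Proof. by move=> a1 z z1; exists (ball_jac a z); exact: hdiff_ball_involution. Qed.

(** Composing f with the involutions centred at x and at f x gives a self-map fixing 0, to which the
    derivative bound applies. The disc is the ball of row vectors of length 1, where the derivative
    of an involution is -s^2 at 0 and -s^-2 at its centre. *)
Lemma schwarz_pick (f : 'rV[C]_1 -> 'rV[C]_1) x L :
  hholo f -> (forall z, unit_ball z -> unit_ball (f z)) -> unit_ball x ->
  hdiff f x L -> cabs (L 0 0) * (1 - hnorm x ^+ 2) <= 1 - hnorm (f x) ^+ 2.
Proof.
move=> hf fB x1 fL; have fx1 := fB _ x1.
pose G := ball_involution (f x) \o (f \o ball_involution x).
have hG : hholo G.
  apply: hholo_comp; last exact: hholo_ball_involution.
    by apply: hholo_comp => //; [exact: hholo_ball_involution|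
       move=> z; exact: ball_involution_ball].
  by move=> z z1 /=; apply/fB/ball_involution_ball.
have z0 := unit_ball0 R 1.
have dG : hdiff G 0 (ball_jac x 0 *m L *m ball_jac (f x) (f x)).
  apply: hdiff_comp; last first.
    by rewrite /= ball_involution0//; exact: hdiff_ball_involution.
  by apply: hdiff_comp; rewrite ?ball_involution0//; exact: hdiff_ball_involution.
have sx := hdot_shrink x1; have sfx := hdot_shrink fx1.
have px := shrink1_neq0 x; have pfx := shrink1_neq0 (f x).
have nfx := shrink_neq0 fx1.
have e1 : (ball_jac x 0) 0 0 = - (ball_shrink x)%:C ^+ 2.
  have := congr1 (fun M : 'rV[C]_1 => M 0 0) (mul_ball_jac x 0 1%:M).
  rewrite mul1mx => ->; rewrite hdot0l subr0 invr1 scale1r ball_involution0//.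
  rewrite !mxE eqxx mulr1n mulr1; move: sx; rewrite /hdot !big_ord1 mxE eqxx mulr1n mul1r => sx.
  have -> : (Num.conj (x 0 0)) * (x 0 0 - (1 + (ball_shrink x)%:C)^-1 * x 0 0) =
     (x 0 0 * Num.conj (x 0 0)) * (1 - (1 + (ball_shrink x)%:C)^-1) by ring.
  by rewrite sx; field.
have e2 : (ball_jac (f x) (f x)) 0 0 = - (ball_shrink (f x))%:C ^- 2.
  have := congr1 (fun M : 'rV[C]_1 => M 0 0) (mul_ball_jac (f x) (f x) 1%:M).
  rewrite mul1mx => ->; rewrite sfx ball_involution_self// opprB addrCA subrr addr0 sub0r.
  rewrite !mxE eqxx mulr1n mulr1; move: sfx; rewrite /hdot !big_ord1 mxE eqxx mulr1n mul1r => sfx.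
  have -> : (Num.conj (f x 0 0)) * (- ((1 + (ball_shrink (f x))%:C)^-1 * f x 0 0)) =
     - (f x 0 0 * Num.conj (f x 0 0)) * (1 + (ball_shrink (f x))%:C)^-1 by ring.
  by rewrite sfx; field; apply/andP.
have dG0 : cdiff (fun z => G z%:M 0 0) 0
    ((ball_jac x 0 *m L *m ball_jac (f x) (f x)) 0 0).
  by have := hdiff_cdiff dG; have -> : (0 : 'rV[C]_1) 0 0 = 0 by rewrite mxE.
have GB z : unit_ball z -> unit_ball (G z).
  by move=> z1; apply: ball_involution_ball => //; apply/fB/ball_involution_ball.
have G0 : G 0 = 0.
  by rewrite /G /= ball_involution0// ball_involution_self.
have := @derivative_le1 R (fun z => G z%:M 0 0) _ _ _ _ dG0.
have mul11 (A B : 'M[C]_1) : (A *m B) 0 0 = A 0 0 * B 0 0 by rewrite mxE big_ord1.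
rewrite !mul11 e1 e2.
have -> : - (ball_shrink x)%:C ^+ 2 * L 0 0 * - (ball_shrink (f x))%:C ^- 2 =
   L 0 0 * ((ball_shrink x ^+ 2) / ball_shrink (f x) ^+ 2)%:C.
  by rewrite rmorphM fmorphV !rmorphXn /=; ring.
rewrite cabsM cabs_real ger0_norm ?divr_ge0 ?sqr_ge0//.
rewrite !ball_shrink_sqr// mulrA ler_pdivrMr ?unit_ball_sqr// mul1r; apply.
- move=> z /ball_rV1 /hG[M GM]; exists (M 0 0).
  by have := hdiff_cdiff GM; rewrite scalar_mx00.
- by move=> z /ball_rV1 /GB; rewrite /unit_ball /= hnorm_rV1 => /ltW.
- by rewrite raddf0 G0 mxE.
Qed.

(* The Schwarz-Pick inequality makes [(1 + y s) (1 - s) / ((1 - y s) (1 + s))]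
   nonincreasing on [0, 1[, where [y s] is the real part of [f s]. *)
Lemma schwarz1 (f : 'rV[C]_1 -> 'rV[C]_1) (t : R) :
  hholo f -> (forall z, unit_ball z -> unit_ball (f z)) -> f 0 = 0 ->
  0 <= t < 1 -> complex.Re (f t%:C%:M 0 0) <= t.
Proof.
move=> hf fB f0 /andP[t0 t1].
pose y (s : R) := complex.Re (f s%:C%:M 0 0).
have inB (s : R) : 0 <= s < 1 -> unit_ball (s%:C%:M : 'rV[C]_1).
  by move=> /andP[s0 s1]; apply/ball_rV1; rewrite cabs_real ger0_norm.
have yb (s : R) : 0 <= s < 1 -> `|y s| < 1.
  move=> /inB /fB; rewrite /unit_ball /= hnorm_rV1; apply: le_lt_trans.
  exact: normRe_le_cabs.
have dy (s : R) : exists l : R, 0 <= s < 1 ->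
    is_derive s 1 y l /\ l * (1 - s ^+ 2) <= 1 - y s ^+ 2.
  have [s01|] := boolP (0 <= s < 1); last by exists 0.
  have [L fL] := hf _ (inB _ s01); exists (complex.Re (L 0 0)) => _; split.
    apply/is_deriveP => e e0; have [d d0 Hd] := hdiff_cdiff fL e0.
    exists d => // h hd; have := Hd h%:C.
    rewrite !scalar_mx00 cabs_real => /(_ hd); apply: le_trans.
    rewrite -rmorphD; apply: le_trans (normRe_le_cabs _).
    rewrite /y; case: (f (s + h)%:C%:M 0 0) => a b; case: (f _ 0 0) => a' b'.
    by case: (L 0 0) => p q; rewrite /= mul0r subr0.
  have := schwarz_pick hf fB (inB _ s01) fL.
  rewrite !hnorm_rV1 scalar_mx00 cabs_real real_normK ?num_real// => K.
  apply: le_trans (le_trans _ K) _.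
    apply: ler_wpM2r; last exact: Re_le_cabs.
    by case/andP: s01 => s0 s1; rewrite subr_ge0 expr_le1// ltW.
  by rewrite lerD2l lerN2 cabs_sqr lerDl sqr_ge0.
have [l Hl] := choice dy.
(* This k equals 1 at 0, because [y 0 = 0], and k t <= 1 amounts to y t <= t. *)
pose k (s : R) := (1 + y s) * (1 - s) * ((1 - y s) * (1 + s))^-1.
have den (s : R) : 0 <= s < 1 -> 0 < (1 - y s) * (1 + s).
  move=> s01; have := yb _ s01; rewrite ltr_norml => /andP[_ ys].
  by rewrite mulr_gt0 ?subr_gt0// ltr_pwDl//; case/andP: s01.
(* The quotient rule for k; Schwarz-Pick makes the numerator nonpositive. *)
pose dk (s : R) := (2 * (l s * (1 - s ^+ 2)) - 2 * (1 - y s ^+ 2)) /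
   ((1 - y s) * (1 + s)) ^+ 2.
have Dk (s : R) : 0 <= s < 1 -> is_derive s 1 k (dk s).
  move=> s01; have [ys _] := Hl s s01.
  have dn : (1 - y s) * (1 + s) != 0 by rewrite gt_eqF// den.
  have D1 : is_derive s 1 (fun r : R => (1 - y r) * (1 + r)) (- l s * (1 + s) + (1 - y s)).
    by apply: is_derive_eq; rewrite /GRing.scale /=; ring.
  have D2 := @is_deriveV R (fun r : R => (1 - y r) * (1 + r)) s _ 1 dn D1.
  rewrite /k; apply: is_derive_eq; rewrite /GRing.scale /= /dk.
  by field; move: dn; rewrite mulf_eq0 negb_or andbC.
have k0 : k 0 = 1.
  have y0 : y 0 = 0.
    have E : (0%:C)%:M = 0 :> 'rV[C]_1 by exact: raddf0.
    by rewrite /y E f0 mxE.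
  by rewrite /k y0; field.
have kt : k t <= 1.
  move: t0; rewrite le_eqVlt => /predU1P[<-|t0]; first by rewrite k0.
  have in01 (s : R) : s \in `[0, t] -> 0 <= s < 1.
    by rewrite in_itv /= => /andP[-> st]; exact: le_lt_trans t1.
  have [] := @MVT _ k dk 0 t t0.
  - by move=> s /subset_itv_oo_cc /in01; exact: Dk.
  - apply: continuous_in_subspaceT => s /[!inE] /in01 s01.
    apply/differentiable_continuous/derivable1_diffP.
    by have [] := Dk s s01.
  - move=> s /subset_itv_oo_cc /in01 s01; rewrite k0 subr0 => E.
    have : dk s * t <= 0.
      rewrite pmulr_lle0// /dk pmulr_lle0 ?invr_gt0 ?exprn_gt0 ?den//.
      by have [_] := Hl _ s01; lra.
    by rewrite -E subr_le0.
have t01 : 0 <= t < 1 by rewrite t0.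
move: kt; rewrite /k ler_pdivrMr ?den// mul1r -/(y t).
by lra.
Qed.

End Schwarz.

(** * Automorphisms of the ball and unitary maps *)

Section Automorphism.
Variables (R : realType) (m : nat).
Local Notation C := R[i].
Local Notation V := 'rV[C]_m.
Implicit Types (F G : V -> V) (z w a : V).

Lemma sq_le (x y : R) : 0 <= x -> x <= y -> x ^+ 2 <= y ^+ 2.
Proof. by move=> x0 xy; rewrite !expr2; exact: ler_pM. Qed.

Definition ball_map F := hholo F /\ forall z, unit_ball z -> unit_ball (F z).

Lemma ball_map_comp F G : ball_map F -> ball_map G -> ball_map (G \o F).
Proof.
move=> [hF FB] [hG GB]; split; first exact: hholo_comp.
by move=> z z1; exact/GB/FB.
Qed.

Lemma ball_map_involution a : unit_ball a -> ball_map (ball_involution a).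
Proof.
move=> a1; split; first exact: hholo_ball_involution.
by move=> z; exact: ball_involution_ball.
Qed.

(** Restrict F to the complex line through z and project onto the direction of F z: this self-map of
    the disc fixes 0 and takes the value |F z| at |z|. *)
Lemma schwarz_ball F z : ball_map F -> F 0 = 0 -> unit_ball z ->
  hnorm (F z) <= hnorm z.
Proof.
move=> [hF FB] F0 z1.
have [->|Fz0] := eqVneq (F z) 0; first by rewrite hnorm0 hnorm_ge0.
have z0 : z != 0 by apply: contra_neq Fz0 => ->.
have nz : 0 < hnorm z by rewrite hnorm_gt0.
have nFz : 0 < hnorm (F z) by rewrite hnorm_gt0.
pose zt := (hnorm z)^-1%:C *: z; pose w := (hnorm (F z))^-1%:C *: F z.
have zt1 : hnorm zt = 1.
  by rewrite hnormZ cabs_real ger0_norm ?invr_ge0 ?ltW// mulVf// gt_eqF.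
have w1 : hnorm w = 1.
  by rewrite hnormZ cabs_real ger0_norm ?invr_ge0 ?ltW// mulVf// gt_eqF.
have ztE (l : 'rV[C]_1) : l *m zt = l 0 0 *: zt.
  by rewrite {1}(rV1E l) mul_scalar_mx.
have ztB (l : 'rV[C]_1) : unit_ball l -> unit_ball (l *m zt).
  by rewrite /unit_ball /= ztE hnormZ zt1 mulr1 hnorm_rV1.
pose f := (fun y : V => y *m \col_k Num.conj (w 0 k)) \o (F \o (fun l : 'rV[C]_1 => l *m zt)).
have fE l : f l = (hdot (F (l *m zt)) w)%:M by rewrite /f /= mul_col_conj.
have t01 : 0 <= hnorm z < 1 by rewrite hnorm_ge0.
have := @schwarz1 R f (hnorm z) _ _ _ t01.
rewrite (fE (hnorm z)%:C%:M) scalar_mx00 ztE scalar_mx00 scalerA -rmorphM /= mulfV ?gt_eqF// scale1r.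
rewrite hdotZr conj_realC hdotzz -rmorphM /= expr2 mulKf ?gt_eqF//; apply.
- apply: (@hholo_comp _ _ m).
  + apply: hholo_comp => //.
    by move=> l _; exists zt; exact: hdiff_linear.
  + by move=> l l1 /=; apply/FB/ztB.
  + by move=> y _; eexists; exact: hdiff_linear.
- move=> l l1; rewrite fE /unit_ball /= hnorm_rV1 scalar_mx00.
  apply: le_lt_trans (hdot_CauchySchwarz _ _) _; rewrite w1 mulr1.
  exact/FB/ztB.
- by rewrite fE mul0mx F0 hdot0l raddf0.
Qed.

(** Extracts the first-order coefficient of an estimate in t without passing to a limit; applied to
    the norm of a difference, it proves identities between derivatives. *)
Lemma infinitesimal_le0 (X B : R) : 0 <= B ->
  (forall e, 0 < e -> exists2 d : R, 0 < d & forall t, 0 < t < d ->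
    X * t <= B * t ^+ 2 + e * t) -> X <= 0.
Proof.
move=> B0 H; rewrite leNgt; apply/negP => X0.
have [d d0 Hd] := H (X / 2) (divr_gt0 X0 (ltr0Sn _ 1)).
pose t := Num.min (d / 2) (X / (4 * (B + 1))).
have B1 : 0 < B + 1 by rewrite ltr_wpDl.
have t0 : 0 < t by rewrite lt_min !divr_gt0// mulr_gt0.
have td : t < d.
  by rewrite gt_min; apply/orP; left; rewrite ltr_pdivrMr// ltr_pMr// ltr1n.
have := Hd t; rewrite t0 td => /(_ isT).
have : B * t <= X / 4.
  have tX : t <= X / (4 * (B + 1)) by rewrite ge_min lexx orbT.
  apply: (@le_trans _ _ ((B + 1) * (X / (4 * (B + 1))))).
    by apply: ler_pM => //; [exact: ltW|lra].
  by rewrite le_eqVlt; apply/orP; left; apply/eqP; field; rewrite gt_eqF.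
move=> /(ler_wpM2r (ltW t0)); rewrite expr2 mulrA => K1 K2.
have : 0 < X * t by rewrite mulr_gt0.
by lra.
Qed.

Lemma cabs_sqr_1B k : cabs (1 - k : C) ^+ 2 = 1 - 2 * complex.Re k + cabs k ^+ 2.
Proof. by case: k => x y; rewrite !cabs_sqr /=; ring. Qed.

Lemma unit_ball_scale z : exists2 s : R, 0 < s & unit_ball (s%:C *: z).
Proof.
have n0 : 0 < hnorm z + 1 by rewrite ltr_wpDl// hnorm_ge0.
exists (hnorm z + 1)^-1; first by rewrite invr_gt0.
rewrite /unit_ball /= hnormZ cabs_real ger0_norm ?invr_ge0 ?ltW//.
by rewrite mulrC ltr_pdivrMr// mul1r ltrDl.
Qed.

Lemma unit_ball_shrink z (t : R) : unit_ball z -> 0 < t < 1 -> unit_ball (t%:C *: z).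
Proof.
move=> z1 /andP[t0 t1]; rewrite /unit_ball /= hnormZ cabs_real gtr0_norm//.
by apply: le_lt_trans z1; rewrite ler_piMl ?hnorm_ge0// ltW.
Qed.

Section FixingOrigin.
Variables F G : V -> V.
Hypotheses (hF : ball_map F) (hG : ball_map G) (F0 : F 0 = 0).
Hypothesis FK : forall z, unit_ball z -> G (F z) = z.

(** The Schwarz lemma for F and for its inverse G. The section ends just after, so that F and G can
    be instantiated by conjugated automorphisms as well. *)
Lemma hnorm_fixing_origin z : unit_ball z -> hnorm (F z) = hnorm z.
Proof.
move=> z1; have G0 : G 0 = 0 by rewrite -{1}F0 FK//; exact: unit_ball0.
apply/eqP; rewrite eq_le (schwarz_ball hF F0 z1)/= -{1}(FK z1).
exact: schwarz_ball hG G0 (hF.2 _ z1).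
Qed.

End FixingOrigin.

Section FixingOriginLinear.
Variables F G : V -> V.
Hypotheses (hF : ball_map F) (hG : ball_map G) (F0 : F 0 = 0).
Hypothesis FK : forall z, unit_ball z -> G (F z) = z.

(* The automorphism [p_{F a} \o F \o p_a] also fixes the origin, hence
   preserves the norm. *)
Lemma cabs_1Bhdot_fixing_origin z a : unit_ball z -> unit_ball a ->
  cabs (1 - hdot (F z) (F a)) ^+ 2 = cabs (1 - hdot z a) ^+ 2.
Proof.
move=> z1 a1; have Fz1 := hF.2 _ z1; have Fa1 := hF.2 _ a1.
have nF := hnorm_fixing_origin hF hG F0 FK.
have E : hnorm (ball_involution (F a) (F z)) = hnorm (ball_involution a z).
  have pz1 := ball_involution_ball a1 z1.
  have p1 := ball_map_involution a1; have p2 := ball_map_involution Fa1.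
  rewrite -{1}(ball_involutionK a1 z1).
  refine (@hnorm_fixing_origin (ball_involution (F a) \o (F \o ball_involution a))
     (ball_involution a \o (G \o ball_involution (F a))) _ _ _ _ _ pz1).
  - exact: ball_map_comp (ball_map_comp p1 hF) p2.
  - exact: ball_map_comp (ball_map_comp p2 hG) p1.
  - by rewrite /= ball_involution0// ball_involution_self.
  - move=> y y1 /=; have py := ball_involution_ball a1 y1.
    by rewrite (ball_involutionK Fa1 (hF.2 _ py)) FK// ball_involutionK.
(* The diagonal identity at (a, z) and at (F a, F z): the left sides and the numerators agree, hence
   so do the denominators. *)
have H := hnorm_ball_involution Fa1 Fz1.
rewrite E (hnorm_ball_involution a1 z1) (nF _ z1) (nF _ a1) in H.
have n0 : (1 - hnorm a ^+ 2) * (1 - hnorm z ^+ 2) != 0.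
  exact: mulf_neq0 (lt0r_neq0 (unit_ball_sqr a1)) (lt0r_neq0 (unit_ball_sqr z1)).
exact/esym/invr_inj/(mulfI n0 H).
Qed.

(* The terms of order one in t, once a is replaced with t a in
   [cabs_1Bhdot_fixing_origin]. *)
Lemma Re_hdot_fixing_origin L z a : hdiff F 0 L -> unit_ball z -> unit_ball a ->
  complex.Re (hdot (F z) (a *m L)) = complex.Re (hdot z a).
Proof.
move=> FL z1 a1; apply/eqP; rewrite -subr_eq0 -normr_eq0 eq_le normr_ge0 andbT.
have nF := hnorm_fixing_origin hF hG F0 FK.
(* Expanding both squares, twice the difference of the real parts is a difference of two numbers in
   [0, t^2]; replacing F(t a) by t a L costs at most e t more. *)
apply: (@infinitesimal_le0 _ 1) => // e e0; have [d d0 Hd] := FL e e0.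
exists (Num.min d 1) => [|t]; first by rewrite lt_min d0 ltr01.
rewrite lt_min => /and3P[t0 td t1].
have ta1 : unit_ball (t%:C *: a) by apply: unit_ball_shrink => //; rewrite t0.
have nta : hnorm (t%:C *: a) = t * hnorm a by rewrite hnormZ cabs_real gtr0_norm.
have nta1 : t * hnorm a <= t by rewrite ler_piMr ?ltW.
have := Hd (t%:C *: a); rewrite nta => /(_ (le_lt_trans nta1 td)).
rewrite add0r F0 subr0 -scalemxAl => K.
have /eqP := cabs_1Bhdot_fixing_origin z1 ta1.
rewrite !cabs_sqr_1B -subr_eq0.
set p := F (t%:C *: a) in K *.
have np : hnorm p <= t by rewrite /p nF// nta.
have c1 : cabs (hdot (F z) p) ^+ 2 <= t ^+ 2.
  apply: sq_le; first exact: cabs_ge0.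
  apply: le_trans (hdot_CauchySchwarz _ _) _; rewrite nF// -[leRHS]mul1r.
  by apply: ler_pM np; [exact: hnorm_ge0|exact: hnorm_ge0|exact: ltW].
have c2 : cabs (hdot z (t%:C *: a)) ^+ 2 <= t ^+ 2.
  apply: sq_le; first exact: cabs_ge0.
  have nta2 : hnorm (t%:C *: a) <= t by rewrite nta.
  apply: le_trans (hdot_CauchySchwarz _ _) _; rewrite -[leRHS]mul1r.
  by apply: ler_pM nta2; [exact: hnorm_ge0|exact: hnorm_ge0|exact: ltW].
have c3 : `|complex.Re (hdot (F z) p) - complex.Re (hdot (F z) (a *m L)) * t| <= e * t.
  have -> : complex.Re (hdot (F z) p) - complex.Re (hdot (F z) (a *m L)) * t =
     complex.Re (hdot (F z) (p - t%:C *: (a *m L))).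
    rewrite hdotBr hdotZr conj_realC.
    by case: (hdot _ p) => ? ?; case: (hdot _ _) => ? ? /=; ring.
  apply: le_trans (normRe_le_cabs _) _; apply: le_trans (hdot_CauchySchwarz _ _) _.
  have {}K : hnorm (p - t%:C *: (a *m L)) <= e * t.
    by apply: le_trans K _; rewrite ler_pM2l.
  rewrite -[leRHS]mul1r; apply: ler_pM K; rewrite ?hnorm_ge0//.
  by rewrite nF//; exact: ltW.
have c4 : complex.Re (hdot z (t%:C *: a)) = complex.Re (hdot z a) * t.
  by rewrite hdotZr conj_realC; case: (hdot _ _) => ? ? /=; ring.
rewrite c4 => /eqP E.
have s1 := sqr_ge0 (cabs (hdot (F z) p)).
have s2 := sqr_ge0 (cabs (hdot z (t%:C *: a))).
rewrite -{1}(gtr0_norm t0) -normrM ler_norml.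
move: c3; rewrite ler_norml => /andP[c3 c3'].
move: c1 c2 s1 s2 E; rewrite !mul1r; set A := cabs _ ^+ 2; set B := cabs _ ^+ 2.
move=> *; apply/andP; split; lra.
Qed.

(** The imaginary part is the real part with a replaced by i a. Both sides are conjugate-linear in
    a, which may therefore be scaled into the ball. *)
Lemma hdot_fixing_origin L z a : hdiff F 0 L -> unit_ball z ->
  hdot (F z) (a *m L) = hdot z a.
Proof.
move=> FL z1; wlog a1 : a / unit_ball a.
  move=> H; have [s s0 /H] := unit_ball_scale a.
  rewrite -scalemxAl !hdotZr conj_realC; apply: mulfI.
  by rewrite -cabs_eq0 cabs_real normr_eq0 gt_eqF.
have ia1 : unit_ball ('i *: a).
  by rewrite /unit_ball /= hnormZ /cabs /= expr0n expr1n add0r sqrtr1 mul1r.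
have := Re_hdot_fixing_origin FL z1 a1; have := Re_hdot_fixing_origin FL z1 ia1.
rewrite -scalemxAl !hdotZr.
case: (hdot _ _) => x y; case: (hdot _ _) => x' y' /=.
by rewrite !mul0r !sub0r !mulN1r !opprK => -> ->.
Qed.

(** The candidate is the derivative L at 0. Replacing z by t z in [hdot_fixing_origin] shows that L
    preserves the Hermitian product, hence is invertible; then F z - z L is orthogonal to the range
    of L, which is the whole space. *)
Lemma fixing_origin_unitary : exists U : 'M[C]_m,
  (forall z, unit_ball z -> F z = z *m U) /\
  (forall z w, hdot (z *m U) (w *m U) = hdot z w).
Proof.
have [L FL] := hF.1 _ (unit_ball0 R m); exists L.
have U z w : hdot (z *m L) (w *m L) = hdot z w.
  wlog z1 : z / unit_ball z.
    move=> H; have [s s0 /H] := unit_ball_scale z.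
    rewrite -scalemxAl !hdotZl; apply: mulfI.
    by rewrite -cabs_eq0 cabs_real normr_eq0 gt_eqF.
  apply/eqP; rewrite -subr_eq0 -cabs_eq0 eq_le cabs_ge0 andbT.
  apply: (@infinitesimal_le0 _ 0) => // e e0.
  have w0 : 0 < hnorm (w *m L) + 1 by rewrite ltr_wpDl ?hnorm_ge0.
  have [d d0 Hd] := FL _ (divr_gt0 e0 w0).
  exists (Num.min d 1) => [|t]; first by rewrite lt_min d0 ltr01.
  rewrite lt_min => /and3P[t0 td t1].
  have tz1 : unit_ball (t%:C *: z) by apply: unit_ball_shrink => //; rewrite t0.
  have nta1 : t * hnorm z <= t by rewrite ler_piMr ?ltW.
  have := Hd (t%:C *: z); rewrite hnormZ cabs_real gtr0_norm//.
  move=> /(_ (le_lt_trans nta1 td)).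
  rewrite add0r F0 subr0 -scalemxAl => K.
  have E := hdot_fixing_origin w FL tz1.
  rewrite mul0r add0r -{1}(gtr0_norm t0) -cabs_real -cabsM mulrC mulrBr -!hdotZl.
  rewrite -E -hdotBl -cabsN -hdotNl opprB.
  apply: le_trans (hdot_CauchySchwarz _ _) _.
  apply: (@le_trans _ _ (e / (hnorm (w *m L) + 1) * t * (hnorm (w *m L) + 1))).
    apply: ler_pM; rewrite ?hnorm_ge0// ?lerDl//.
    by apply: le_trans K _; rewrite ler_pM2l// divr_gt0.
  by rewrite le_eqVlt; apply/orP; left; apply/eqP; field; rewrite gt_eqF.
split=> // z z1.
have uL : L \in unitmx.
  rewrite -row_free_unit; apply: inj_row_free => v v0; apply/eqP.
  by rewrite -hnorm_eq0 -sqrf_eq0 -(inj_eq (@complexI R)) -hdotzz -U v0 hdot0l.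
apply/eqP; rewrite -subr_eq0 -hnorm_eq0 -sqrf_eq0 -(inj_eq (@complexI R)) -hdotzz.
rewrite -{2}(mulmxKV uL (F z - z *m L)) hdotBl (hdot_fixing_origin _ FL z1) U.
by rewrite subrr.
Qed.

End FixingOriginLinear.

Lemma automorphism_transport (p : V -> V) c : ball_automorphism p -> unit_ball c ->
  exists U : 'M[C]_m,
  (forall z, unit_ball z ->
     ball_involution (p c) (p z) = ball_involution c z *m U) /\
  (forall z w, hdot (z *m U) (w *m U) = hdot z w).
Proof.
move=> [dp [q [dq pB qB qK pK]]] c1; have pc1 := pB _ c1.
have hp : ball_map p by split=> // z /dp /differentiable_hdiff.
have hq : ball_map q by split=> // z /dq /differentiable_hdiff.
have i1 := ball_map_involution c1; have i2 := ball_map_involution pc1.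
have [] := @fixing_origin_unitary (ball_involution (p c) \o (p \o ball_involution c))
     (ball_involution c \o (q \o ball_involution (p c))).
- exact: ball_map_comp (ball_map_comp i1 hp) i2.
- exact: ball_map_comp (ball_map_comp i2 hq) i1.
- by rewrite /= ball_involution0// ball_involution_self.
- move=> y y1 /=; have py := ball_involution_ball c1 y1.
  by rewrite (ball_involutionK pc1 (pB _ py)) qK// ball_involutionK.
move=> U [UE Uu]; exists U; split => // z z1.
by rewrite -UE/= ?ball_involutionK//; exact: ball_involution_ball.
Qed.

End Automorphism.

(** * Lebesgue measure: dyadic cubes, regularity, linear images *)

Section LebesgueOuter.
Variables (R : realType) (m : nat).
Local Notation C := R[i].
Local Notation V := 'rV[C]_m.
Local Notation lam := (@lebesgue_outer R m).
Implicit Types (z w a b : V) (E X : set V).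

(** A cover of E by boxes is carried, box by box, to a cover of its image. *)
Lemma lebesgue_outer_image (T : V -> V) (k : R) E : 0 < k ->
  (forall a b, exists c d : V,
    (forall z, box (Some (a, b)) z -> box (Some (c, d)) (T z)) /\
    box_volume (Some (c, d)) <= k * box_volume (Some (a, b))) ->
  (lam (T @` E) <= k%:E * lam E)%E.
Proof.
move=> k0 H; rewrite -lee_pdivrMl//; apply: le_ereal_inf_tmp => _ [B EB <-].
rewrite lee_pdivrMl//.
have H' ab : exists cd, (forall z, box ab z -> box cd (T z)) /\
    box_volume cd <= k * box_volume ab.
  case: ab => [[a b]|]; last by exists None; split => //=; rewrite mulr0.
  by have [c [d ?]] := H a b; exists (Some (c, d)).
have [F HF] := choice H'.
rewrite -nneseriesZl//; last by move=> i _; rewrite lee_fin box_volume_ge0.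
apply: (@le_trans _ _ (\sum_(i <oo) (box_volume (F (B i)))%:E)%E).
  apply: ereal_inf_lbound; exists (F \o B) => //.
  by move=> _ [z /EB[i _ Bz] <-]; exists i => //; apply: (HF _).1.
apply: lee_nneseries => i _; first by rewrite lee_fin box_volume_ge0.
by rewrite -EFinM lee_fin; exact: (HF _).2.
Qed.

(** Positive diagonal maps send boxes to boxes. The factors are squared because each scales a real
    and an imaginary coordinate. *)
Lemma lebesgue_outer_diag (d : 'I_m -> R) b E : (forall k, 0 < d k) ->
  (lam ((fun z => \row_k ((d k)%:C * z 0 k + b 0 k)%R) @` E) <=
   (\prod_k d k ^+ 2)%:E * lam E)%E.
Proof.
move=> d0; apply: lebesgue_outer_image.
  by apply: prodr_gt0 => k _; rewrite exprn_gt0.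
have ReE k (z : C) : complex.Re ((d k)%:C * z) = d k * complex.Re z.
  by case: z => x y /=; rewrite mul0r subr0.
have ImE k (z : C) : complex.Im ((d k)%:C * z) = d k * complex.Im z.
  by case: z => x y /=; rewrite mul0r addr0.
have ReD (z w : C) : complex.Re (z + w) = complex.Re z + complex.Re w by case: z; case: w.
have ImD (z w : C) : complex.Im (z + w) = complex.Im z + complex.Im w by case: z; case: w.
move=> x y; pose T z : V := \row_k ((d k)%:C * z 0 k + b 0 k).
exists (T x), (T y); split => [z zxy k|].
  rewrite !mxE !ReD !ImD !ReE !ImE !ltrD2r !lerD2r !ltr_pM2l// !ler_pM2l//.
rewrite /= -big_split /=; apply: ler_prod => k _; apply/andP; split.
  by apply: mulr_ge0; rewrite le_max lexx.
have E1 (u v c : R) : Num.max 0 (d k * u + c - (d k * v + c)) = d k * Num.max 0 (u - v).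
  rewrite maxr_pMr ?ltW// mulr0; congr Num.max; ring.
rewrite !mxE !ReD !ImD !ReE !ImE !E1.
by rewrite le_eqVlt; apply/orP; left; apply/eqP; ring.
Qed.

Lemma lebesgue_outer_affine_le (s : R) b E : 0 < s ->
  (lam ((fun z => (s%:C *: z + b)%R) @` E) <= (s ^+ (2 * m))%:E * lam E)%E.
Proof.
move=> s0; have := @lebesgue_outer_diag (fun=> s) b E (fun=> s0).
rewrite prodr_const card_ord -exprM; congr (lam _ <= _)%E.
by apply: eq_imagel => z _; apply/rowP => k; rewrite !mxE.
Qed.

(** The missing inequality is the one-sided bound for the inverse affine map. *)
Lemma lebesgue_outer_affine (s : R) b E : 0 < s ->
  lam ((fun z => s%:C *: z + b) @` E) = ((s ^+ (2 * m))%:E * lam E)%E.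
Proof.
move=> s0; apply/eqP; rewrite eq_le lebesgue_outer_affine_le//=.
have s1 : 0 < s^-1 by rewrite invr_gt0.
have := @lebesgue_outer_affine_le s^-1 (- (s^-1%:C *: b)) ((fun z => s%:C *: z + b) @` E) s1.
have E1 : (fun z => s^-1%:C *: z - s^-1%:C *: b) @` ((fun z => s%:C *: z + b) @` E) = E.
  rewrite image_comp -[RHS]image_id; apply: eq_imagel => z _ /=.
  by rewrite scalerDr scalerA addrK -rmorphM /= mulVf ?gt_eqF// scale1r.
by rewrite E1 exprVn -lee_pdivlMl ?exprn_gt0// ?invr_gt0 ?exprn_gt0// invrK.
Qed.

Lemma lebesgue_outer_translate b E : lam ((fun z => z + b) @` E) = lam E.
Proof.
have := @lebesgue_outer_affine 1 b E ltr01; rewrite expr1n mul1e => <-.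
by congr lam; apply: eq_imagel => z _; rewrite scale1r.
Qed.

End LebesgueOuter.

(** * Half-spaces, dyadic cubes and open sets *)

Section LebesgueMeasurable.
Variables (R : realType) (m : nat).
Local Notation C := R[i].
Local Notation V := 'rV[C]_m.
Implicit Types (z w a b : V) (E X : set V).

(** The 2m real coordinates are indexed by ['I_m * bool], so that real and imaginary parts share
    their proofs. *)
Definition rcoord (t : bool) (x : C) : R := if t then complex.Re x else complex.Im x.

Definition set_rcoord (t : bool) (x : C) (r : R) : C :=
  if t then r +i* complex.Im x else complex.Re x +i* r.

(** The outer measure is an infimum over covers by boxes, so the Caratheodory criterion can be
    tested on boxes alone. *)
Lemma lebesgue_measurable_split (A : set V) :
  (forall a b, exists p q, [/\ box (Some (a, b)) `&` A `<=` box p,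
     box (Some (a, b)) `&` ~` A `<=` box q &
     box_volume p + box_volume q <= box_volume (Some (a, b))]) ->
  lebesgue_measurable A.
Proof.
move=> H; apply: (@le_caratheodory_measurable _ _ (lebesgue_outer_measure R m)) => X.
have H' ab : exists pq : option (V * V) * option (V * V),
   [/\ box ab `&` A `<=` box pq.1, box ab `&` ~` A `<=` box pq.2 &
     box_volume pq.1 + box_volume pq.2 <= box_volume ab].
  case: ab => [[a b]|]; last first.
    by exists (None, None); split => [z []|z []|] //=; rewrite addr0.
  by have [p [q ?]] := H a b; exists (p, q).
have [F HF] := choice H'.
apply: le_ereal_inf_tmp => _ [B XB <-].
apply: (@le_trans _ _ (\sum_(k <oo) (box_volume (F (B k)).1)%:E +
    \sum_(k <oo) (box_volume (F (B k)).2)%:E)%E); last first.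
  rewrite -nneseriesD; [|by move=> i _ _; rewrite lee_fin box_volume_ge0..].
  apply: lee_nneseries => i _.
    by rewrite -EFinD lee_fin addr_ge0// box_volume_ge0.
  by rewrite -EFinD lee_fin; have [] := HF (B i).
apply: leeD; apply: ereal_inf_lbound.
  exists (fun k => (F (B k)).1) => // z [/XB[k _ Bz] Az]; exists k => //.
  by have [+ _ _] := HF (B k); apply.
exists (fun k => (F (B k)).2) => // z [/XB[k _ Bz] Az]; exists k => //.
by have [_ + _] := HF (B k); apply.
Qed.

(** Cutting the interval ]a, b] at r, including the cases where it is empty or r lies outside it. *)
Lemma max_split (a b r : R) : Num.max 0 (Num.min b r - a) +
  Num.max 0 (b - Num.max a r) = Num.max 0 (b - a).
Proof.
rewrite !maxEle minEle; case: (leP b r) => br; case: (leP a r) => ar;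
  repeat case: ifPn => //; rewrite -?ltNge; lra.
Qed.

Lemma halfspace_measurable t (i : 'I_m) (r : R) :
  lebesgue_measurable [set z : V | rcoord t (z 0 i) <= r].
Proof.
apply: lebesgue_measurable_split => a b.
pose b' : V := \row_k if k == i then
  set_rcoord t (b 0 k) (Num.min (rcoord t (b 0 k)) r) else b 0 k.
pose a' : V := \row_k if k == i then
  set_rcoord t (a 0 k) (Num.max (rcoord t (a 0 k)) r) else a 0 k.
exists (Some (a, b')), (Some (a', b)); split.
- move=> z [/= zab zr] k; rewrite mxE; case: eqP => [->|_]; last exact: zab.
  have /andP[/andP[h1 h2] /andP[h3 h4]] := zab i.
  case: (t) zr => /= zr; apply/andP; split; apply/andP; split=> //.
    by rewrite le_min; apply/andP.
  by rewrite le_min; apply/andP.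
- move=> z [/= zab /negP zr] k; rewrite mxE; case: eqP => [->|_]; last exact: zab.
  rewrite -ltNge in zr.
  have /andP[/andP[h1 h2] /andP[h3 h4]] := zab i.
  case: (t) zr => /= zr; apply/andP; split; apply/andP; split=> //.
    by rewrite gt_max; apply/andP.
  by rewrite gt_max; apply/andP.
pose vol (x y : V) (k : 'I_m) : R := Num.max 0 (complex.Re (y 0 k : C) - complex.Re (x 0 k : C)) *
  Num.max 0 (complex.Im (y 0 k : C) - complex.Im (x 0 k : C)).
have volE (x y : V) : box_volume (Some (x, y)) =
  vol x y i * \prod_(k < m | k != i) vol x y k by exact: bigD1.
rewrite !volE.
have -> : \prod_(k < m | k != i) vol a b' k = \prod_(k < m | k != i) vol a b k.
  by apply: eq_bigr => k /negbTE ki; rewrite /vol mxE ki.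
have -> : \prod_(k < m | k != i) vol a' b k = \prod_(k < m | k != i) vol a b k.
  by apply: eq_bigr => k /negbTE ki; rewrite /vol mxE ki.
rewrite -mulrDl le_eqVlt; apply/orP; left; apply/eqP; congr (_ * _).
rewrite /vol !mxE eqxx; clear; case: t => /=.
  by rewrite -mulrDl max_split.
by rewrite -mulrDr max_split.
Qed.

Lemma measurable_rcoord_gt t (i : 'I_m) (r : R) :
  lebesgue_measurable [set z : V | r < rcoord t (z 0 i)].
Proof.
have := measurableC (halfspace_measurable t i r).
congr measurable; apply/seteqP; split => z /=; rewrite ltNge.
  by move/negP.
by move/negP.
Qed.

(** Ceilings give cubes that are open below and closed above, like [box]; integer codes form a
    countable type, which allows enumerating the cubes. *)
Definition dyadic_code (n : nat) z : 'rV[int * int]_m :=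
  \row_k (Num.ceil (2 ^+ n * complex.Re (z 0 k)), Num.ceil (2 ^+ n * complex.Im (z 0 k))).

Definition dyadic_cube (n : nat) (c : 'rV[int * int]_m) : set V :=
  [set z | dyadic_code n z = c].

Lemma dyadic_cube_itv n c z : dyadic_cube n c z <-> forall k t,
  ((if t then (c 0 k).1 else (c 0 k).2) - 1)%:~R < 2 ^+ n * rcoord t (z 0 k) <=
  (if t then (c 0 k).1 else (c 0 k).2)%:~R.
Proof.
split=> [<- k [] /=|H]; rewrite ?mxE /= ?ceil_itv//.
apply/rowP => k; rewrite mxE [RHS]surjective_pairing.
by congr pair; apply/ceil_def; [exact: H k true|exact: H k false].
Qed.

Lemma dyadic_cube_measurable n c : lebesgue_measurable (dyadic_cube n c).
Proof.
have p0 : 0 < 2 ^+ n :> R by rewrite exprn_gt0.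
pose f (kt : 'I_m * bool) : set V :=
  [set z | ((if kt.2 then (c 0 kt.1).1 else (c 0 kt.1).2) - 1)%:~R / 2 ^+ n
     < rcoord kt.2 (z 0 kt.1)] `&`
  [set z | rcoord kt.2 (z 0 kt.1) <=
     (if kt.2 then (c 0 kt.1).1 else (c 0 kt.1).2)%:~R / 2 ^+ n].
have -> : dyadic_cube n c = \bigcap_(kt in [set: 'I_m * bool]) f kt.
  apply/seteqP; split => z.
    move=> /dyadic_cube_itv H [k t] _; have /andP[h1 h2] := H k t.
    by split; rewrite /= ?ltr_pdivrMr ?ler_pdivlMr// mulrC.
  move=> H; apply/dyadic_cube_itv => k t; have [] := H (k, t) I.
  by rewrite /= ltr_pdivrMr// ler_pdivlMr// mulrC => -> ->.
apply: (@fin_bigcap_measurable _ (lebesgue_type R m)); first exact: finite_finset.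
move=> [k t] _; apply: measurableI.
  exact: measurable_rcoord_gt.
exact: halfspace_measurable.
Qed.

(** The ceiling of 2y determines the ceiling of y, so consecutive generations of cubes are
    nested. *)
Lemma dyadic_codeS n z w :
  dyadic_code n.+1 z = dyadic_code n.+1 w -> dyadic_code n z = dyadic_code n w.
Proof.
have half (x y : R) : Num.ceil (2 ^+ n.+1 * x) = Num.ceil (2 ^+ n.+1 * y) ->
    Num.ceil (2 ^+ n * x) = Num.ceil (2 ^+ n * y).
  rewrite exprS -!mulrA => xy; apply/esym/ceil_def.
  have e (c : int) : (2 * c)%:~R = 2 * c%:~R :> R by rewrite intrM.
  rewrite -(ltr_pM2l (_ : 0 < 2 :> R))// -[X in _ && X](ler_pM2l (_ : 0 < 2 :> R))//.
  rewrite -!e -ceil_gt_int -ceil_le_int -xy ceil_gt_int ceil_le_int !e.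
  by rewrite ltr_pM2l// ler_pM2l// ceil_itv.
move=> /rowP zw; apply/rowP => k; have := zw k; rewrite !mxE => -[h1 h2].
by rewrite (half _ _ h1) (half _ _ h2).
Qed.

Lemma dyadic_code_le n n' z w : (n <= n')%N ->
  dyadic_code n' z = dyadic_code n' w -> dyadic_code n z = dyadic_code n w.
Proof.
move=> /subnK <-; elim: (n' - n)%N => [//|k IH]; rewrite addSn => /dyadic_codeS.
exact: IH.
Qed.

Lemma dyadic_cube_diam n c z w : dyadic_cube n c z -> dyadic_cube n c w ->
  hnorm (z - w) <= 2 * m%:R / 2 ^+ n.
Proof.
have p0 : 0 < 2 ^+ n :> R by rewrite exprn_gt0.
move=> /dyadic_cube_itv H /dyadic_cube_itv K.
have d k t : `|rcoord t (z 0 k) - rcoord t (w 0 k)| <= 1 / 2 ^+ n.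
  rewrite ler_pdivlMr// -{1}(gtr0_norm p0) -normrM mulrBl.
  have := H k t; have := K k t; rewrite intrB !(mulrC (2 ^+ n)).
  by rewrite ler_norml => /andP[h1 h2] /andP[h3 h4]; apply/andP; split; lra.
apply: le_trans (hnorm_le_sum _) _.
have -> : 2 * m%:R / 2 ^+ n = \sum_(k < m) (2 / 2 ^+ n) :> R.
  by rewrite sumr_const card_ord -[RHS]mulr_natr mulrAC.
apply: ler_sum => k _; apply: le_trans (cabs_le_ReIm _) _.
have := d k true; have := d k false; rewrite /= !mxE.
by case: (z 0 k) (w 0 k) => x y [x' y'] /=; lra.
Qed.

(* Each point is attributed to the first of its dyadic cubes satisfying [P]. *)
Lemma dyadic_partition (P : nat -> 'rV[int * int]_m -> Prop) (G : set V) :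
  (forall z, G z -> exists n, P n (dyadic_code n z)) ->
  (forall n c, P n c -> dyadic_cube n c `<=` G) ->
  exists E : nat -> set V, [/\ trivIset setT E, G = \bigcup_k E k &
    forall k, E k = set0 \/ exists n c, P n c /\ E k = dyadic_cube n c].
Proof.
move=> PG GP.
pose first n z := P n (dyadic_code n z) /\
  forall n', (n' < n)%N -> ~ P n' (dyadic_code n' z).
have first_exists z : G z -> exists n, first n z.
  move=> /PG[n]; elim/ltn_ind: n => n IH Pn.
  have [[n' [n'n Pn']]|N] := pselect (exists n', (n' < n)%N /\ P n' (dyadic_code n' z)).
    exact: IH Pn'.
  by exists n; split => // n' n'n Pn'; apply: N; exists n'.
have first_code n z w : dyadic_code n z = dyadic_code n w -> first n z -> first n w.
  move=> zw [Pn N]; split; first by rewrite -zw.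
  by move=> n' n'n; rewrite -(dyadic_code_le (ltnW n'n) zw); exact: N.
(* Cubes are enumerated by [pickle]; integers that code no cube, or code one not selected,
   contribute the empty set. *)
pose E k : set V := if pickle_inv k is Some (n, c) then
  [set z | dyadic_cube n c z /\ first n z] else set0.
exists E; split.
- move=> k1 k2 _ _ [z []]; rewrite /E.
  have := @pickle_invK (nat * 'rV[int * int]_m)%type k1.
  have := @pickle_invK (nat * 'rV[int * int]_m)%type k2.
  case: (pickle_inv k1) => [[n1 c1]|]//; case: (pickle_inv k2) => [[n2 c2]|]//=.
  move=> <- <- [zc1 [P1 N1]] [zc2 [P2 N2]].
  have n12 : n1 = n2.
    by case: (ltngtP n1 n2) => // h; [have := N2 _ h P1|have := N1 _ h P2].
  by congr pickle; congr pair => //; rewrite -zc1 -zc2 n12.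
- apply/seteqP; split => z.
    move=> /first_exists[n fn]; exists (pickle (n, dyadic_code n z)) => //.
    by rewrite /E pickleK_inv.
  move=> [k _]; rewrite /E; case: pickle_inv => // -[n c] [zc [Pn _]].
  by apply: (GP n c) => //; rewrite -zc.
- move=> k; rewrite /E; case: pickle_inv => [[n c]|]; last by left.
  have [[z [zc fz]]|N] := pselect (exists z, dyadic_cube n c z /\ first n z).
    right; exists n, c; split; first by rewrite -zc; exact: fz.1.
    apply/seteqP; split => [w []//|w wc]; split => //.
    by apply: first_code fz; rewrite zc.
  left; apply/seteqP; split => // w [wc fw]; apply: N; by exists w.
Qed.

(** Openness in the Hermitian norm, in the same explicit style as [hdiff]. *)
Definition hopen (G : set V) := forall z, G z -> exists2 d : R, 0 < d &
  forall w, hnorm (w - z) < d -> G w.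

Lemma dyadic_small (d : R) : 0 < d -> exists n0, forall n, (n0 <= n)%N ->
  2 * m%:R / 2 ^+ n < d.
Proof.
move=> d0; exists (Num.bound (2 * m%:R / d)) => n n0.
have p0 : 0 < 2 ^+ n :> R by rewrite exprn_gt0.
rewrite ltr_pdivrMr// -ltr_pdivrMl// mulrC.
apply: lt_le_trans (archi_boundP _) _; first by rewrite divr_ge0// ?ltW// mulr_ge0.
by rewrite -natrX ler_nat (leq_trans n0)// ltnW// ltn_expl.
Qed.

Lemma hopen_dyadic (G : set V) z : hopen G -> G z ->
  exists n0, forall n, (n0 <= n)%N -> dyadic_cube n (dyadic_code n z) `<=` G.
Proof.
move=> oG /oG[d d0 Hd]; have [n0 Hn] := dyadic_small d0; exists n0 => n n0n w wz.
by apply: Hd; apply: le_lt_trans (Hn n n0n); exact: dyadic_cube_diam wz _.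
Qed.

(** Here P is a property of all sufficiently small cubes around each point: trivial when only a
    partition is wanted, a measure inequality when local bounds are to be summed. *)
Lemma hopen_partition (P : nat -> 'rV[int * int]_m -> Prop) (G : set V) :
  hopen G -> (forall z, G z -> exists n0, forall n, (n0 <= n)%N -> P n (dyadic_code n z)) ->
  exists E : nat -> set V, [/\ trivIset setT E, G = \bigcup_k E k &
    forall k, E k = set0 \/
      exists n c, [/\ P n c, dyadic_cube n c `<=` G & E k = dyadic_cube n c]].
Proof.
move=> oG GP.
have [z Gz|n c []//|E [tE GE EP]] :=
    @dyadic_partition (fun n c => P n c /\ dyadic_cube n c `<=` G) G.
  have [n1 H1] := GP z Gz; have [n2 H2] := hopen_dyadic oG Gz.
  exists (maxn n1 n2); split; first by apply: H1; exact: leq_maxl.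
  by apply: H2; exact: leq_maxr.
exists E; split => // k; have [->|[n [c [[Pn sub] Ek]]]] := EP k; first by left.
by right; exists n, c.
Qed.

Lemma hopen_measurable (G : set V) : hopen G -> lebesgue_measurable G.
Proof.
move=> oG; have [|E [_ -> EP]] := @hopen_partition (fun _ _ => True) G oG.
  by move=> z _; exists 0%N.
apply: (@bigcup_measurable _ (lebesgue_type R m)) => k _.
have [->|[n [c [_ _ ->]]]] := EP k; last exact: dyadic_cube_measurable.
exact: measurable0.
Qed.

End LebesgueMeasurable.

Section OpenSets.
Variables (R : realType) (m : nat).
Local Notation C := R[i].
Local Notation V := 'rV[C]_m.
Implicit Types (z w a b : V) (D E X G : set V).

Definition hcont_on D (f : V -> R) := forall z, D z -> forall e, 0 < e ->
  exists2 d : R, 0 < d & forall w, hnorm (w - z) < d -> `|f w - f z| < e.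

Definition hcontV_on D (f : V -> V) := forall z, D z -> forall e, 0 < e ->
  exists2 d : R, 0 < d & forall w, hnorm (w - z) < d -> hnorm (f w - f z) < e.

Lemma hopenT : hopen [set: V].
Proof. by move=> z _; exists 1. Qed.

Lemma hopen_unit_ball : hopen (@unit_ball R m).
Proof.
move=> z /unit_ball_open[d d0 H]; exists d => // w /H.
by rewrite subrKC.
Qed.

Lemma hopenI D E : hopen D -> hopen E -> hopen (D `&` E).
Proof.
move=> oD oE z [/oD[d1 d10 H1] /oE[d2 d20 H2]].
exists (Num.min d1 d2) => [|w]; first by rewrite lt_min d10.
by rewrite lt_min => /andP[/H1 ? /H2].
Qed.

Lemma hopen_bigcup (I : Type) (D : I -> set V) :
  (forall i, hopen (D i)) -> hopen (\bigcup_i D i).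
Proof.
by move=> oD z [i _ /oD[d d0 H]]; exists d => // w /H ?; exists i.
Qed.

Lemma hopen_bigcap_fin (J : finType) (D : J -> set V) :
  (forall i, hopen (D i)) -> hopen (\bigcap_i D i).
Proof.
move=> oD z zD; have H i : exists d : R, 0 < d /\ forall w, hnorm (w - z) < d -> D i w.
  by have [d d0 Hd] := oD i z (zD i I); exists d.
have [d Hd] := choice H.
exists (\big[Num.min/1]_(i : J) d i) => [|w wd i _].
  by apply/bigmin_gtP; split => // i _; exact: (Hd i).1.
apply: (Hd i).2; apply: lt_le_trans wd _; exact: bigmin_le.
Qed.

Lemma hopen_gt D (f : V -> R) (r : R) : hopen D -> hcont_on D f ->
  hopen (D `&` [set z | r < f z]).
Proof.
move=> oD cf z [Dz /= rz]; have [d1 d10 H1] := oD z Dz.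
have rz0 : 0 < f z - r by rewrite subr_gt0.
have [d2 d20 H2] := cf z Dz (f z - r) rz0.
exists (Num.min d1 d2) => [|w]; first by rewrite lt_min d10.
rewrite lt_min => /andP[/H1 Dw /H2]; rewrite ltr_norml => /andP[K _].
by split => //=; lra.
Qed.

Lemma hopen_lt D (f : V -> R) (r : R) : hopen D -> hcont_on D f ->
  hopen (D `&` [set z | f z < r]).
Proof.
move=> oD cf; have cNf : hcont_on D (fun z => - f z).
  move=> z Dz e e0; have [d d0 H] := cf z Dz e e0.
  by exists d => // w /H; rewrite -opprD normrN.
have := @hopen_gt D _ (- r) oD cNf; congr hopen.
by apply/seteqP; split => z [Dz] /=; rewrite ltrN2.
Qed.

Lemma measurable_le D (f : V -> R) (r : R) : hopen D -> hcont_on D f ->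
  lebesgue_measurable (D `&` [set z | f z <= r]).
Proof.
move=> oD cf; have -> : D `&` [set z | f z <= r] = D `\` (D `&` [set z | r < f z]).
  apply/seteqP; split => z /=; rewrite leNgt.
    by move=> [Dz /negP fz]; split => // -[].
  by move=> [Dz N]; split => //; apply/negP => rz; exact: N.
apply: (@measurableD _ (lebesgue_type R m)); first exact: hopen_measurable.
exact/hopen_measurable/hopen_gt.
Qed.

Lemma hcontV_rcoord D (f : V -> V) t (i : 'I_m) : hcontV_on D f ->
  hcont_on D (fun z => rcoord t (f z 0 i)).
Proof.
move=> cf z Dz e e0; have [d d0 H] := cf z Dz e e0; exists d => // w /H.
apply: le_lt_trans; apply: le_trans (cabs_le_hnorm _ i); rewrite !mxE.
case: t; [apply: le_trans (normRe_le_cabs _)|apply: le_trans (normIm_le_cabs _)];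
  by rewrite /=; case: (f w 0 i) (f z 0 i) => x y [].
Qed.

Lemma measurable_preimage_cube D (f : V -> V) n c : hopen D -> hcontV_on D f ->
  lebesgue_measurable (D `&` f @^-1` dyadic_cube n c).
Proof.
move=> oD cf; have p0 : 0 < 2 ^+ n :> R by rewrite exprn_gt0.
pose hi (kt : 'I_m * bool) : R :=
  (if kt.2 then (c 0 kt.1).1 else (c 0 kt.1).2)%:~R / 2 ^+ n.
pose lo (kt : 'I_m * bool) : R :=
  ((if kt.2 then (c 0 kt.1).1 else (c 0 kt.1).2) - 1)%:~R / 2 ^+ n.
pose F (kt : 'I_m * bool) : set V :=
  (D `&` [set z | lo kt < rcoord kt.2 (f z 0 kt.1)]) `&`
  (D `&` [set z | rcoord kt.2 (f z 0 kt.1) <= hi kt]).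
have -> : D `&` f @^-1` dyadic_cube n c = D `&` \bigcap_(kt in [set: 'I_m * bool]) F kt.
  apply/seteqP; split => z [Dz].
    move=> /dyadic_cube_itv H; split => // -[k t] _; have /andP[h1 h2] := H k t.
    by split; split; rewrite /= ?/lo ?/hi ?ltr_pdivrMr ?ler_pdivlMr// mulrC.
  move=> H; split => //; apply/dyadic_cube_itv => k t; have [[_ + [_]]] := H (k, t) I.
  by rewrite /= /lo /hi ltr_pdivrMr// ler_pdivlMr// mulrC => -> ->.
apply: (@measurableI _ (lebesgue_type R m)); first exact: hopen_measurable.
apply: (@fin_bigcap_measurable _ (lebesgue_type R m)); first exact: finite_finset.
move=> [k t] _; apply: measurableI.
  by apply/hopen_measurable/hopen_gt => //; exact: hcontV_rcoord.
by apply: measurable_le => //; exact: hcontV_rcoord.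
Qed.

End OpenSets.

(** * Outer regularity *)

Section Regularity.
Variables (R : realType) (m : nat).
Local Notation C := R[i].
Local Notation V := 'rV[C]_m.
Local Notation lam := (@lebesgue_outer R m).
Implicit Types (z w a b : V) (D E X G : set V).

(** The half-open box is already open below, so only its upper faces move. Sides are enlarged by a
    ratio and not by an amount, so that one d serves for all boxes of a cover. *)
Definition fat_box (d : R) a b : set V := \bigcap_(kt in [set: 'I_m * bool])
  [set z | rcoord kt.2 (a 0 kt.1) < rcoord kt.2 (z 0 kt.1) <
     rcoord kt.2 (a 0 kt.1) + (1 + d) * (rcoord kt.2 (b 0 kt.1) - rcoord kt.2 (a 0 kt.1))].

Lemma hcontV_id D : hcontV_on D id.
Proof. by move=> z _ e e0; exists e. Qed.

Lemma hopen_fat_box d a b : hopen (fat_box d a b).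
Proof.
apply: hopen_bigcap_fin => -[k t] /=.
have cr : hcont_on setT (fun z : V => rcoord t (z 0 k)).
  exact: (@hcontV_rcoord _ _ setT id t k (@hcontV_id setT)).
have := hopenI (hopen_gt (r := rcoord t (a 0 k)) (@hopenT R m) cr)
  (hopen_lt (r := rcoord t (a 0 k) + (1 + d) * (rcoord t (b 0 k) - rcoord t (a 0 k)))
     (@hopenT R m) cr).
congr hopen; apply/seteqP; split => z /=; first by move=> [[_ ->] [_ ->]].
by move=> /andP[].
Qed.

Lemma box_fat_box d a b : 0 < d -> box (Some (a, b)) `<=` fat_box d a b.
Proof.
move=> d0 z zab [k t] _ /=; have /andP[/andP[h1 h2] /andP[h3 h4]] := zab k.
have aux (x y w : R) : x < w -> w <= y -> x < w < x + (1 + d) * (y - x).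
  move=> xw wy; rewrite xw/=; have : 0 < d * (y - x) by rewrite mulr_gt0// subr_gt0 (lt_le_trans xw).
  by lra.
by case: t; exact: aux.
Qed.

Lemma lam_fat_box d a b : 0 < d ->
  (lam (fat_box d a b) <= ((1 + d) ^+ (2 * m) * box_volume (Some (a, b)))%:E)%E.
Proof.
move=> d0; pose c : V := \row_k (a 0 k + (1 + d)%:C * (b 0 k - a 0 k)).
have cE t k : rcoord t (c 0 k) =
    rcoord t (a 0 k) + (1 + d) * (rcoord t (b 0 k) - rcoord t (a 0 k)).
  rewrite mxE; case: (a 0 k) => x y; case: (b 0 k) => x' y'.
  by case: t => /=; ring.
pose F (i : nat) : option (V * V) := if i == 0%N then Some (a, c) else None.
apply: ereal_inf_lbound => /=; exists F.
  move=> z zab; exists 0%N => // k; have /andP[h1 h2] := zab (k, true) I.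
  have /andP[h3 h4] := zab (k, false) I.
  have := cE true k; have := cE false k; rewrite /= in h1 h2 h3 h4 * => -> ->.
  by apply/andP; split; apply/andP; split => //; exact: ltW.
rewrite (nneseries_split _ 1)// => [|k _]; last by rewrite lee_fin box_volume_ge0.
rewrite big_nat1 add0n eseries0 ?adde0; last by case.
congr EFin; rewrite /= exprM -[X in _ ^+ X](card_ord m) -prodr_const -big_split /=.
apply: eq_bigr => k _; have := cE true k; have := cE false k; rewrite /= => -> ->.
have aux (x y : R) : Num.max 0 (x + (1 + d) * (y - x) - x) = (1 + d) * Num.max 0 (y - x).
  by rewrite addrAC subrr add0r maxr_pMr ?mulr0// addr_ge0// ltW.
by rewrite !aux; ring.
Qed.

Lemma expr_1D_le n (r : R) : 1 < r -> exists2 d : R, 0 < d & (1 + d) ^+ n <= r.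
Proof.
move=> r1; have : (1 + x) ^+ n @[x --> (0 : R)] --> (1 + 0 : R) ^+ n.
  apply: (@cvg_comp _ _ _ (fun x : R => 1 + x) (fun x => x ^+ n)).
    by apply: cvgD; [exact: cvg_cst|exact: cvg_id].
  exact: exprn_continuous.
move=> /cvgrPdist_lt /(_ (r - 1)); rewrite subr_gt0 r1 addr0 expr1n => /(_ isT).
move=> /nbhs_ballP[d /= d0 H]; exists (d / 2); first by rewrite divr_gt0.
have /H : ball (0 : R) d (d / 2).
  by rewrite -ball_normE /= sub0r normrN gtr0_norm ?divr_gt0// ltr_pdivrMr// ltr_pMr// ltr1n.
by rewrite ltr_norml => /andP[+ _]; lra.
Qed.

(** Fattening every box of a near-optimal cover by the same ratio multiplies the total volume by (1
    + d)^(2m), with d small enough to stay below r. *)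
Lemma lebesgue_outer_regular E (r : R) : (lam E < r%:E)%E ->
  exists G, [/\ hopen G, E `<=` G & (lam G < r%:E)%E].
Proof.
move=> /ereal_inf_lt[_ [B EB <-]].
set v := (\sum_(k <oo) _)%E => vr.
have v0 : (0 <= v)%E by apply: nneseries_ge0 => k _ _; rewrite lee_fin box_volume_ge0.
have vf : v \is a fin_num by rewrite ge0_fin_numE// (lt_trans vr) ?ltry.
have [d d0 dr] : exists2 d : R, 0 < d & (1 + d) ^+ (2 * m) * fine v < r.
  have vr' : fine v < r by rewrite -lte_fin fineK.
  have v0' : 0 <= fine v by exact: fine_ge0.
  have [v00|vn0] := eqVneq (fine v) 0; first by exists 1 => //; rewrite v00 mulr0 -v00.
  have vp : 0 < fine v by rewrite lt_neqAle eq_sym vn0.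
  (* The midpoint of 1 and r / v leaves room for a strict inequality. *)
  have q1 : 1 < (1 + r / fine v) / 2.
    by rewrite ltr_pdivlMr// mul1r ltrD2l ltr_pdivlMr// mul1r.
  have [d d0 dq] := expr_1D_le (2 * m) q1; exists d => //.
  rewrite -ltr_pdivlMr//; apply: le_lt_trans dq _.
  rewrite ltr_pdivrMr// mulr_natr mulr2n ltrD2r.
  by rewrite ltr_pdivlMr// mul1r.
exists (\bigcup_i (if B i is Some (a, b) then fat_box d a b else set0)); split.
- apply: hopen_bigcup => i; case: (B i) => [[a b]|]; first exact: hopen_fat_box.
  by move=> z.
- move=> z /EB[i _]; case Bi: (B i) => [[a b]|] // zB.
  by exists i => //; rewrite Bi; exact: box_fat_box.
apply: (@le_lt_trans _ _ ((1 + d) ^+ (2 * m) * fine v)%:E); last by rewrite lte_fin.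
apply: le_trans (@lebesgue_outer_sigma_subadditive R m _) _.
rewrite EFinM fineK// /v -nneseriesZl; last by move=> i _; rewrite lee_fin box_volume_ge0.
apply: lee_nneseries => [i _ _|i _]; first exact: lebesgue_outer_ge0.
case: (B i) => [[a b]|]; first by rewrite -EFinM; exact: lam_fat_box.
by rewrite lebesgue_outer0 /= mule0.
Qed.

(** The intended f is the outer measure of the image under a map: a volume bound on open sets then
    extends to arbitrary sets. *)
Lemma lebesgue_outer_le_open (f : set V -> \bar R) (k : R) E : 0 < k ->
  (forall X Y, X `<=` Y -> (f X <= f Y)%E) ->
  (forall G, hopen G -> E `<=` G -> (f G <= k%:E * lam G)%E) ->
  (f E <= k%:E * lam E)%E.
Proof.
move=> k0 fS H; rewrite -lee_pdivrMl//; apply/lee_addgt0Pr => e e0.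
have [lE|] := ltP (lam E) +oo%E; last by rewrite leye_eq => /eqP ->; rewrite leey.
have lf : lam E \is a fin_num by rewrite ge0_fin_numE ?lebesgue_outer_ge0.
have lt : (lam E < (fine (lam E) + e)%:E)%E by rewrite EFinD fineK// lteDl// lte_fin.
have [G [oG EG Gr]] := lebesgue_outer_regular lt.
rewrite lee_pdivrMl//; apply: le_trans (fS _ _ EG) _.
apply: le_trans (H G oG EG) _.
have -> : (lam E + e%:E)%E = (fine (lam E) + e)%:E by rewrite EFinD fineK.
by apply: lee_wpmul2l; [rewrite lee_fin ltW|exact: ltW].
Qed.

End Regularity.

(** * Volumes of images under linear maps *)

Section LinearImages.
Variables (R : realType) (m : nat).
Local Notation C := R[i].
Local Notation V := 'rV[C]_m.
Local Notation lam := (@lebesgue_outer R m).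
Implicit Types (z w a b x : V) (D E X G : set V) (L U : 'M[C]_m).

Lemma lam_bigcup (E : nat -> set V) : (forall k, lebesgue_measurable (E k)) ->
  trivIset setT E -> lam (\bigcup_k E k) = (\sum_(k <oo) lam (E k))%E.
Proof.
move=> mE tE; have mU := @bigcupT_measurable _ (lebesgue_type R m) E mE.
exact: (measure_semi_bigcup (lebesgue_Cm R m) mE tE mU).
Qed.

(** The point b is the upper corner, which matches the orientation of the dyadic cubes. *)
Definition hcube (s : R) b : set V := [set z | forall k t,
  rcoord t (b 0 k) - s < rcoord t (z 0 k) <= rcoord t (b 0 k)].

Lemma hcube_image (s : R) b : 0 < s ->
  hcube s b = (fun z => s%:C *: z + b) @` hcube 1 0.
Proof.
move=> s0; have E (z w : V) k t : rcoord t ((s%:C *: z + w) 0 k) =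
    s * rcoord t (z 0 k) + rcoord t (w 0 k).
  by rewrite !mxE; case: (z 0 k) => x y; case: (w 0 k) => x' y'; case: t => /=; ring.
have r0 k t : rcoord t ((0 : V) 0 k) = 0 by rewrite mxE; case: t.
apply/seteqP; split => z.
  move=> zb; exists (s^-1%:C *: (z - b)) => [k t|]; last first.
    by rewrite scalerA -rmorphM /= mulfV ?gt_eqF// scale1r subrK.
  have -> : rcoord t ((s^-1%:C *: (z - b)) 0 k) = (rcoord t (z 0 k) - rcoord t (b 0 k)) / s.
    by rewrite !mxE; case: (z 0 k) => x y; case: (b 0 k) => x' y'; case: t => /=; ring.
  have /andP[h1 h2] := zb k t; rewrite r0 sub0r.
  by rewrite ltr_pdivlMr// ler_pdivrMr// mulN1r mul0r ltrBrDl subr_le0 h1.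
move=> [w wb <-] k t; rewrite E.
have := wb k t; rewrite r0 sub0r => /andP[h1 h2].
rewrite addrC ltrD2r gerDr pmulr_rle0// h2 andbT.
by rewrite -mulrN1 ltr_pM2l.
Qed.

Lemma lam_hcube (s : R) b : 0 < s -> lam (hcube s b) = ((s ^+ (2 * m))%:E * lam (hcube 1 0))%E.
Proof. by move=> s0; rewrite hcube_image// lebesgue_outer_affine. Qed.

Lemma lam_hcube_mulmx (s : R) b L : 0 < s -> lam ((fun z => z *m L) @` hcube s b) =
  ((s ^+ (2 * m))%:E * lam ((fun z => z *m L) @` hcube 1 0))%E.
Proof.
move=> s0; rewrite hcube_image// -(lebesgue_outer_affine (b *m L))// !image_comp.
by congr lam; apply: eq_imagel => z _ /=; rewrite mulmxDl scalemxAl.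
Qed.

Lemma lam_unit_hcube_le1 : (lam (hcube 1 0) <= 1)%E.
Proof.
pose F (i : nat) : option (V * V) :=
  if i == 0%N then Some (\row_k (-1 -i* 1), 0) else None.
have F0 i : (0 <= (box_volume (F i))%:E)%E by rewrite lee_fin box_volume_ge0.
apply: (@le_trans _ _ (\sum_(i <oo) (box_volume (F i))%:E)%E).
  apply: ereal_inf_lbound; exists F => // z zb; exists 0%N => // k.
  have := zb k true; have := zb k false; rewrite !mxE /= !sub0r => -> ->.
  by [].
rewrite (nneseries_split _ 1)//.
rewrite big_nat1 add0n eseries0 ?adde0; last by case.
rewrite /= lee_fin prodr_ile1// => k _; rewrite !mxE /= opprK add0r.
by rewrite (max_r ler01) mul1r ler01 lexx.
Qed.

Lemma dyadic_cube_hcube n c : exists b, dyadic_cube n c = hcube (2 ^- n) b.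
Proof.
have p0 : 0 < 2 ^+ n :> R by rewrite exprn_gt0.
exists (\row_k (((c 0 k).1)%:~R / 2 ^+ n +i* (((c 0 k).2)%:~R / 2 ^+ n))).
have rE k t : rcoord t ((\row_j (((c 0 j).1)%:~R / 2 ^+ n +i* (((c 0 j).2)%:~R / 2 ^+ n)) : V) 0 k)
    = (if t then (c 0 k).1 else (c 0 k).2)%:~R / 2 ^+ n.
  by rewrite mxE; case: t.
have e (x : int) (y : R) : ((x - 1)%:~R < 2 ^+ n * y <= x%:~R) =
    (x%:~R / 2 ^+ n - 2 ^- n < y <= x%:~R / 2 ^+ n).
  by rewrite -{2}[2 ^- n]mul1r -mulrBl ltr_pdivrMr// ler_pdivlMr// intrB (mulrC y).
apply/seteqP; split => z.
  by move=> /dyadic_cube_itv H k t; rewrite rE -e.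
by move=> H; apply/dyadic_cube_itv => k t; rewrite e -rE.
Qed.

Lemma ball_sub_hcube x (r : R) : 0 < r -> exists b,
  [set z | hnorm (z - x) <= r] `<=` hcube (3 * r) b.
Proof.
move=> r0; exists (\row_k (x 0 k + (r +i* r))) => z /= zx k t.
have : `|rcoord t (z 0 k) - rcoord t (x 0 k)| <= r.
  apply: le_trans zx; apply: le_trans (cabs_le_hnorm _ k); rewrite !mxE.
  case: t; [apply: le_trans (normRe_le_cabs _)|apply: le_trans (normIm_le_cabs _)];
  by rewrite /=; case: (z 0 k) (x 0 k) => a b [].
have -> : rcoord t ((\row_k0 (x 0 k0 + (r +i* r)) : V) 0 k) = rcoord t (x 0 k) + r.
  by rewrite mxE; case: (x 0 k) => a b; case: t.
by rewrite ler_norml => /andP[h1 h2]; apply/andP; split; lra.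
Qed.

Lemma hcube_sub_ball (s : R) b z : hcube s b z -> hnorm (z - b) <= 2 * m%:R * s.
Proof.
move=> zb; have d k t : `|rcoord t (z 0 k) - rcoord t (b 0 k)| <= s.
  by have /andP[h1 h2] := zb k t; rewrite ler_norml; apply/andP; split; lra.
apply: le_trans (hnorm_le_sum _) _.
have -> : 2 * m%:R * s = \sum_(k < m) (2 * s) :> R.
  by rewrite sumr_const card_ord -[RHS]mulr_natr mulrAC.
apply: ler_sum => k _; apply: le_trans (cabs_le_ReIm _) _.
have := d k true; have := d k false; rewrite /= !mxE.
by case: (z 0 k) (b 0 k) => x y [x' y'] /=; lra.
Qed.

(** Every dyadic cube is a scaled translate of the unit cube and L commutes with scaling, so the
    constant of the unit cube holds for all cubes, then for open sets by partition, then for all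
    sets by regularity. *)
Lemma lebesgue_outer_mulmx_le L (k : R) E : 0 < k ->
  (lam ((fun z => (z *m L)%R) @` hcube 1 0) <= k%:E * lam (hcube 1 0))%E ->
  (lam ((fun z => (z *m L)%R) @` E) <= k%:E * lam E)%E.
Proof.
move=> k0 kQ; apply: (@lebesgue_outer_le_open _ _ (fun X => lam ((fun z => (z *m L)%R) @` X))) => //.
  by move=> X Y XY; apply: le_lebesgue_outer; exact: image_subset.
move=> G oG _; have [|F [tF -> FP]] := @hopen_partition _ _ (fun _ _ => True) G oG.
  by move=> z _; exists 0%N.
have mF i : lebesgue_measurable (F i).
  have [->|[n [c [_ _ ->]]]] := FP i; last exact: dyadic_cube_measurable.
  exact: (@measurable0 _ (lebesgue_type R m)).
rewrite lam_bigcup// image_bigcup; apply: le_trans (@lebesgue_outer_sigma_subadditive R m _) _.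
rewrite -nneseriesZl; last by move=> i _; exact: lebesgue_outer_ge0.
apply: lee_nneseries => [i _ _|i _]; first exact: lebesgue_outer_ge0.
have [->|[n [c [_ _ ->]]]] := FP i.
  by rewrite image_set0 lebesgue_outer0 mule0.
have [b ->] := dyadic_cube_hcube n c.
have n0 : 0 < 2 ^- n :> R by rewrite invr_gt0 exprn_gt0.
rewrite lam_hcube// lam_hcube_mulmx// muleCA; apply: lee_wpmul2l kQ.
by rewrite lee_fin exprn_ge0// ltW.
Qed.

Definition unitary_row U := forall z w : V, hdot (z *m U) (w *m U) = hdot z w.

Lemma unitary_row_hnorm U z : unitary_row U -> hnorm (z *m U) = hnorm z.
Proof.
by move=> uU; apply/eqP; rewrite -(@eqrXn2 _ 2)// ?hnorm_ge0// -(inj_eq (@complexI R)) -!hdotzz uU.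
Qed.

Lemma unitary_row_unit U : unitary_row U -> U \in unitmx.
Proof.
move=> uU; rewrite -row_free_unit; apply: inj_row_free => v v0; apply/eqP.
by rewrite -hnorm_eq0 -(unitary_row_hnorm v uU) v0 hnorm0.
Qed.

Lemma hcontV_mulmx L : hcontV_on setT (fun z => z *m L).
Proof.
move=> z _ e e0; have [B B0 H] := hnorm_mulmx_bound L.
exists (e / B) => [|w]; first by rewrite divr_gt0.
by rewrite ltr_pdivlMr// mulrC -mulmxBl; exact: le_lt_trans.
Qed.

Lemma mulmx_cube_measurable L n c : L \in unitmx ->
  lebesgue_measurable ((fun z => z *m L) @` dyadic_cube n c).
Proof.
move=> uL; have := @measurable_preimage_cube _ _ setT _ n c (@hopenT R m) (@hcontV_mulmx (invmx L)).
congr lebesgue_measurable; apply/seteqP; split => z.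
  by move=> [_ /= zc]; exists (z *m invmx L) => //; rewrite mulmxKV.
by move=> [w wc <-]; split => //=; rewrite mulmxK.
Qed.

Lemma lam_unit_ball_fin : (lam (@unit_ball R m) < +oo)%E.
Proof.
have [b Hb] := @ball_sub_hcube 0 1 ltr01.
have : (lam (@unit_ball R m) <= lam (hcube (3 * 1) b))%E.
  by apply: le_lebesgue_outer => z /ltW z1; apply: Hb; rewrite /= subr0.
move=> /le_lt_trans; apply; rewrite lam_hcube ?mulr_gt0//.
apply: (@le_lt_trans _ _ (((3 * 1) ^+ (2 * m))%:E * 1)%E); last by rewrite mule1 ltry.
by apply: lee_wpmul2l lam_unit_hcube_le1; rewrite lee_fin exprn_ge0// mulr_ge0.
Qed.

Lemma lam_unit_ball_gt0 : (0 < lam (hcube 1 0))%E -> (0 < lam (@unit_ball R m))%E.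
Proof.
(* A cube of side s cornered at 0 has norm at most 2 m s, which is below 1 for this s. *)
move=> Q0; pose s : R := (2 * m%:R + 1)^-1.
have d0 : 0 < 2 * m%:R + 1 :> R by rewrite ltr_wpDl// mulr_ge0.
have s0 : 0 < s by rewrite invr_gt0.
apply: (@lt_le_trans _ _ (lam (hcube s 0))).
  by rewrite lam_hcube// mule_gt0// lte_fin exprn_gt0.
apply: le_lebesgue_outer => z /hcube_sub_ball; rewrite subr0 /unit_ball /= => /le_lt_trans; apply.
by rewrite ltr_pdivrMr// mul1r ltrDl.
Qed.

(* U maps the ball onto itself, and multiplies the measure of all dyadic cubes
   by the same factor. *)
Lemma lam_unitary U : (0 < lam (hcube 1 0))%E -> unitary_row U ->
  lam ((fun z => z *m U) @` hcube 1 0) = lam (hcube 1 0).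
Proof.
move=> Q0 uU; have uU' := unitary_row_unit uU.
have [|F [tF BF FP]] := @hopen_partition _ _ (fun _ _ => True) _ (@hopen_unit_ball R m).
  by move=> z _; exists 0%N.
have mF i : lebesgue_measurable (F i).
  have [->|[n [c [_ _ ->]]]] := FP i; last exact: dyadic_cube_measurable.
  exact: (@measurable0 _ (lebesgue_type R m)).
have mUF i : lebesgue_measurable ((fun z => z *m U) @` F i).
  have [->|[n [c [_ _ ->]]]] := FP i; last exact: mulmx_cube_measurable.
  by rewrite image_set0; exact: (@measurable0 _ (lebesgue_type R m)).
have UB : (fun z => z *m U) @` @unit_ball R m = @unit_ball R m.
  apply/seteqP; split => z.
    by move=> [w w1 <-]; rewrite /unit_ball /= unitary_row_hnorm.
  move=> z1; exists (z *m invmx U); last by rewrite mulmxKV.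
  by rewrite /unit_ball /= -(unitary_row_hnorm _ uU) mulmxKV.
have tUF : trivIset setT (fun i => (fun z => z *m U) @` F i).
  move=> i j _ _ [z [[w1 w1F <-] [w2 w2F /(can_inj (mulmxK uU')) E]]].
  by apply: tF => //; exists w1; split => //; rewrite -E.
set q := lam (hcube 1 0) in Q0 *; set k := lam _.
have qf : q \is a fin_num.
  by rewrite ge0_fin_numE ?lebesgue_outer_ge0// (le_lt_trans lam_unit_hcube_le1) ?ltry.
have kf : k \is a fin_num.
  rewrite ge0_fin_numE ?lebesgue_outer_ge0//.
  have m0 : 0 < 2 * m%:R + 1 :> R by rewrite ltr_wpDl// mulr_ge0.
  have [b Hb] := @ball_sub_hcube 0 _ m0.
  apply: (@le_lt_trans _ _ (lam (hcube (3 * (2 * m%:R + 1)) b))).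
    apply: le_lebesgue_outer => z [w /hcube_sub_ball + <-]; rewrite subr0 mulr1 => wm.
    by apply: Hb; rewrite /= subr0 unitary_row_hnorm//; lra.
  rewrite lam_hcube ?mulr_gt0// -/q -(fineK qf) -EFinM; exact: ltry.
(* The measure of one and the same ball is computed from the cubes and from their images; being
   positive and finite, it cancels. *)
have E : (q * lam (@unit_ball R m) = k * lam (@unit_ball R m))%E.
  rewrite -{1}UB BF image_bigcup !lam_bigcup// -(fineK qf) -(fineK kf).
  rewrite -!nneseriesZl; try by move=> i _; exact: lebesgue_outer_ge0.
  apply: eq_eseriesr => i _; rewrite (fineK qf) (fineK kf).
  have [->|[n [c [_ _ ->]]]] := FP i; first by rewrite image_set0 lebesgue_outer0 !mule0.
  have [b ->] := dyadic_cube_hcube n c.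
  have n0 : 0 < 2 ^- n :> R by rewrite invr_gt0 exprn_gt0.
  by rewrite lam_hcube// lam_hcube_mulmx// -/q -/k muleCA (muleC q) muleCA.
have bf : lam (@unit_ball R m) \is a fin_num.
  by rewrite ge0_fin_numE ?lebesgue_outer_ge0// lam_unit_ball_fin.
have b0 : 0 < fine (lam (@unit_ball R m)).
  by rewrite -lte_fin fineK// lam_unit_ball_gt0.
move: E; rewrite -(fineK bf) -(fineK qf) -(fineK kf) -!EFinM => -[] /mulIf.
by move=> -> //; rewrite gt_eqF.
Qed.

Lemma lebesgue_outer_unitary_le U E : (0 < lam (hcube 1 0))%E -> unitary_row U ->
  (lam ((fun z => (z *m U)%R) @` E) <= lam E)%E.
Proof.
move=> Q0 uU; have := @lebesgue_outer_mulmx_le U 1 E ltr01.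
by rewrite !mul1e lam_unitary// lexx => /(_ isT).
Qed.

End LinearImages.

(** * Volume factors of the derivatives of ball involutions *)

Section JacobianVolume.
Variables (R : realType) (m : nat).
Local Notation C := R[i].
Local Notation V := 'rV[C]_m.
Local Notation lam := (@lebesgue_outer R m).
Implicit Types (z w a b v x : V) (D E X G : set V) (L U W : 'M[C]_m).

(** An upper bound standing for the squared modulus of the determinant; it passes to products, so it
    need only be found for the factors. *)
Definition expands L (k : R) := 0 < k /\
  forall E, (lam ((fun z => (z *m L)%R) @` E) <= k%:E * lam E)%E.

Lemma expandsM L M k l : expands L k -> expands M l -> expands (L *m M) (k * l).
Proof.
move=> [k0 kL] [l0 lM]; split; first exact: mulr_gt0.
move=> E; rewrite mulrC EFinM -muleA.
apply: (@le_trans _ _ (l%:E * lam ((fun z => (z *m L)%R) @` E))%E); last first.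
  by apply: lee_wpmul2l => //; rewrite lee_fin ltW.
apply: le_trans (lM _); rewrite image_comp le_eqVlt; apply/orP; left; apply/eqP.
by congr lam; apply: eq_imagel => z _ /=; rewrite mulmxA.
Qed.

(** The Householder reflection in the hyperplane orthogonal to v. *)
Definition reflection v : 'M[C]_m :=
  1%:M - (2 / hdot v v) *: (\col_k Num.conj (v 0 k) *m v).

Lemma mul_reflection v z : z *m reflection v = z - (2 / hdot v v * hdot z v) *: v.
Proof.
rewrite mulmxBr mulmx1 -scalemxAr mulmxA mul_col_conj mul_scalar_mx.
by rewrite scalerA.
Qed.

Lemma reflection_unitary v : v != 0 -> unitary_row (reflection v).
Proof.
move=> v0 z w; have n0 : hdot v v != 0.
  by rewrite hdotzz gt_eqF// ltcR exprn_gt0 ?hnorm_gt0.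
rewrite !mul_reflection !hdotBl !hdotBr !hdotZl !hdotZr.
rewrite (rmorphM _ (2 / hdot v v)) fmorph_div rmorph_nat /= -!hdotC.
by field.
Qed.

Lemma hdot_delta z i : hdot z (delta_mx 0 i) = z 0 i.
Proof.
rewrite /hdot (bigD1 i)//= big1 => [|j /negbTE ji]; rewrite !mxE ?eqxx ?ji.
  by rewrite /= rmorph1 mulr1 addr0.
by rewrite andbF rmorph0 mulr0.
Qed.

(** Let u be the basis vector scaled to norm |a|, with a phase making <a,u> real and nonnegative.
    For v = a + u one gets <v,v> = 2 <a,v>, so the reflection of v sends a to -u; the plus sign
    ensures v != 0. *)
Lemma align_unitary a (i0 : 'I_m) : exists W, unitary_row W /\
  exists k : C, a *m W = k *: delta_mx 0 i0.
Proof.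
have [a0|a0] := eqVneq a 0.
  exists 1%:M; split => [z w|]; first by rewrite !mulmx1.
  by exists 0; rewrite a0 mul0mx scale0r.
have na : 0 < hnorm a by rewrite hnorm_gt0.
have [k k1 ak] : exists2 k : C, cabs k = 1 & a 0 i0 * Num.conj k = (cabs (a 0 i0))%:C.
  have [->|ai0] := eqVneq (a 0 i0) 0.
    by exists 1; rewrite ?cabs1// mul0r cabs0.
  have c0 : cabs (a 0 i0) != 0 by rewrite cabs_eq0.
  exists (a 0 i0 / (cabs (a 0 i0))%:C).
    by rewrite cabsM cabsV cabs_real ger0_norm ?cabs_ge0// divff.
  rewrite rmorphM /= mulrA mulJ fmorphV /= conj_realC -fmorphV -rmorphM /=.
  by rewrite expr2 mulfK.
pose u : V := ((hnorm a)%:C * k) *: delta_mx 0 i0.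
have au : hdot a u = (hnorm a * cabs (a 0 i0))%:C.
  rewrite hdotZr hdot_delta rmorphM /= conj_realC -mulrA (mulrC (Num.conj k)) ak.
  by rewrite (rmorphM _ (hnorm a)).
have ua : hdot u a = (hnorm a * cabs (a 0 i0))%:C by rewrite hdotC au conj_realC.
have uu : hdot u u = (hnorm a ^+ 2)%:C.
  have nd : hnorm (delta_mx 0 i0 : V) = 1.
    by rewrite /hnorm hdot_delta mxE !eqxx sqrtr1.
  by rewrite hdotzz hnormZ nd cabsM k1 !mulr1 cabs_real ger0_norm// ltW.
pose v := a + u.
have vv : hdot v v = 2 * hdot a v.
  by rewrite /v !hdotDl !hdotDr au ua uu hdotzz; ring.
have v0 : v != 0.
  apply: contraTneq na => v0; rewrite -leNgt.
  have : hdot a v = 0 by rewrite v0 hdot0r.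
  rewrite /v hdotDr au hdotzz -rmorphD => /complexI /eqP.
  rewrite paddr_eq0 ?sqr_ge0 ?mulr_ge0 ?hnorm_ge0 ?cabs_ge0// sqrf_eq0 => /andP[/eqP -> _].
  exact: lexx.
exists (reflection v); split; first exact: reflection_unitary.
exists (- ((hnorm a)%:C * k)).
have n0 : hdot v v != 0 by rewrite hdotzz gt_eqF// ltcR exprn_gt0 ?hnorm_gt0.
have av0 : hdot a v != 0 by move: n0; rewrite vv; apply: contra_neq => ->; rewrite mulr0.
rewrite mul_reflection vv; have -> : 2 / (2 * hdot a v) * hdot a v = 1 by field.
by rewrite scale1r /v opprD addrA subrr sub0r scaleNr.
Qed.

Lemma unitary_row_inv W : unitary_row W -> unitary_row (invmx W).
Proof.
by move=> uW z w; rewrite -uW !mulmxKV// unitary_row_unit.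
Qed.

(* That the unit cube has positive measure will be deduced from the existence
   of a set K of positive measure; its exact value is not needed. *)
Hypothesis Q0 : (0 < lam (hcube 1 0))%E.

Lemma expands_unitary U : unitary_row U -> expands U 1.
Proof.
by move=> uU; split => // E; rewrite mul1e; exact: lebesgue_outer_unitary_le.
Qed.

(** In a unitary basis containing the direction of a, L is diagonal: eigenvalue be + ga |a|^2 along
    a and be on the m - 1 other axes, each counted twice over the reals. *)
Lemma expands_rank1 a (be ga : R) (i0 : 'I_m) L : 0 < be -> 0 < be + ga * hnorm a ^+ 2 ->
  (forall z, z *m L = be%:C *: z + (ga%:C * hdot z a) *: a) ->
  expands L ((be + ga * hnorm a ^+ 2) ^+ 2 * be ^+ (2 * m.-1)).
Proof.
move=> be0 al0 LE; have [W [uW [k aW]]] := align_unitary a i0.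
have uW' := unitary_row_unit uW.
pose d (j : 'I_m) : R := if j == i0 then be + ga * hnorm a ^+ 2 else be.
have d0 j : 0 < d j by rewrite /d; case: ifP.
have prd : \prod_j d j ^+ 2 = (be + ga * hnorm a ^+ 2) ^+ 2 * be ^+ (2 * m.-1).
  rewrite (bigD1 i0)//= {1}/d eqxx; congr (_ * _).
  rewrite (eq_bigr (fun=> be ^+ 2)) => [|j /negbTE ji]; last by rewrite /d ji.
  by rewrite prodr_const exprM cardC1 card_ord.
have nk : (ga%:C * (Num.conj k * k)) = (ga * hnorm a ^+ 2)%:C.
  rewrite rmorphM /= -hdotzz -uW aW hdotZl hdotZr; congr (_ * _).
  by rewrite hdot_delta mxE !eqxx mulr1 mulrC.
have hWa z : hdot z a = Num.conj k * (z *m W) 0 i0.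
  by rewrite -uW aW hdotZr hdot_delta.
have -> : L = W *m (diag_mx (\row_j (d j)%:C) *m invmx W).
  rewrite mulmxA; apply: (can_inj (mulmxK uW')); rewrite mulmxKV//.
  apply/row_matrixP => i; rewrite !rowE !mulmxA LE mulmxDl -!scalemxAl aW hWa.
  move: (delta_mx 0 i *m W) => y; apply/rowP => j; rewrite mul_mx_diag !mxE /d.
  case: (j =P i0) => [->|_]; last by rewrite /= !mulr0 addr0 mulrC.
  by rewrite rmorphD /= -nk; ring.
rewrite -[X in expands _ X]mul1r -[X in expands _ (1 * X)]mulr1.
apply: expandsM; first exact: expands_unitary.
apply: expandsM; last by apply: expands_unitary; exact: unitary_row_inv.
split=> [|E]; first by rewrite mulr_gt0// exprn_gt0.
have := @lebesgue_outer_diag R m d 0 E d0; rewrite prd; congr (lam _ <= _)%E.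
apply: eq_imagel => z _; apply/rowP => j.
by rewrite mul_mx_diag !mxE addr0 mulrC.
Qed.

(** The eigenvalues of the opposite of the derivative are s^2 along a and s on its orthogonal, so
    the volume factor is s^(4 + 2(m - 1)) = (s^2)^(m + 1). *)
Lemma expands_ball_jac0 a (i0 : 'I_m) : unit_ball a ->
  expands (ball_jac a 0) ((1 - hnorm a ^+ 2) ^+ m.+1).
Proof.
move=> a1; set s := ball_shrink a; have s0 : 0 < s by exact: ball_shrink_gt0.
have s1 := ball_shrink_sqr a1; rewrite -/s in s1.
have s1' : 0 < 1 + s by rewrite addr_gt0.
have al : s + (- (s / (1 + s))) * hnorm a ^+ 2 = s ^+ 2.
  have -> : hnorm a ^+ 2 = 1 - s ^+ 2 by rewrite s1; ring.
  by field; rewrite gt_eqF.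
have m0 : (0 < m)%N by exact: leq_trans (ltn_ord i0).
have -> : (1 - hnorm a ^+ 2) ^+ m.+1 =
    1 * ((s + (- (s / (1 + s))) * hnorm a ^+ 2) ^+ 2 * s ^+ (2 * m.-1)).
  rewrite al mul1r -s1 -!exprM -exprD; congr (_ ^+ _).
  by rewrite -mulnDr add2n prednK.
(* The unitary factor -1 makes the eigenvalues positive, as [expands_rank1] requires. *)
have -> : ball_jac a 0 = - 1%:M *m (- ball_jac a 0).
  by rewrite mulNmx mul1mx opprK.
apply: expandsM.
  apply: expands_unitary => z w.
  by rewrite !mulmxN !mulmx1 hdotNl hdotNr opprK.
apply: expands_rank1 => //; first by rewrite al exprn_gt0.
move=> z; rewrite mulmxN mul_ball_jac hdot0l subr0 invr1 scale1r ball_involution0// -/s.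
have p0 := shrink1_neq0 a; rewrite -/s in p0.
rewrite rmorphN rmorphM fmorphV rmorphD rmorph1 /=.
by apply/rowP => i; rewrite !mxE; field.
Qed.

(** At its own centre the derivative has the inverse eigenvalues, s^-2 along a and s^-1 on its
    orthogonal, again up to the factor -1. *)
Lemma expands_ball_jac_self a (i0 : 'I_m) : unit_ball a ->
  expands (ball_jac a a) ((1 - hnorm a ^+ 2) ^- m.+1).
Proof.
move=> a1; set s := ball_shrink a; have s0 : 0 < s by exact: ball_shrink_gt0.
have s1 := ball_shrink_sqr a1; rewrite -/s in s1.
have s1' : 0 < 1 + s by rewrite addr_gt0.
have al : s^-1 + (s ^- 2 / (1 + s)) * hnorm a ^+ 2 = s ^- 2.
  have -> : hnorm a ^+ 2 = 1 - s ^+ 2 by rewrite s1; ring.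
  by field; rewrite !gt_eqF.
have m0 : (0 < m)%N by exact: leq_trans (ltn_ord i0).
have -> : (1 - hnorm a ^+ 2) ^- m.+1 =
    1 * ((s^-1 + (s ^- 2 / (1 + s)) * hnorm a ^+ 2) ^+ 2 * s^-1 ^+ (2 * m.-1)).
  rewrite al mul1r -s1 -!exprVn -!exprM -exprD; congr (_ ^+ _).
  by rewrite -mulnDr add2n prednK.
have -> : ball_jac a a = - 1%:M *m (- ball_jac a a).
  by rewrite mulNmx mul1mx opprK.
apply: expandsM.
  apply: expands_unitary => z w.
  by rewrite !mulmxN !mulmx1 hdotNl hdotNr opprK.
apply: expands_rank1 => //; [by rewrite invr_gt0|by rewrite al invr_gt0 exprn_gt0|].
move=> z; rewrite mulmxN mul_ball_jac ball_involution_self// -/s.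
have p0 := shrink1_neq0 a; rewrite -/s in p0.
have ps := shrink_neq0 a1; rewrite -/s in ps.
rewrite (hdot_shrink a1) -/s opprB addrCA subrr addr0.
rewrite rmorphM !fmorphV rmorphXn rmorphD rmorph1 /=.
by apply/rowP => i; rewrite !mxE; field; rewrite p0 ps.
Qed.

End JacobianVolume.

(** * Invariance of the hyperbolic measure *)

Section HyperbolicMeasure.
Variables (R : realType) (m : nat).
Local Notation C := R[i].
Local Notation V := 'rV[C]_m.
Local Notation lam := (@lebesgue_outer R m).
Local Notation dens := (@hyperbolic_density R m).
Local Notation LT := (lebesgue_type R m).
Implicit Types (z w a b v x : V) (D A E X G : set V).

Lemma lebesgue_measurable0 : lebesgue_measurable (set0 : set V).
Proof. exact: (@measurable0 _ LT). Qed.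

Lemma hyperbolic_densityE z : unit_ball z -> dens z = (1 - hnorm z ^+ 2) ^- m.+1.
Proof. by move=> z1; rewrite /hyperbolic_density patchE mem_set. Qed.

Lemma hyperbolic_density_ge0 z : 0 <= dens z.
Proof.
rewrite /hyperbolic_density patchE; case: ifPn => // /set_mem /unit_ball_sqr z1.
by rewrite invr_ge0 exprn_ge0// ltW.
Qed.

Lemma hyperbolic_density_ge1 z : unit_ball z -> 1 <= dens z.
Proof.
move=> z1; rewrite hyperbolic_densityE// invf_ge1 ?exprn_gt0 ?unit_ball_sqr//.
rewrite exprn_ile1//; first exact: ltW (unit_ball_sqr z1).
by rewrite lerBlDr lerDl sqr_ge0.
Qed.

Lemma hcont_on_comp D (f : V -> R) (g : R -> R) : hcont_on D f ->
  (forall z, D z -> {for f z, continuous g}) -> hcont_on D (g \o f).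
Proof.
move=> cf cg z Dz e e0; have /cvgrPdist_lt /(_ e e0) := cg z Dz.
move=> /nbhs_ballP[d /= d0 H]; have [r r0 Hr] := cf z Dz d d0.
exists r => // w /Hr; rewrite distrC => K.
rewrite distrC; exact: H.
Qed.

Lemma hcont_on_hnorm D : hcont_on D (@hnorm R m).
Proof.
move=> z _ e e0; exists e => // w wz; apply: le_lt_trans wz.
have := hnorm_sub_le z w; rewrite -(hnormN (z - w)) opprB => h1.
have h2 := hnorm_sub_le w z.
by rewrite ler_norml; apply/andP; split; lra.
Qed.

Lemma hcont_on_density : hcont_on (@unit_ball R m) dens.
Proof.
have : hcont_on (@unit_ball R m) ((fun r : R => ((1 - r ^+ 2) ^+ m.+1)^-1) \o @hnorm R m).
  apply: hcont_on_comp; first exact: hcont_on_hnorm.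
  move=> z /unit_ball_sqr z1; apply: cvgV; first by rewrite expf_neq0// gt_eqF.
  apply: (@continuous_comp _ _ _ (fun r : R => 1 - r ^+ 2) (fun x : R => x ^+ m.+1));
    last exact: exprn_continuous.
  by apply: cvgB; [exact: cvg_cst|exact: exprn_continuous].
move=> H z z1 e e0; have [d d0 Hd] := H z z1 e e0.
have [r r0 Hr] := hopen_unit_ball z1.
exists (Num.min d r) => [|w]; first by rewrite lt_min d0.
by rewrite lt_min => /andP[/Hd + /Hr w1]; rewrite !hyperbolic_densityE.
Qed.

Lemma hcont_measurable_fun D (f : V -> R) : hopen D -> hcont_on D f ->
  measurable_fun (D : set LT) (f : LT -> R).
Proof.
move=> oD cf mD; apply: (measurability _ (RGenOInfty.measurableE R)) => //.
move=> _ [_ [r ->] <-].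
have := hopen_measurable (hopen_gt (r := r) oD cf); congr lebesgue_measurable.
by apply/seteqP; split => z [Dz] /=; rewrite in_itv /= andbT.
Qed.

Lemma measurable_density A : lebesgue_measurable A -> A `<=` @unit_ball R m ->
  measurable_fun (A : set LT) (EFin \o (dens : LT -> R)).
Proof.
move=> mA AB; apply/measurable_EFinP.
apply: (@measurable_funS _ _ LT _ (@unit_ball R m)) => //.
  exact: hopen_measurable (@hopen_unit_ball R m).
exact: hcont_measurable_fun (@hopen_unit_ball R m) hcont_on_density.
Qed.

Lemma hyperbolic_measure_ge0 A : (0 <= hyperbolic_measure A)%E.
Proof. by apply: integral_ge0 => z _; rewrite lee_fin hyperbolic_density_ge0. Qed.

Lemma hyperbolic_measure_le A (c : R) : lebesgue_measurable A ->
  A `<=` @unit_ball R m -> (forall z, A z -> dens z <= c) ->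
  (hyperbolic_measure A <= c%:E * lam A)%E.
Proof.
move=> mA AB Ac; have E := integral_cst (lebesgue_Cm R m) mA c%:E.
rewrite -[X in (_ <= X)%E]E; apply: ge0_le_integral => //.
- by move=> z _; rewrite lee_fin hyperbolic_density_ge0.
- exact: measurable_density.
Qed.

Lemma hyperbolic_measure_ge A (c : R) : lebesgue_measurable A -> 0 <= c ->
  A `<=` @unit_ball R m -> (forall z, A z -> c <= dens z) ->
  (c%:E * lam A <= hyperbolic_measure A)%E.
Proof.
move=> mA c0 AB Ac; have E := integral_cst (lebesgue_Cm R m) mA c%:E.
rewrite -[X in (X <= _)%E]E; apply: ge0_le_integral => //.
- exact: measurable_density.
Qed.

Lemma hyperbolic_measureS A E : lebesgue_measurable A -> lebesgue_measurable E ->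
  A `<=` E -> E `<=` @unit_ball R m -> (hyperbolic_measure A <= hyperbolic_measure E)%E.
Proof.
move=> mA mE AE EB; apply: ge0_subset_integral => //; first exact: measurable_density.
by move=> z _; rewrite lee_fin hyperbolic_density_ge0.
Qed.

Lemma hyperbolic_measure_bigcup (E : nat -> set V) :
  (forall k, lebesgue_measurable (E k)) -> (forall k, E k `<=` @unit_ball R m) ->
  trivIset setT E ->
  hyperbolic_measure (\bigcup_k E k) = (\sum_(k <oo) hyperbolic_measure (E k))%E.
Proof.
move=> mE EB tE; apply: (@ge0_integral_bigcup _ LT) => //.
  apply: measurable_density; first exact: (@bigcupT_measurable _ LT).
  by move=> z [k _]; exact: EB.
by move=> z _; rewrite lee_fin hyperbolic_density_ge0.
Qed.

Lemma hyperbolic_measureU A E : lebesgue_measurable A -> lebesgue_measurable E ->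
  A `<=` @unit_ball R m -> E `<=` @unit_ball R m -> [disjoint A & E] ->
  hyperbolic_measure (A `|` E) = (hyperbolic_measure A + hyperbolic_measure E)%E.
Proof.
move=> mA mE AB EB AE; apply: (@ge0_integral_setU _ LT) => //.
  apply: measurable_density; first exact: (@measurableU _ LT).
  by move=> z [/AB|/EB].
by move=> z _; rewrite lee_fin hyperbolic_density_ge0.
Qed.

End HyperbolicMeasure.

(** * Volume of the image of a small cube *)

Section LocalEstimate.
Variables (R : realType) (m : nat).
Local Notation C := R[i].
Local Notation V := 'rV[C]_m.
Local Notation lam := (@lebesgue_outer R m).
Implicit Types (z w a b v x : V) (D A E X G : set V) (L M : 'M[C]_m).

Lemma hcube_fatten (s r : R) b : 0 < s -> 0 < r -> exists b',
  forall z w, hcube s b z -> hnorm w <= r * s -> hcube ((1 + 2 * r) * s) b' (z + w).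
Proof.
move=> s0 r0; exists (\row_k (b 0 k + (r * s +i* (r * s)))) => z w zb wr k t.
have wk : `|rcoord t (w 0 k)| <= r * s.
  apply: le_trans wr; apply: le_trans (cabs_le_hnorm w k).
  by case: t; [exact: normRe_le_cabs|exact: normIm_le_cabs].
have -> : rcoord t ((\row_j (b 0 j + (r * s +i* (r * s))) : V) 0 k) = rcoord t (b 0 k) + r * s.
  by rewrite mxE; case: (b 0 k) => x y; case: (t).
have -> : rcoord t ((z + w) 0 k) = rcoord t (z 0 k) + rcoord t (w 0 k).
  by rewrite mxE; case: (z 0 k) (w 0 k) => x y [x' y']; case: (t).
have /andP[h1 h2] := zb k t; move: wk; rewrite ler_norml => /andP[h3 h4].
by apply/andP; split; lra.
Qed.

(* On a small cube around [x], [f] differs from its affine approximation by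
   the image under [L] of a displacement that is small compared to the side. *)
Lemma local_volume_estimate (f : V -> V) x L (k r : R) : hdiff f x L ->
  L \in unitmx -> expands L k -> 1 < r -> exists n0, forall n, (n0 <= n)%N ->
  (lam (f @` dyadic_cube n (dyadic_code n x)) <=
     (r * k)%:E * lam (dyadic_cube n (dyadic_code n x)))%E.
Proof.
move=> fL uL [k0 kL] r1; have [d d0 dr] := expr_1D_le (2 * m) r1.
have [B B0 HB] := hnorm_mulmx_bound (invmx L).
have m0 : 0 < 2 * m%:R + 1 :> R by rewrite ltr_wpDl// mulr_ge0.
(* A point of the cube is within 2 m 2^-n of x, so pulling the remainder back through L displaces it
   by at most (d / 2) 2^-n, and the side grows by the factor 1 + d. The added 1 keeps the divisor
   positive. *)
pose e := d / 2 / (B * (2 * m%:R + 1)).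
have e0 : 0 < e by rewrite !divr_gt0// mulr_gt0.
have [dl dl0 Hf] := fL e e0; have [n0 Hn] := dyadic_small m dl0.
exists n0 => n n0n; have s0 : 0 < 2 ^- n :> R by rewrite invr_gt0 exprn_gt0.
have [b Eb] := dyadic_cube_hcube R n (dyadic_code n x).
have [b' Hb'] := hcube_fatten b s0 (divr_gt0 d0 (ltr0Sn R 1)).
pose g := fun y : V => y + (f x - x *m L).
have sub : f @` dyadic_cube n (dyadic_code n x) `<=`
   g @` ((fun z => z *m L) @` hcube ((1 + 2 * (d / 2)) * 2 ^- n) b').
  move=> _ [z zx <-]; have diam := dyadic_cube_diam zx (erefl (dyadic_code n x)).
  pose w := (f z - f x - (z - x) *m L) *m invmx L.
  have K : hnorm (f z - f x - (z - x) *m L) <= e * hnorm (z - x).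
    have := Hf (z - x); rewrite subrKC; apply.
    exact: le_lt_trans (Hn n n0n).
  exists ((z + w) *m L); last first.
    rewrite /g mulmxDl /w mulmxKV// mulmxBl.
    move: (z *m L) (x *m L) (f z) (f x) => a1 a2 a3 a4.
    by apply/rowP => i; rewrite !mxE; ring.
  exists (z + w) => //; apply: Hb'; first by rewrite -Eb.
  apply: le_trans (HB _) _; rewrite mulrC -ler_pdivlMr//; apply: le_trans K _.
  apply: (@le_trans _ _ (e * ((2 * m%:R + 1) * 2 ^- n))).
    rewrite ler_pM2l//; apply: le_trans diam _.
    by rewrite ler_pM2r// lerDl.
  by rewrite le_eqVlt; apply/orP; left; apply/eqP; rewrite /e; field; rewrite !gt_eqF// exprn_gt0.
apply: le_trans (le_lebesgue_outer sub) _; rewrite lebesgue_outer_translate.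
have dE : 2 * (d / 2) = d by field.
have s1 : 0 < (1 + 2 * (d / 2)) * 2 ^- n by rewrite dE mulr_gt0// addr_gt0.
apply: le_trans (kL _) _; rewrite Eb (lam_hcube b' s1) (lam_hcube b s0) dE.
rewrite exprMn !EFinM !muleA; apply: lee_wpmul2r; first exact: lebesgue_outer_ge0.
rewrite -!EFinM lee_fin; apply: ler_wpM2r; first by rewrite exprn_ge0// ltW.
by rewrite mulrC ler_pM2r.
Qed.

End LocalEstimate.

(** * The hyperbolic measure under an automorphism *)

Section AutomorphismMeasure.
Variables (R : realType) (m : nat).
Local Notation C := R[i].
Local Notation V := 'rV[C]_m.
Local Notation lam := (@lebesgue_outer R m).
Local Notation ball := (@unit_ball R m).
Local Notation dens := (@hyperbolic_density R m).
Local Notation LT := (lebesgue_type R m).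
Implicit Types (z w a b v x : V) (D A E X G K N : set V) (L M : 'M[C]_m).
Variables (p q : V -> V) (i0 : 'I_m).
Hypothesis dp : holomorphic_on ball p.
Hypothesis dq : holomorphic_on ball q.
Hypothesis pB : forall z, ball z -> ball (p z).
Hypothesis qB : forall z, ball z -> ball (q z).
Hypothesis qK : forall z, ball z -> q (p z) = z.
Hypothesis pK : forall z, ball z -> p (q z) = z.
Hypothesis Q0 : (0 < lam (hcube 1 0))%E.

Let hp : hholo p.
Proof. by move=> z /dp /differentiable_hdiff. Qed.

Let hq : hholo q.
Proof. by move=> z /dq /differentiable_hdiff. Qed.

Lemma hholo_hcontV (f : V -> V) : hholo f -> hcontV_on ball f.
Proof.
move=> hf z z1 e e0; have [L fL] := hf z z1.
have [d d0 H] := hdiff_continuous fL e0; exists d => // w /H.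
by rewrite subrKC.
Qed.

Lemma hdiff_id x : hdiff (@id V) x 1%:M.
Proof.
move=> e e0; exists 1 => // h _; rewrite mulmx1 addrAC addrK subrr hnorm0.
by rewrite mulr_ge0 ?hnorm_ge0// ltW.
Qed.

(** In the chain rule p_x is differentiated at its centre and p_{p x} at 0, the two points where the
    volume factor of an involution was computed; the product of the two factors is a ratio of
    densities. *)
Lemma automorphism_jacobian x : ball x -> exists L, [/\ hdiff p x L, L \in unitmx &
  expands L (dens x / dens (p x))].
Proof.
move=> x1; have px1 := pB x1.
have ap : ball_automorphism p by split => //; exists q; split.
have [U [UE uU]] := automorphism_transport ap x1.
have U0 : ball_involution x x *m U = 0 by rewrite ball_involution_self// mul0mx.
pose L := ball_jac x x *m (U *m ball_jac (p x) 0).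
have pL : hdiff p x L.
  have [r r0 Hr] := unit_ball_open x1.
  apply: (@hdiff_ext _ _ _
    (ball_involution (p x) \o ((fun z => z *m U) \o ball_involution x)) _ _ _ r r0).
    by move=> h /Hr xh1; rewrite /= -UE// ball_involutionK//; exact: pB.
  rewrite /L mulmxA; apply: hdiff_comp.
    by apply: hdiff_comp; [exact: hdiff_ball_involution|exact: hdiff_linear].
  by rewrite /= U0; apply: hdiff_ball_involution => //; exact: unit_ball0.
exists L; split => //.
  (* Differentiating q o p = id at x exhibits an inverse of L. *)
  have [M qM] := hq px1.
  have [r r0 Hr] := unit_ball_open x1.
  have I1 : hdiff (q \o p) x 1%:M.
    apply: (@hdiff_ext _ _ _ id _ _ _ r r0); last exact: hdiff_id.
    by move=> h /Hr xh1 /=; rewrite qK.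
  by have [] := mulmx1_unit (hdiff_unique (hdiff_comp pL qM) I1).
rewrite !hyperbolic_densityE// invrK -[X in _ * X]mul1r.
apply: expandsM; first exact: expands_ball_jac_self.
by apply: expandsM; [exact: expands_unitary|exact: expands_ball_jac0].
Qed.

(** Turns direct images into preimages under q, so that continuity of q yields openness and
    measurability of images. *)
Lemma image_ball A : A `<=` ball -> p @` A = ball `&` q @^-1` A.
Proof.
move=> AB; apply/seteqP; split => z.
  by move=> [w Aw <-]; split; [exact/pB/AB|rewrite /= qK//; exact: AB].
by move=> [z1 /= Aqz]; exists (q z) => //; exact: pK.
Qed.

Lemma image_cube_measurable n c : dyadic_cube n c `<=` ball ->
  lebesgue_measurable (p @` dyadic_cube n c).
Proof.
move=> cB; rewrite image_ball//; apply: measurable_preimage_cube.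
  exact: hopen_unit_ball.
exact: hholo_hcontV.
Qed.

Lemma image_hopen G : hopen G -> G `<=` ball -> hopen (p @` G).
Proof.
move=> oG GB; rewrite image_ball// => z [z1 /= Gqz].
have [d d0 H] := oG _ Gqz; have [e e0 He] := hholo_hcontV hq z1 d0.
have [r r0 Hr] := hopen_unit_ball z1.
exists (Num.min e r) => [|w]; first by rewrite lt_min e0.
by rewrite lt_min => /andP[/He /H Gqw /Hr].
Qed.

Lemma image_sub_ball A : A `<=` ball -> p @` A `<=` ball.
Proof. by move=> AB _ [z /AB /pB ? <-]. Qed.

Lemma trivIset_image (E : nat -> set V) : (forall k, E k `<=` ball) ->
  trivIset setT E -> trivIset setT (fun k => p @` E k).
Proof.
move=> EB tE i j _ _ [z [[w1 w1E <-] [w2 w2E]]] => /(congr1 q).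
rewrite (qK (EB j _ w2E)) (qK (EB i _ w1E)) => E21.
by apply: tE => //; exists w1; split => //; rewrite -E21.
Qed.

Lemma local_hyperbolic_estimate x (r : R) : ball x -> 1 < r ->
  exists n0, forall n, (n0 <= n)%N -> dyadic_cube n (dyadic_code n x) `<=` ball /\
  (hyperbolic_measure (p @` dyadic_cube n (dyadic_code n x)) <=
     r%:E * hyperbolic_measure (dyadic_cube n (dyadic_code n x)))%E.
Proof.
(* Three factors t are spent: one on the volume estimate, one on the variation of the density over
   the cube, one on its variation over the image. *)
move=> x1 r1; have px1 := pB x1; have [d d0 dr] := expr_1D_le 3 r1.
set t := 1 + d in dr; have t1 : 1 < t by rewrite ltrDl.
have t0 : 0 < t by apply: lt_trans t1.
have [L [pL uL kL]] := automorphism_jacobian x1.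
have D0 z : ball z -> 0 < dens z by move=> z1; apply: lt_le_trans (hyperbolic_density_ge1 z1).
have [n1 H1] := local_volume_estimate pL uL kL t1.
have o2 := hopen_gt (r := dens x / t) (@hopen_unit_ball R m) (@hcont_on_density R m).
have [n2 H2] : exists n0, forall n, (n0 <= n)%N -> dyadic_cube n (dyadic_code n x) `<=`
    ball `&` [set z | dens x / t < dens z].
  apply: hopen_dyadic o2 _; split => //=.
  by rewrite ltr_pdivrMr// ltr_pMr// D0.
have o3 := hopen_lt (r := dens (p x) * t) (@hopen_unit_ball R m) (@hcont_on_density R m).
have [e e0 He] : exists2 e : R, 0 < e & forall w, hnorm (w - p x) < e ->
    (ball `&` [set z | dens z < dens (p x) * t]) w.
  by apply: o3; split => //=; rewrite ltr_pMr// D0.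
have [e' e'0 He'] := hholo_hcontV hp x1 e0.
have [n3 H3] := dyadic_small m e'0.
exists (maxn n1 (maxn n2 n3)) => n; rewrite !geq_max => /and3P[/H1 {}H1 /H2 {}H2 n3n].
set c := dyadic_cube n _ in H1 H2 *.
have cB : c `<=` ball by move=> z /H2[].
have pc z : c z -> dens (p z) <= dens (p x) * t.
  move=> cz; apply/ltW; have [] // := He (p z).
  apply: He'; apply: le_lt_trans (H3 n n3n).
  exact: dyadic_cube_diam cz (erefl (dyadic_code n x)).
have mc : lebesgue_measurable c by exact: dyadic_cube_measurable.
have mpc : lebesgue_measurable (p @` c) by exact: image_cube_measurable.
split => //; apply: (@le_trans _ _ ((dens (p x) * t)%:E * lam (p @` c))%E).
  by apply: hyperbolic_measure_le => //; [exact: image_sub_ball|move=> _ [z cz <-]; exact: pc].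
have dt0 : 0 <= dens (p x) * t by rewrite mulr_ge0// ltW// D0.
apply: (@le_trans _ _ ((dens (p x) * t)%:E * ((t * (dens x / dens (p x)))%:E * lam c))%E).
  by apply: lee_wpmul2l.
have dx0 : 0 <= dens x / t by rewrite divr_ge0// ltW// D0.
have H4 : ((dens x / t)%:E * lam c <= hyperbolic_measure c)%E.
  by apply: hyperbolic_measure_ge => // z /H2[_ /= /ltW].
have -> : ((dens (p x) * t)%:E * ((t * (dens x / dens (p x)))%:E * lam c) =
    (t ^+ 3)%:E * ((dens x / t)%:E * lam c))%E.
  rewrite !muleA -!EFinM; congr (_%:E * _)%E; field.
  by rewrite !gt_eqF// D0.
apply: (@le_trans _ _ ((t ^+ 3)%:E * hyperbolic_measure c)%E).
  by apply: lee_wpmul2l => //; rewrite lee_fin exprn_ge0// ltW.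
by apply: lee_wpmul2r; [exact: hyperbolic_measure_ge0|rewrite lee_fin].
Qed.

Lemma hyperbolic_measure_hopen G : hopen G -> G `<=` ball ->
  (hyperbolic_measure (p @` G) <= hyperbolic_measure G)%E.
Proof.
move=> oG GB.
have key (r : R) : 1 < r -> (hyperbolic_measure (p @` G) <= r%:E * hyperbolic_measure G)%E.
  move=> r1; have [|E [tE EG EP]] := @hopen_partition _ _ (fun n c => dyadic_cube n c `<=` ball /\
    (hyperbolic_measure (p @` dyadic_cube n c) <=
     r%:E * hyperbolic_measure (dyadic_cube n c))%E) G oG.
    by move=> z /GB z1; exact: local_hyperbolic_estimate.
  have EB k : E k `<=` ball.
    by have [->|[n [c [[cB _] _ ->]]]] := EP k => //; exact: sub0set.
  have mE k : lebesgue_measurable (E k).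
    have [->|[n [c [_ _ ->]]]] := EP k; first exact: lebesgue_measurable0.
    exact: dyadic_cube_measurable.
  have mpE k : lebesgue_measurable (p @` E k).
    have [->|[n [c [[cB _] _ ->]]]] := EP k; first by rewrite image_set0; exact: lebesgue_measurable0.
    exact: image_cube_measurable.
  rewrite EG image_bigcup !hyperbolic_measure_bigcup//; last 2 first.
    - by move=> k; exact: image_sub_ball.
    - exact: trivIset_image.
  rewrite -nneseriesZl; last by move=> k _; exact: hyperbolic_measure_ge0.
  apply: lee_nneseries => [k _ _|k _]; first exact: hyperbolic_measure_ge0.
  have [->|[n [c [[_ H] _ ->]]]] := EP k; last exact: H.
  by rewrite image_set0 /hyperbolic_measure !integral_set0 mule0.
have [hG|] := ltP (hyperbolic_measure G) +oo%E; last by rewrite leye_eq => /eqP ->; rewrite leey.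
have hf : hyperbolic_measure G \is a fin_num by rewrite ge0_fin_numE ?hyperbolic_measure_ge0.
apply/lee_addgt0Pr => e e0; have g0 : 0 < fine (hyperbolic_measure G) + 1.
  by rewrite ltr_wpDl// fine_ge0// hyperbolic_measure_ge0.
(* The excess of r over 1, multiplied by the finite measure of G, stays below e; the added 1 covers
   a null G. *)
have r1 : 1 < 1 + e / (fine (hyperbolic_measure G) + 1) by rewrite ltrDl divr_gt0.
apply: le_trans (key _ r1) _; rewrite -(fineK hf) -EFinM -EFinD lee_fin mulrDl mul1r lerD2l.
by rewrite mulrAC ler_pdivrMr// ler_pM2l// lerDl.
Qed.

Lemma null_measurable N : lam N = 0%E -> lebesgue_measurable N.
Proof.
move=> N0; apply: (@le_caratheodory_measurable _ _ (lebesgue_outer_measure R m)) => X.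
have -> : lebesgue_outer_measure R m (X `&` N) = 0%E.
  apply/eqP; rewrite eq_le [X in _ && X]lebesgue_outer_ge0 andbT -N0.
  by apply: le_lebesgue_outer; exact: subIsetr.
by rewrite add0e; apply: le_lebesgue_outer; exact: subIsetl.
Qed.

(* The density is bounded on each shell, so that sets of small Lebesgue measure
   have small hyperbolic measure there. *)
Let shell (j : nat) : set V := ball `&` [set z | dens z < j.+1%:R].

Let hopen_shell j : hopen (shell j).
Proof. exact: hopen_lt (@hopen_unit_ball R m) (@hcont_on_density R m). Qed.

Let shell_ball j : shell j `<=` ball. Proof. exact: subIsetl. Qed.

Let bigcup_shell : \bigcup_j shell j = ball.
Proof.
apply/seteqP; split => [z [j _ []]//|z z1].
exists (Num.bound (dens z)) => //; split => //=.
apply: lt_trans (archi_boundP (hyperbolic_density_ge0 z)) _.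
by rewrite ltr_nat.
Qed.

Let shell_le j A : lebesgue_measurable A -> A `<=` shell j ->
  (hyperbolic_measure A <= j.+1%:R%:E * lam A)%E.
Proof.
move=> mA AS; apply: hyperbolic_measure_le => //.
  by move=> z /AS[].
by move=> z /AS[_ /ltW].
Qed.

(** In a shell, N lies in an open set of small Lebesgue measure, hence of small hyperbolic measure.
    The image of that set has no larger hyperbolic measure, and this dominates Lebesgue measure
    because the density is at least 1. *)
Lemma image_null N : N `<=` ball -> lam N = 0%E -> lam (p @` N) = 0%E.
Proof.
move=> NB N0.
have key j : lam (p @` (N `&` shell j)) = 0%E.
  apply/eqP; rewrite eq_le lebesgue_outer_ge0 andbT; apply/lee_addgt0Pr => e e0.
  rewrite add0e; have ej : 0 < e / j.+1%:R by rewrite divr_gt0.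
  have lt : (lam (N `&` shell j) < (e / j.+1%:R)%:E)%E.
    apply: (@le_lt_trans _ _ (lam N)); first by apply: le_lebesgue_outer; exact: subIsetl.
    by rewrite N0 lte_fin.
  have [G [oG NG Ge]] := lebesgue_outer_regular lt.
  have oG' : hopen (G `&` shell j) := hopenI oG (@hopen_shell j).
  have G'B : G `&` shell j `<=` ball by move=> z [_ /shell_ball].
  have mG' := hopen_measurable oG'.
  have opG' := image_hopen oG' G'B.
  apply: (@le_trans _ _ (lam (p @` (G `&` shell j)))).
    by apply: le_lebesgue_outer; apply: image_subset => z [Nz Sz]; split => //; exact: NG.
  apply: (@le_trans _ _ (hyperbolic_measure (p @` (G `&` shell j)))).
    rewrite -[X in (X <= _)%E]mul1e; apply: hyperbolic_measure_ge => //.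
    - exact: hopen_measurable.
    - exact: image_sub_ball.
    - by move=> z /(image_sub_ball G'B) z1; exact: hyperbolic_density_ge1.
  apply: le_trans (hyperbolic_measure_hopen oG' G'B) _.
  apply: le_trans (shell_le mG' (@subIsetr _ _ _)) _.
  apply: (@le_trans _ _ (j.+1%:R%:E * (e / j.+1%:R)%:E)%E).
    apply: lee_wpmul2l; first by rewrite lee_fin.
    apply: le_trans (ltW Ge); apply: le_lebesgue_outer; exact: subIsetl.
  by rewrite -EFinM lee_fin mulrC divfK// pnatr_eq0.
have -> : p @` N = \bigcup_j (p @` (N `&` shell j)).
  rewrite -image_bigcup; congr image.
  by rewrite -setI_bigcupr bigcup_shell; apply/esym/setIidPl.
apply/eqP; rewrite eq_le lebesgue_outer_ge0 andbT.
apply: le_trans (@lebesgue_outer_sigma_subadditive R m _) _.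
by rewrite eseries0// => j _ _; exact: key.
Qed.

Lemma lam_ball_sub_fin A : A `<=` ball -> lam A \is a fin_num.
Proof.
move=> AB; rewrite ge0_fin_numE ?lebesgue_outer_ge0//.
by apply: le_lt_trans (le_lebesgue_outer AB) _; exact: lam_unit_ball_fin.
Qed.

Lemma lam_setD A E : lebesgue_measurable A -> A `<=` E ->
  (lam E = lam A + lam (E `\` A))%E.
Proof.
by move=> mA AE; rewrite [LHS](mA E) (setIidr AE) setDE.
Qed.

(** By regularity K is a countable intersection of open subsets of the ball minus a null set. As p
    is injective on the ball, its image commutes with these operations, and it preserves openness
    and nullity. *)
Lemma image_measurable K : lebesgue_measurable K -> K `<=` ball ->
  lebesgue_measurable (p @` K).
Proof.
move=> mK KB; have Kf := lam_ball_sub_fin KB.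
have H n : exists G, [/\ hopen G, K `<=` G & (lam G < lam K + n.+1%:R^-1%:E)%E].
  have lt : (lam K < (fine (lam K) + n.+1%:R^-1)%:E)%E.
    by rewrite EFinD fineK// lteDl// lte_fin.
  have [G [oG KG GK]] := lebesgue_outer_regular lt.
  by exists G; split => //; rewrite -(fineK Kf) -EFinD.
have [G HG] := choice H.
pose G' n := G n `&` ball; pose I' := \bigcap_n G' n.
have oG' n : hopen (G' n) by have [oG _ _] := HG n; exact: hopenI oG (@hopen_unit_ball R m).
have G'B n : G' n `<=` ball by exact: subIsetr.
have IB : I' `<=` ball by move=> z /(_ 0%N I); exact: G'B.
have KI : K `<=` I'.
  by move=> z Kz n _; split; [have [_ KG _] := HG n; exact: KG|exact: KB].
have N0 : lam (I' `\` K) = 0%E.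
  apply/eqP; rewrite eq_le lebesgue_outer_ge0 andbT; apply/lee_addgt0Pr => e e0.
  rewrite add0e; pose n := Num.bound e^-1.
  have ne : n.+1%:R^-1 <= e.
    rewrite -[leRHS]invrK lef_pV2 ?posrE ?invr_gt0//.
    apply/ltW; apply: lt_trans (archi_boundP _) _; first by rewrite invr_ge0 ltW.
    by rewrite ltr_nat.
  have : (lam I' <= lam K + n.+1%:R^-1%:E)%E.
    have [_ _ /ltW GK] := HG n; apply: le_trans GK; apply: le_lebesgue_outer.
    by move=> z /(_ n I)[].
  rewrite (lam_setD mK KI) leeD2lE// => /le_trans; apply.
  by rewrite lee_fin.
have -> : p @` K = (\bigcap_n (p @` G' n)) `\` p @` (I' `\` K).
  apply/seteqP; split.
    move=> _ [z Kz <-]; split => [n _|]; first by exists z => //; exact: KI.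
    move=> [w [Iw NKw]] /(congr1 q); rewrite (qK (IB _ Iw)) (qK (KB _ Kz)) => wz.
    by apply: NKw; rewrite wz.
  move=> z [zG zN]; have [w0 w0G w0z] := zG 0%N I.
  have w01 := G'B _ _ w0G; exists w0 => //; apply: contrapT => NK.
  apply: zN; exists w0 => //; split => // n _.
  have [w wG wz] := zG n I; have w1 := G'B _ _ wG.
  have := congr1 q (etrans w0z (esym wz)); rewrite (qK w01) (qK w1) => ->.
  exact: wG.
apply: (@measurableD _ LT).
  apply: (@bigcapT_measurable _ LT) => n.
  by apply: hopen_measurable; apply: image_hopen.
by apply: null_measurable; apply: image_null => // z [/IB].
Qed.

(** Cut K along the disjoint differences of the shells. Each piece lies in an open subset of its
    shell with Lebesgue excess at most e / (j + 1), hence hyperbolic excess at most e, and the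
    inequality for open sets applies. *)
Lemma hyperbolic_measure_image_le K : lebesgue_measurable K -> K `<=` ball ->
  (hyperbolic_measure (p @` K) <= hyperbolic_measure K)%E.
Proof.
move=> mK KB; pose E j := K `&` seqDU shell j.
have mE j : lebesgue_measurable (E j).
  apply: (@measurableI _ LT) => //; apply: (@seqDU_measurable _ LT) => n.
  exact: hopen_measurable (@hopen_shell n).
have ES j : E j `<=` shell j by move=> z [_ []].
have EB j : E j `<=` ball by move=> z /ES /shell_ball.
have tE : trivIset setT E.
  move=> i j _ _ [z [[_ zi] [_ zj]]].
  by apply: (@trivIset_seqDU _ shell) => //; exists z.
have KE : K = \bigcup_j E j.
  rewrite -setI_bigcupr -seqDU_bigcup_eq bigcup_shell.
  by apply/esym/setIidPl.
have mpE j : lebesgue_measurable (p @` E j) by exact: image_measurable.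
rewrite {1}KE image_bigcup [in leRHS]KE !hyperbolic_measure_bigcup//; last 2 first.
  - by move=> k; exact: image_sub_ball.
  - exact: trivIset_image.
apply: lee_nneseries => [j _ _|j _]; first exact: hyperbolic_measure_ge0.
apply/lee_addgt0Pr => e e0; have ej : 0 < e / j.+1%:R by rewrite divr_gt0.
have Ef := lam_ball_sub_fin (EB j).
have lt : (lam (E j) < (fine (lam (E j)) + e / j.+1%:R)%:E)%E.
  by rewrite EFinD fineK// lteDl// lte_fin.
have [G [oG EG Ge]] := lebesgue_outer_regular lt.
have oG' : hopen (G `&` shell j) := hopenI oG (@hopen_shell j).
have G'B : G `&` shell j `<=` ball by move=> z [_ /shell_ball].
have mG' := hopen_measurable oG'.
have EG' : E j `<=` G `&` shell j by move=> z Ez; split; [exact: EG|exact: ES].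
apply: (@le_trans _ _ (hyperbolic_measure (p @` (G `&` shell j)))).
  apply: hyperbolic_measureS => //; last exact: image_sub_ball.
    by apply: hopen_measurable; exact: image_hopen.
  exact: image_subset.
apply: le_trans (hyperbolic_measure_hopen oG' G'B) _.
have mD : lebesgue_measurable ((G `&` shell j) `\` E j) := @measurableD _ LT _ _ mG' (mE j).
rewrite -{1}(setDUK EG') hyperbolic_measureU//; last 2 first.
  - by move=> z [/G'B].
  - by apply/disj_setPS => z [? []].
have DS : (G `&` shell j) `\` E j `<=` shell j by move=> z [[_ Sz] _].
apply: leeD2l; apply: le_trans (shell_le mD DS) _.
apply: (@le_trans _ _ (j.+1%:R%:E * (e / j.+1%:R)%:E)%E); last first.
  by rewrite -EFinM lee_fin mulrC divfK// pnatr_eq0.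
apply: lee_wpmul2l; first by rewrite lee_fin.
rewrite -(leeD2lE _ _ Ef) -(lam_setD (mE j) EG').
apply: le_trans (le_lebesgue_outer (@subIsetl _ _ _)) _.
by apply: le_trans (ltW Ge) _; rewrite EFinD fineK.
Qed.

End AutomorphismMeasure.

(** * Change of variables and the barycenter *)

Section ChangeOfVariables.
Variables (R : realType) (m : nat) (i0 : 'I_m).
Local Notation C := R[i].
Local Notation V := 'rV[C]_m.
Local Notation lam := (@lebesgue_outer R m).
Local Notation mu := (lebesgue_Cm R m).
Local Notation ball := (@unit_ball R m).
Local Notation dens := (@hyperbolic_density R m).
Local Notation LT := (lebesgue_type R m).
Implicit Types (z w a : V) (A E K : set V) (p q : V -> V) (f g : V -> R).
Hypothesis Q0 : (0 < lam (hcube 1 0))%E.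

(** Symmetric in p and q, so that each one-sided inequality can be used in both directions. *)
Definition inverse_automorphisms p q :=
  (holomorphic_on ball p /\ holomorphic_on ball q) /\
  [/\ forall z, ball z -> ball (p z), forall z, ball z -> ball (q z),
      forall z, ball z -> q (p z) = z & forall z, ball z -> p (q z) = z].

Lemma inverse_automorphisms_sym p q :
  inverse_automorphisms p q -> inverse_automorphisms q p.
Proof. by move=> [[? ?] [? ? ? ?]]. Qed.

Lemma image_imageK p q K : inverse_automorphisms p q -> K `<=` ball ->
  q @` (p @` K) = K.
Proof.
move=> [_ [_ _ qK _]] KB; rewrite image_comp -[RHS]image_id.
by apply: eq_imagel => z /KB /qK.
Qed.

Lemma image_automorphism_measurable p q K : inverse_automorphisms p q ->
  lebesgue_measurable K -> K `<=` ball -> lebesgue_measurable (p @` K).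
Proof.
move=> [[dp dq] [pB qB qK pK]] mK KB.
exact: (image_measurable i0 dp dq pB qB qK pK Q0 mK KB).
Qed.

Lemma image_automorphism_sub p q K : inverse_automorphisms p q ->
  K `<=` ball -> p @` K `<=` ball.
Proof. by move=> [_ [pB _ _ _]] KB _ [z /KB /pB ? <-]. Qed.

Lemma hyperbolic_measure_image p q K : inverse_automorphisms p q ->
  lebesgue_measurable K -> K `<=` ball ->
  hyperbolic_measure (p @` K) = hyperbolic_measure K.
Proof.
move=> pq mK KB; apply/eqP; rewrite eq_le.
have mpK := image_automorphism_measurable pq mK KB.
have pKB := image_automorphism_sub pq KB.
have [[dp dq] [pB qB qK pK]] := pq.
apply/andP; split; first exact: (hyperbolic_measure_image_le i0 dp dq pB qB qK pK Q0 mK KB).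
rewrite -{1}(image_imageK pq KB).
exact: (hyperbolic_measure_image_le i0 dq dp qB pB pK qK Q0 mpK pKB).
Qed.

Lemma hcont_on_measurable A f : lebesgue_measurable A -> A `<=` ball ->
  hcont_on ball f -> measurable_fun (A : set LT) (f : LT -> R).
Proof.
move=> mA AB cf; apply: (@measurable_funS _ _ LT _ ball) => //.
  exact: hopen_measurable (@hopen_unit_ball R m).
exact: hcont_measurable_fun (@hopen_unit_ball R m) cf.
Qed.

Lemma measurable_mul_density A f : lebesgue_measurable A -> A `<=` ball ->
  hcont_on ball f -> measurable_fun (A : set LT) ((fun z => f z * dens z) : LT -> R).
Proof.
move=> mA AB cf; apply: (@measurable_funM _ LT); first exact: hcont_on_measurable.
exact: hcont_on_measurable (@hcont_on_density R m).
Qed.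

Lemma hcont_on_comp_automorphism p q f : inverse_automorphisms p q ->
  hcont_on ball f -> hcont_on ball (f \o p).
Proof.
move=> [[dp _] [pB _ _ _]] cf z z1 e e0; have [d d0 Hd] := cf _ (pB _ z1) e e0.
have hp : hholo p by move=> y /dp /differentiable_hdiff.
have [r r0 Hr] := hholo_hcontV hp z1 d0.
by exists r => // w /Hr /Hd.
Qed.

(* Slicing [K] along the values of [f \o p] reduces the inequality to the
   invariance of the hyperbolic measure. *)
Lemma integral_image_le p q K f : inverse_automorphisms p q ->
  lebesgue_measurable K -> K `<=` ball -> (hyperbolic_measure K < +oo)%E ->
  hcont_on ball f -> (forall z, ball z -> 0 <= f z) ->
  (\int[mu]_(w in p @` K) (f w * dens w)%:E <=
   \int[mu]_(z in K) (f (p z) * dens z)%:E)%E.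
Proof.
move=> pq mK KB Kfin cf f0; have [_ [pB qB qK pK]] := pq.
have cfp := hcont_on_comp_automorphism pq cf.
apply/lee_addgt0Pr => e e0.
have hf : hyperbolic_measure K \is a fin_num.
  by rewrite ge0_fin_numE ?hyperbolic_measure_ge0.
(* Slices of height 1/N cost at most the measure of K divided by N in total, which is at most e. *)
pose N : R := (fine (hyperbolic_measure K) + 1) / e.
have h0 : 0 <= fine (hyperbolic_measure K) by rewrite fine_ge0// hyperbolic_measure_ge0.
have N0 : 0 < N by rewrite divr_gt0// ltr_wpDl.
pose E j := K `&` [set z | (j%:R <= N * f (p z) < j.+1%:R)].
have cN : hcont_on ball (fun z => N * f (p z)).
  move=> z z1 r r0; have [d d0 Hd] := cfp z z1 (r / N) (divr_gt0 r0 N0).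
  exists d => // w /Hd; rewrite -mulrBr normrM gtr0_norm// ltr_pdivlMr// mulrC.
  exact.
have mE j : lebesgue_measurable (E j).
  have -> : E j = K `&` ((ball `&` [set z | N * f (p z) < j.+1%:R]) `\`
      (ball `&` [set z | N * f (p z) < j%:R])).
    apply/seteqP; split => z.
      move=> [Kz /= /andP[h1 h2]]; split => //; split; first by split => //; exact: KB.
      by move=> [_ /=]; rewrite ltNge h1.
    move=> [Kz [[zB /= h2] nh1]]; split => //=; rewrite h2 andbT leNgt.
    by apply/negP => h1; apply: nh1.
  apply: (@measurableI _ LT) => //; apply: (@measurableD _ LT).
    exact/hopen_measurable/(hopen_lt (@hopen_unit_ball R m) cN).
  exact/hopen_measurable/(hopen_lt (@hopen_unit_ball R m) cN).
have EB j : E j `<=` ball by move=> z [/KB].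
have tE : trivIset setT E.
  move=> i j _ _ [z [[_ /= /andP[i1 i2]] [_ /= /andP[j1 j2]]]].
  have := le_lt_trans i1 j2; have := le_lt_trans j1 i2.
  by rewrite !ltr_nat !ltnS => ji ij; apply/eqP; rewrite eqn_leq ij ji.
have KE : K = \bigcup_j E j.
  apply/seteqP; split => [z Kz|z [j _ []]//].
  exists (Num.truncn (N * f (p z))) => //; split => //=.
  by apply: truncn_itv; rewrite mulr_ge0 ?f0 ?ltW//; apply/pB/KB.
have mpE j := image_automorphism_measurable pq (mE j) (EB j).
have pEB j := image_automorphism_sub pq (EB j).
have tpE : trivIset setT (fun j => p @` E j).
  move=> i j _ _ [z [[w1 w1E <-] [w2 w2E]]] => /(congr1 q).
  rewrite (qK _ (EB _ _ w2E)) (qK _ (EB _ _ w1E)) => E21.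
  by apply: tE => //; exists w1; split => //; rewrite -E21.
have pKE : p @` K = \bigcup_j p @` E j by rewrite {1}KE image_bigcup.
have mpK := image_automorphism_measurable pq mK KB.
have pKB := image_automorphism_sub pq KB.
(* On a slice f o p is at least j/N, and on its image f is at most (j + 1)/N; both have the same
   hyperbolic measure. *)
have piece j : (\int[mu]_(w in p @` E j) (f w * dens w)%:E <=
    \int[mu]_(z in E j) (f (p z) * dens z)%:E + N^-1%:E * hyperbolic_measure (E j))%E.
  apply: (@le_trans _ _ ((j.+1%:R / N)%:E * hyperbolic_measure (p @` E j))%E).
    rewrite /hyperbolic_measure -(@ge0_integralZl _ LT); last 4 first.
    - exact: mpE.
    - exact: measurable_density (mpE j) (@pEB j).
    - by move=> z _; rewrite lee_fin hyperbolic_density_ge0.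
    - by rewrite lee_fin divr_ge0// ltW.
    apply: (@ge0_le_integral _ LT); first exact: mpE.
    - by move=> z /pEB z1; rewrite lee_fin mulr_ge0 ?f0// hyperbolic_density_ge0.
    - by apply/measurable_EFinP; exact: measurable_mul_density (mpE j) (@pEB j) cf.
    - by apply: measurable_funeM; exact: measurable_density (mpE j) (@pEB j).
    move=> _ [z [_ /= /andP[_ h2]] <-]; rewrite -EFinM lee_fin.
    apply: ler_wpM2r; first exact: hyperbolic_density_ge0.
    by rewrite ler_pdivlMr// mulrC ltW.
  rewrite (hyperbolic_measure_image pq (mE j) (EB j)).
  have jN : (0 <= (j%:R / N)%:E)%E by rewrite lee_fin divr_ge0// ltW.
  have iN : (0 <= N^-1%:E)%E by rewrite lee_fin invr_ge0 ltW.
  rewrite -natr1 mulrDl mul1r EFinD (ge0_muleDl _ jN iN).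
  apply: leeD2r.
  rewrite /hyperbolic_measure -(@ge0_integralZl _ LT); last 4 first.
  - exact: mE.
  - exact: measurable_density (mE j) (@EB j).
  - by move=> z _; rewrite lee_fin hyperbolic_density_ge0.
  - by rewrite lee_fin divr_ge0// ltW.
  apply: (@ge0_le_integral _ LT); first exact: mE.
  - by move=> z _; rewrite -EFinM lee_fin mulr_ge0 ?hyperbolic_density_ge0// divr_ge0// ltW.
  - by apply: measurable_funeM; exact: measurable_density (mE j) (@EB j).
  - by apply/measurable_EFinP; exact: (@measurable_mul_density _ (f \o p) (mE j) (@EB j)).
  move=> z [_ /= /andP[h1 _]]; rewrite -EFinM lee_fin.
  apply: ler_wpM2r; first exact: hyperbolic_density_ge0.
  by rewrite ler_pdivrMr// mulrC.
have I1 : (\int[mu]_(w in p @` K) (f w * dens w)%:E =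
    \sum_(j <oo) \int[mu]_(w in p @` E j) (f w * dens w)%:E)%E.
  rewrite pKE; apply: (@ge0_integral_bigcup _ LT) => //.
    by rewrite -pKE; apply/measurable_EFinP; exact: measurable_mul_density.
  by rewrite -pKE => z /pKB z1; rewrite lee_fin mulr_ge0 ?f0// hyperbolic_density_ge0.
have fp0 z : ball z -> (0 <= (f (p z) * dens z)%:E)%E.
  by move=> z1; rewrite lee_fin mulr_ge0 ?hyperbolic_density_ge0//; apply/f0/pB.
have I2 : (\int[mu]_(z in K) (f (p z) * dens z)%:E =
    \sum_(j <oo) \int[mu]_(z in E j) (f (p z) * dens z)%:E)%E.
  rewrite {1}KE; apply: (@ge0_integral_bigcup _ LT) => //.
    by rewrite -KE; apply/measurable_EFinP; exact: (@measurable_mul_density _ (f \o p)).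
  by rewrite -KE => z /KB; exact: fp0.
rewrite I1; apply: (@le_trans _ _ (\sum_(j <oo) (\int[mu]_(z in E j) (f (p z) * dens z)%:E
    + N^-1%:E * hyperbolic_measure (E j)))%E).
  apply: lee_nneseries => [j _ _|j _]; last exact: piece.
  by apply: integral_ge0 => z /pEB z1; rewrite lee_fin mulr_ge0 ?f0// hyperbolic_density_ge0.
rewrite nneseriesD; last 2 first.
- by move=> j _ _; apply: integral_ge0 => z /EB; exact: fp0.
- by move=> j _ _; rewrite mule_ge0 ?hyperbolic_measure_ge0// lee_fin invr_ge0 ltW.
rewrite -I2; apply: leeD2l; rewrite nneseriesZl; last by move=> j _; exact: hyperbolic_measure_ge0.
rewrite -hyperbolic_measure_bigcup// -KE -(fineK hf) -EFinM lee_fin /N invf_div.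
by rewrite mulrAC ler_pdivrMr ?ltr_wpDl// ler_pM2l// lerDl.
Qed.

(** The reverse inequality is [integral_image_le] for the inverse q, the set p(K) and the function f
    o p. *)
Lemma integral_image p q K f : inverse_automorphisms p q ->
  lebesgue_measurable K -> K `<=` ball -> (hyperbolic_measure K < +oo)%E ->
  hcont_on ball f -> (forall z, ball z -> 0 <= f z) ->
  (\int[mu]_(w in p @` K) (f w * dens w)%:E =
   \int[mu]_(z in K) (f (p z) * dens z)%:E)%E.
Proof.
move=> pq mK KB Kfin cf f0; apply/eqP; rewrite eq_le (integral_image_le pq)//=.
have mpK := image_automorphism_measurable pq mK KB.
have pKB := image_automorphism_sub pq KB.
have pKfin : (hyperbolic_measure (p @` K) < +oo)%E.
  by rewrite (hyperbolic_measure_image pq).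
have [_ [pB qB qK pK]] := pq.
have fp0 z : ball z -> 0 <= f (p z) by move=> z1; apply/f0/pB.
have := integral_image_le (inverse_automorphisms_sym pq) mpK pKB pKfin
  (hcont_on_comp_automorphism pq cf) fp0.
rewrite (image_imageK pq KB) => /le_trans; apply.
rewrite le_eqVlt; apply/orP; left; apply/eqP; apply: eq_integral => w /set_mem /pKB w1.
by rewrite /= pK.
Qed.

End ChangeOfVariables.

(** * Hyperbolic integrals of vector-valued maps *)

Section HyperbolicIntegral.
Variables (R : realType) (m : nat).
Local Notation C := R[i].
Local Notation V := 'rV[C]_m.
Local Notation lam := (@lebesgue_outer R m).
Local Notation mu := (lebesgue_Cm R m).
Local Notation ball := (@unit_ball R m).
Local Notation dens := (@hyperbolic_density R m).
Local Notation LT := (lebesgue_type R m).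
Implicit Types (z w a : V) (K : set V) (p q : V -> V) (f g : V -> R).

Definition hintegrable K f := mu.-integrable K (EFin \o ((fun z => f z * dens z) : LT -> R)).

Definition hintegral K f : R := Rintegral mu K (fun z => f z * dens z).

Lemma hintegral_lin K f g (a b : R) : lebesgue_measurable K ->
  hintegrable K f -> hintegrable K g ->
  hintegrable K (fun z => a * f z + b * g z) /\
  hintegral K (fun z => a * f z + b * g z) = a * hintegral K f + b * hintegral K g.
Proof.
move=> mK If Ig; have Iaf := integrableZl mK a If; have Ibg := integrableZl mK b Ig.
split.
  apply: eq_integrable (integrableD mK Iaf Ibg) => // z _ /=.
  by rewrite -!EFinM -EFinD mulrDl !mulrA.
rewrite /hintegral -!RintegralZl// -RintegralD//.
by apply: eq_Rintegral => z _; rewrite mulrDl !mulrA.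
Qed.

Lemma hintegrable_bounded K f (M : R) : lebesgue_measurable K -> K `<=` ball ->
  (hyperbolic_measure K < +oo)%E -> hcont_on ball f ->
  (forall z, ball z -> `|f z| <= M) -> hintegrable K f.
Proof.
move=> mK KB Kfin cf fM.
have Id : mu.-integrable K (EFin \o (dens : LT -> R)).
  apply/integrableP; split; first exact: measurable_density.
  apply: le_lt_trans Kfin; rewrite le_eqVlt; apply/orP; left; apply/eqP.
  by apply: eq_integral => z _; rewrite /= ger0_norm// hyperbolic_density_ge0.
apply: (le_integrable mK _ _ (integrableZl mK M Id)).
  by apply/measurable_EFinP; exact: measurable_mul_density.
move=> z /KB /fM h; rewrite -EFinM !abse_EFin lee_fin !normrM.
by apply: ler_wpM2r => //; exact: le_trans (ler_norm M).
Qed.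

Lemma hintegral_image p q K f (i0 : 'I_m) : (0 < lam (hcube 1 0))%E ->
  inverse_automorphisms p q ->
  lebesgue_measurable K -> K `<=` ball -> (hyperbolic_measure K < +oo)%E ->
  hcont_on ball f -> (forall z, ball z -> `|f z| <= 1) ->
  hintegral (p @` K) f = hintegral K (f \o p).
Proof.
move=> Q0 pq mK KB Kfin cf f1; have [_ [pB _ _ _]] := pq.
have mpK := image_automorphism_measurable i0 Q0 pq mK KB.
have pKB := image_automorphism_sub pq KB.
have pKfin : (hyperbolic_measure (p @` K) < +oo)%E.
  by rewrite (hyperbolic_measure_image i0 Q0 pq).
have c1 : hcont_on ball (fun=> 1) by move=> z _ e e0; exists 1 => // w _; rewrite subrr normr0.
have b1 z : ball z -> `|1 : R| <= 1 by rewrite normr1.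
have cfp := hcont_on_comp_automorphism pq cf.
have fp1 z : ball z -> `|f (p z)| <= 1 by move=> /pB /f1.
have I1 A mA AB Afin : hintegrable A (fun=> 1) := @hintegrable_bounded A _ 1 mA AB Afin c1 b1.
(* The bound |f| <= 1 makes f + 1 nonnegative; the constant is subtracted at the end, its integral
   being finite on K and on p(K). *)
have cf1 : hcont_on ball (fun z => f z + 1).
  move=> z zB e e0; have [d d0 Hd] := cf z zB e e0; exists d => // w /Hd.
  by rewrite opprD addrACA subrr addr0.
have f10 z : ball z -> 0 <= f z + 1.
  by move=> /f1; rewrite ler_norml => /andP[h _]; rewrite -lerBlDr sub0r.
have E : hintegral (p @` K) (fun z => f z + 1) = hintegral K (fun z => f (p z) + 1).
  by congr fine; exact: (integral_image i0 Q0 pq mK KB Kfin cf1 f10).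
have E1 : hintegral (p @` K) (fun=> 1) = hintegral K (fun=> 1).
  have c0 z : ball z -> 0 <= (fun=> 1 : R) z by [].
  by congr fine; exact: (integral_image i0 Q0 pq mK KB Kfin c1 c0).
have [_ L1] := hintegral_lin 1 1 mpK (hintegrable_bounded mpK pKB pKfin cf f1) (I1 _ mpK pKB pKfin).
have [_ L2] := hintegral_lin 1 1 mK (hintegrable_bounded mK KB Kfin cfp fp1) (I1 _ mK KB Kfin).
have e1 A g : hintegral A (fun z => g z + 1) = hintegral A (fun z => 1 * g z + 1 * 1).
  by apply: eq_Rintegral => z _; rewrite !mul1r.
move: E; rewrite e1 L1 (e1 K (f \o p)) L2 !mul1r E1.
exact: addIr.
Qed.

Definition cintegrable K (f : V -> C) :=
  hintegrable K (fun z => complex.Re (f z)) /\ hintegrable K (fun z => complex.Im (f z)).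

Definition cintegral K (f : V -> C) : C :=
  hintegral K (fun z => complex.Re (f z)) +i* hintegral K (fun z => complex.Im (f z)).

Lemma cintegralD K (f g : V -> C) : lebesgue_measurable K ->
  cintegrable K f -> cintegrable K g -> cintegrable K (fun z => f z + g z) /\
  cintegral K (fun z => f z + g z) = cintegral K f + cintegral K g.
Proof.
move=> mK [f1 f2] [g1 g2].
have [h1 e1] := hintegral_lin 1 1 mK f1 g1; have [h2 e2] := hintegral_lin 1 1 mK f2 g2.
have E1 : (fun z => complex.Re (f z + g z)) =
    (fun z => 1 * complex.Re (f z) + 1 * complex.Re (g z)).
  by apply/funext => z; case: (f z) => x y; case: (g z) => x' y' /=; rewrite !mul1r.
have E2 : (fun z => complex.Im (f z + g z)) =
    (fun z => 1 * complex.Im (f z) + 1 * complex.Im (g z)).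
  by apply/funext => z; case: (f z) => x y; case: (g z) => x' y' /=; rewrite !mul1r.
by rewrite /cintegrable /cintegral E1 E2; split => //; rewrite e1 e2 !mul1r.
Qed.

Lemma cintegralZr K (f : V -> C) c : lebesgue_measurable K -> cintegrable K f ->
  cintegrable K (fun z => f z * c) /\ cintegral K (fun z => f z * c) = cintegral K f * c.
Proof.
case: c => a b mK [f1 f2].
have [h1 e1] := hintegral_lin a (- b) mK f1 f2; have [h2 e2] := hintegral_lin b a mK f1 f2.
have E1 : (fun z => complex.Re (f z * (a +i* b))) =
    (fun z => a * complex.Re (f z) + - b * complex.Im (f z)).
  by apply/funext => z; case: (f z) => x y /=; ring.
have E2 : (fun z => complex.Im (f z * (a +i* b))) =
    (fun z => b * complex.Re (f z) + a * complex.Im (f z)).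
  by apply/funext => z; case: (f z) => x y /=; ring.
rewrite /cintegrable /cintegral E1 E2; split => //; rewrite e1 e2.
by apply/eqP; rewrite eq_complex /=; apply/andP; split; apply/eqP; ring.
Qed.

Lemma cintegral_sum K (I : Type) (s : seq I) (F : I -> V -> C) : lebesgue_measurable K ->
  (forall i, cintegrable K (F i)) -> cintegrable K (fun z => \sum_(i <- s) F i z) /\
  cintegral K (fun z => \sum_(i <- s) F i z) = \sum_(i <- s) cintegral K (F i).
Proof.
move=> mK IF; elim: s => [|i s [IHi IHe]].
  have E0 : hintegrable K (fun=> 0) /\ hintegral K (fun=> 0) = 0.
    have E : (fun z => (fun=> 0 : R) z * dens z) = (fun=> 0) by apply/funext => z; rewrite mul0r.
    rewrite /hintegrable /hintegral E; split; first exact: integrable0.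
    by rewrite /Rintegral integral0.
  have E z : \sum_(i <- [::]) F i z = 0 by rewrite big_nil.
  rewrite (funext E) big_nil /cintegrable /cintegral /=.
  by case: E0 => E1 E2; rewrite E2.
have E z : \sum_(j <- i :: s) F j z = F i z + \sum_(j <- s) F j z by rewrite big_cons.
by rewrite (funext E) big_cons -IHe; exact: cintegralD.
Qed.

Lemma hyperbolic_integral_mulmx K (f : V -> V) (U : 'M[C]_m) : lebesgue_measurable K ->
  (forall k, cintegrable K (fun z => f z 0 k)) ->
  hyperbolic_integral K (fun z => f z *m U) = hyperbolic_integral K f *m U.
Proof.
move=> mK If; apply/rowP => k; rewrite !mxE -/(cintegral K (fun z => (f z *m U) 0 k)).
have E z : (f z *m U) 0 k = \sum_j f z 0 j * U j k by rewrite mxE.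
have IF j := cintegralZr (U j k) mK (If j).
rewrite (funext E) (cintegral_sum _ mK (fun j => (IF j).1)).2.
by apply: eq_bigr => j _; rewrite (IF j).2 mxE.
Qed.

Lemma ball_involution_coord a t k : unit_ball a ->
  hcont_on ball (fun z => rcoord t (ball_involution a z 0 k)) /\
  forall z, ball z -> `|rcoord t (ball_involution a z 0 k)| <= 1.
Proof.
move=> a1; split.
  exact: (hcontV_rcoord t k (hholo_hcontV (hholo_ball_involution a1))).
move=> z z1; apply: (@le_trans _ _ (cabs (ball_involution a z 0 k))).
  by case: t; [exact: normRe_le_cabs|exact: normIm_le_cabs].
apply: le_trans (cabs_le_hnorm _ k) _; exact/ltW/ball_involution_ball.
Qed.

Lemma barycenter_integral_image p q K (i0 : 'I_m) : (0 < lam (hcube 1 0))%E ->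
  ball_automorphism p -> inverse_automorphisms p q ->
  lebesgue_measurable K -> K `<=` ball -> (hyperbolic_measure K < +oo)%E ->
  forall a, unit_ball a ->
  hyperbolic_integral (p @` K) (ball_involution (p a)) = 0 <->
  hyperbolic_integral K (ball_involution a) = 0.
Proof.
move=> Q0 ap pq mK KB Kfin a a1; have [_ [pB _ _ _]] := pq.
have [U [UE uU]] := automorphism_transport ap a1.
have -> : hyperbolic_integral (p @` K) (ball_involution (p a)) =
    hyperbolic_integral K (ball_involution a) *m U.
  rewrite -hyperbolic_integral_mulmx//; last first.
    move=> k; split.
      have [h1 h2] := ball_involution_coord true k a1.
      exact: hintegrable_bounded h1 h2.
    have [h1 h2] := ball_involution_coord false k a1.
    exact: hintegrable_bounded h1 h2.
  have im t k : hintegral (p @` K) (fun z => rcoord t (ball_involution (p a) z 0 k)) =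
      hintegral K (fun z => rcoord t ((ball_involution a z *m U) 0 k)).
    have [h1 h2] := ball_involution_coord t k (pB _ a1).
    rewrite (hintegral_image i0 Q0 pq mK KB Kfin h1 h2).
    by apply: eq_Rintegral => z /set_mem /KB z1 /=; rewrite UE.
  by apply/rowP => k; rewrite !mxE; congr (_ +i* _); [exact: (im true k)|exact: (im false k)].
have uU' := unitary_row_unit uU; split => [E|->]; last by rewrite mul0mx.
by rewrite -(mulmxK uU' (hyperbolic_integral _ _)) E mul0mx.
Qed.

(** If the unit cube were null, so would be every cube by scaling, and K lies in a cube; then K
    would have no hyperbolic measure. *)
Lemma lam_unit_hcube_gt0 K : lebesgue_measurable K -> K `<=` ball ->
  (0 < hyperbolic_measure K)%E -> (0 < lam (hcube 1 0))%E.
Proof.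
move=> mK KB K0; rewrite lt0e lebesgue_outer_ge0 andbT; apply/eqP => Q0.
have [b Hb] := @ball_sub_hcube R m 0 1 ltr01.
have K0' : lam K = 0%E.
  apply/eqP; rewrite eq_le lebesgue_outer_ge0 andbT.
  have <- : lam (hcube (3 * 1) b) = 0%E.
    by rewrite (lam_hcube b (mulr_gt0 _ ltr01))// Q0 mule0.
  by apply: le_lebesgue_outer => z /KB /ltW z1; apply: Hb; rewrite /= subr0.
by move: K0; rewrite /hyperbolic_measure null_set_integral ?ltxx//; exact: measurable_density.
Qed.

End HyperbolicIntegral.

Theorem theorem5p6 (R : realType) (m : nat) (m_gt0 : (0 < m)%N)
  (K : set 'rV[R[i]]_m)
  (mK : lebesgue_measurable K)
  (KB : K `<=` @unit_ball R m)
  (K_gt0 : (0 < hyperbolic_measure K)%E)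
  (K_fin : (hyperbolic_measure K < +oo)%E)
  (c : 'rV[R[i]]_m) (hc : is_holomorphic_barycenter K c)
  (p : 'rV[R[i]]_m -> 'rV[R[i]]_m) (hp : ball_automorphism p) :
  is_holomorphic_barycenter (p @` K) (p c).
Proof.
Proof.
(* Positivity of m provides a coordinate axis along which the centre of an involution can be
   aligned. *)
have Q0 := lam_unit_hcube_gt0 mK KB K_gt0; have i0 := Ordinal m_gt0.
have [_ [[c1 c0] cU]] := hc; have [hp1 [q [hq pB qB qK pK]]] := hp.
have pq : inverse_automorphisms p q by split.
have im := barycenter_integral_image i0 Q0 hp pq mK KB K_fin.
split; last split.
- split; first exact: (image_automorphism_measurable i0 Q0 pq mK KB).
  + exact: (image_automorphism_sub pq KB).
  + by rewrite (hyperbolic_measure_image i0 Q0 pq mK KB).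
  + by rewrite (hyperbolic_measure_image i0 Q0 pq mK KB).
- by split; [exact: pB|apply/(im c c1)].
(* Any barycenter x of p(K) is p(q x), and q x then satisfies the equation for K, so it equals c. *)
move=> x [x1]; rewrite -(pK x x1) => x0; congr p; apply: cU.
exact: conj (qB x x1) ((im _ (qB x x1)).1 x0).
Qed.
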